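(* Let $(\rho,\hat\theta_\rho)$, $\rho\in\mathcal P$, constitute a mean field equilibrium. Consider the $NM$-agent system in which, at time $0$, the queue lengths of the agents are set independently across agents according to $\Pi_\rho$, and the initial beliefs are consistent with this ($\mu_{1,0}=\Pi_\rho$). Suppose all agents except agent $1$ play the policy $\hat\theta_\rho$. Then for any policies $\theta^N$ of agent $1$ (one for each $N$, possibly history dependent) and any $q\in\mathbb R^+$, $$\limsup_{N\to\infty}\Big(V^{N}_{1,\mu_{1,0}}\big(q;\hat\theta_\rho,(\hat\theta_\rho)_{-1}\big)-V^{N}_{1,\mu_{1,0}}\big(q;\theta^N,(\hat\theta_\rho)_{-1}\big)\Big)\le 0 .$$
   Context: Notation: $\mathbb R^+=[0,\infty)$, $z^+=\max(z,0)$. Fix an integer $M\ge 2$ and $\beta\in(0,1)$. Let $\Phi$ be a probability distribution (of job arrivals) on $[0,\bar A]$, $\bar A<\infty$, with a bounded density, and let $\Psi$ be a probability distribution (of regeneration values) on $\mathbb R^+$ with a bounded density. The holding cost $C:\mathbb R^+\to\mathbb R^+$ is continuous, increasing, strictly convex, and $C(q)=O(q^m)$ for some integer $m$. $\mathcal P=\{G: G \text{ is a continuous c.d.f. of a probability measure on }\mathbb R^+,\ \int_0^\infty(1-G(x))\,dx<E\}$ for a fixed finite $E$. Mean field objects. For $\rho\in\mathcal P$: $p_\rho(x)=\rho(x)^{M-1}$, $r_\rho(x)=xp_\rho(x)-\int_0^xp_\rho(u)\,du$. $\hat V_\rho(q)=\inf_\theta\mathbb E\big[\sum_{t\ge0}\beta^t(C(Q_t)+r_\rho(\theta(Q_t)))\mid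 Q_0=q\big]$, the infimum over measurable $\theta:\mathbb R^+\to\mathbb R^+$, where, given $Q_t$, $Q_{t+1}=(Q_t-1)^++A_t$ with probability $p_\rho(\theta(Q_t))$ and $Q_{t+1}=Q_t+A_t$ otherwise, $A_t$ i.i.d. $\sim\Phi$. The optimal policy is $\hat\theta_\rho(q)=\beta\,\mathbb E_{A\sim\Phi}[\hat V_\rho(q+A)-\hat V_\rho((q-1)^++A)]$. $\Pi_\rho$ is the unique invariant distribution of the chain with kernel $\mathbb P(Q_{k+1}\in B\mid Q_k=q)=\beta p_\rho(\hat\theta_\rho(q))\mathbb P((q-1)^++A\in B)+\beta(1-p_\rho(\hat\theta_\rho(q)))\mathbb P(q+A\in B)+(1-\beta)\Psi(B)$, $A\sim\Phi$. $(\rho,\hat\theta_\rho)$ is a mean field equilibrium if $\rho(x)=\Pi_\rho(\hat\theta_\rho^{-1}([0,x]))$ for all $x\in\mathbb R^+$. Finite system. There are $N$ cells and $NM$ agents, each with a queue length (state) in $\mathbb R^+$. At each time $t=0,1,2,\dots$: the agents are assigned by a uniformly random permutation (independent over time and of everything else) to the $N$ cells, exactly $M$ per cell; each agent submits a bid in $\mathbb R^+$; in each cell the highest bidder wins (ties broken uniformly at random), receives one unit of service, and pays the second highest bid in the cell, while losers pay nothing. Then, independently for each agent, with probability $\beta$ its queue length $q$ becomes $(q-1)^++A$ if it won and $q+A$ if it lost, with fresh $A\sim\Phi$; with probability $1-\beta$ the agent regenerates and its queue length becomes a fresh sample from $\Psi$. An agent playing a stationary policy $\theta$ bids $\theta(q)$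 when its queue length is $q$. A history-dependent policy of agent $1$ maps its current queue length together with its own history (its past states, its past bids, the auctions it won, and the payments it made) measurably to a bid in $\mathbb R^+$. Cost. $V^N_{1,\mu_{1,0}}(q;\theta,(\hat\theta_\rho)_{-1})$ is the expected total of holding cost $C(Q_1(t))$ plus auction payment of agent $1$, summed over times $t=0,1,\dots$ up to its first regeneration (so that the time-$t$ term is incurred with probability $\beta^t$), when agent $1$ starts with queue length $q$ and uses policy $\theta$, all other agents use $\hat\theta_\rho$, and the initial queue lengths of the other agents are i.i.d. $\mu_{1,0}=\Pi_\rho$. *)

(* Defs.v *)
From HB Require Import structures.
From mathcomp Require Import all_boot all_order all_algebra all_fingroup.
From mathcomp Require Import all_classical all_reals all_analysis.

Set Implicit Arguments.
Unset Strict Implicit.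
Unset Printing Implicit Defensive.

Import Order.TTheory GRing.Theory Num.Theory.
Import numFieldNormedType.Exports.

Local Open Scope classical_set_scope.
Local Open Scope ring_scope.

(* Functions on R^+ are represented by functions on R; their values at negative
   arguments are irrelevant, and no hypothesis constrains them unless stated.
   Accordingly expectations over R^+-valued variables are taken over nneg. *)
Definition nneg (R : realType) : set R := `[0, +oo[%classic.
Arguments nneg : clear implicits.

Section Data.
Variable R : realType.

Definition has_bounded_density (mu : probability R R) : Prop :=
  exists (f : R -> R) (B : R),
    [/\ measurable_fun setT f,
        forall x, 0 <= f x <= B
      & forall A : set R, measurable A ->
          mu A = (\int[lebesgue_measure]_(x in A) (f x)%:E)%E].

Definition arrival_distribution (Abar : R) (Phi : probability R R) : Prop :=
  Phi `[0, Abar]%classic = 1%E /\ has_bounded_density Phi.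

Definition regeneration_distribution (Psi : probability R R) : Prop :=
  Psi (nneg R) = 1%E /\ has_bounded_density Psi.

Definition holding_cost (C : R -> R) : Prop :=
  [/\ forall q, 0 <= q -> 0 <= C q,
      {within nneg R, continuous C},
      {in nneg R &, {homo C : x y / x <= y}},
      (forall x y t, 0 <= x -> 0 <= y -> x != y -> 0 < t < 1 ->
         C (t * x + (1 - t) * y) < t * C x + (1 - t) * C y)
    & exists (m : nat) (K : R), \forall q \near +oo, C q <= K * q ^+ m].

(* Continuity is required on all of R: in particular there is no atom at 0. *)
Definition bid_cdf (E : R) (G : R -> R) : Prop :=
  [/\ exists mu : probability R R,
        mu (nneg R) = 1%E /\ forall x, (G x)%:E = mu `]-oo, x]%classic,
      continuous G
    & (\int[lebesgue_measure]_(x in nneg R) (1 - G x)%:E < E%:E)%E].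

Definition served (q : R) : R := Num.max (q - 1) 0.

End Data.

Section MeanField.
Variables (R : realType) (M : nat) (beta : R) (C : R -> R).
Variables (Phi Psi : probability R R) (rho : R -> R).

Definition win_prob (x : R) : R := rho x ^+ M.-1.

Definition mean_payment (x : R) : R :=
  x * win_prob x - \int[lebesgue_measure]_(u in `[0, x]) win_prob u.

Definition stationary_policy (theta : R -> R) : Prop :=
  measurable_fun setT theta /\ forall q, 0 <= theta q.

(* E[f(Q_{t+1}) | Q_t = q] for the mean field chain controlled by theta. *)
Definition mf_transition (theta : R -> R) (f : R -> \bar R) (q : R) : \bar R :=
  ((win_prob (theta q))%:E * \int[Phi]_(a in nneg R) f (served q + a)%R
   + (1 - win_prob (theta q))%:E * \int[Phi]_(a in nneg R) f (q + a)%R)%E.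

Definition mf_cost (theta : R -> R) (q : R) : \bar R :=
  (C q + mean_payment (theta q))%:E.

(* By the Markov property E[g(Q_t) | Q_0 = q] is the t-th iterate of the
   transition operator applied to g, evaluated at q. *)
Definition mf_policy_value (theta : R -> R) (q : R) : \bar R :=
  (\sum_(0 <= t <oo)
     (beta ^+ t)%:E * iter t (mf_transition theta) (mf_cost theta) q)%E.

Definition mf_value (q : R) : \bar R :=
  ereal_inf [set mf_policy_value theta q | theta in stationary_policy].

Definition mf_policy (q : R) : R :=
  beta * fine (\int[Phi]_(a in nneg R)
                 (mf_value (q + a)%R - mf_value (served q + a)%R))%E.

Definition mf_kernel (q : R) (B : set R) : \bar R :=
  ((beta * win_prob (mf_policy q))%:E * Phi [set a | B (served q + a)%R]
   + (beta * (1 - win_prob (mf_policy q)))%:E * Phi [set a | B (q + a)%R]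
   + (1 - beta)%:E * Psi B)%E.

Definition invariant_distribution (Pi : probability R R) : Prop :=
  Pi (nneg R) = 1%E /\
  forall B : set R, measurable B ->
    Pi B = (\int[Pi]_(q in nneg R) mf_kernel q B)%E.

Definition mean_field_equilibrium (Pi : probability R R) : Prop :=
  invariant_distribution Pi /\
  forall x, 0 <= x ->
    (rho x)%:E = Pi [set q | 0 <= q /\ 0 <= mf_policy q <= x].

End MeanField.

Section Independence.
Context d (Om : measurableType d) (R : realType) (P : probability Om R).

Definition mutually_independent (J : Type) (F : J -> set (set Om)) : Prop :=
  forall (n : nat) (j : 'I_n -> J) (A : 'I_n -> set Om),
    injective j -> (forall k, F (j k) (A k)) ->
    P (\big[setI/setT]_(k < n) A k) = (\prod_(k < n) P (A k))%E.

Definition has_law (X : Om -> R) (mu : probability R R) : Prop :=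
  [/\ measurable_fun setT X, forall w, 0 <= X w
    & forall B : set R, measurable B -> P (X @^-1` B) = mu B].

Definition uniform_perm (n : nat) (s : Om -> 'S_n) : Prop :=
  forall p : 'S_n, measurable (s @^-1` [set p]) /\
                   P (s @^-1` [set p]) = (n`!%:R^-1)%:E.

Definition bernoulli_coin (beta : R) (X : Om -> bool) : Prop :=
  measurable_fun setT X /\ P (X @^-1` [set true]) = beta%:E.

End Independence.

(* Sources of randomness of a system with n agents; the random permutation
   [tiebreak] ranks the agents, and the lowest rank wins a tie. *)
Record noise (R : realType) (n : nat) (Om : Type) := Noise {
  init : 'I_n -> Om -> R;
  assign : nat -> Om -> 'S_n;
  tiebreak : nat -> Om -> 'S_n;
  arrival : nat -> 'I_n -> Om -> R;
  survives : nat -> 'I_n -> Om -> bool;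
  fresh : nat -> 'I_n -> Om -> R }.

Inductive source (n : nat) :=
  | Init of 'I_n
  | Assign of nat
  | Tiebreak of nat
  | Arrival of nat & 'I_n
  | Survives of nat & 'I_n
  | Fresh of nat & 'I_n.

Section NoiseLaw.
Context d (Om : measurableType d) (R : realType) (P : probability Om R).
Variables (n : nat) (X : noise R n Om).

Definition source_events (j : source n) : set (set Om) :=
  match j with
  | Init i => preimage_set_system setT (init X i) measurable
  | Assign t => preimage_set_system setT (assign X t) setT
  | Tiebreak t => preimage_set_system setT (tiebreak X t) setT
  | Arrival t i => preimage_set_system setT (arrival X t i) measurable
  | Survives t i => preimage_set_system setT (survives X t i) setT
  | Fresh t i => preimage_set_system setT (fresh X t i) measurable
  end.

Definition noise_law (beta : R) (Phi Psi Pi : probability R R) : Prop :=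
  [/\ mutually_independent P source_events,
      forall i, has_law P (init X i) Pi,
      forall t, uniform_perm P (assign X t) /\ uniform_perm P (tiebreak X t),
      forall t i, has_law P (arrival X t i) Phi /\ has_law P (fresh X t i) Psi
    & forall t i, bernoulli_coin P beta (survives X t i)].

End NoiseLaw.

(* (queue length, bid, auction won, payment) at one past time. *)
Notation stage R := (R * R * bool * R)%type.

(* [theta h q]: bid at queue length q after the history h, most recent stage
   first. *)
Definition history_policy (R : realType) (theta : seq (stage R) -> R -> R) :
    Prop :=
  (forall t : nat, measurable_fun setT
     (fun z : t.-tuple (stage R) * R => theta z.1 z.2)) /\
  forall h q, 0 <= theta h q.

Definition markovian (R : realType) (theta : R -> R) :
    seq (stage R) -> R -> R := fun _ => theta.

Section FiniteSystem.
Variables (R : realType) (N M : nat) (Om : Type) (X : noise R (N * M) Om).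
Variables (agent1 : 'I_(N * M)) (q1 : R).
Variables (theta : seq (stage R) -> R -> R) (theta_others : R -> R).

(* [alive]: agent 1 has not regenerated yet. *)
Record state := State {
  queue : 'I_(N * M) -> R;
  hist : seq (stage R);
  alive : bool }.

Definition bid (s : state) (i : 'I_(N * M)) : R :=
  if i == agent1 then theta (hist s) (queue s i) else theta_others (queue s i).

Section Stage.
Variables (t : nat) (w : Om) (s : state).

(* The agent sent to slot k by the assignment is in cell k %/ M. *)
Definition rival (i j : 'I_(N * M)) : bool :=
  (j != i) && (assign X t w j %/ M == assign X t w i %/ M)%N.

Definition wins (i : 'I_(N * M)) : bool :=
  [forall j, rival i j ==>
     ((bid s j < bid s i) ||
      (bid s j == bid s i) && (tiebreak X t w i < tiebreak X t w j)%N)].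

(* Bids are nonnegative, so 0 is neutral for the maximum of the rival bids. *)
Definition payment (i : 'I_(N * M)) : R :=
  if wins i then \big[Num.max/0]_(j | rival i j) bid s j else 0.

Definition next_queue (i : 'I_(N * M)) : R :=
  if survives X t i w
  then (if wins i then served (queue s i) else queue s i) + arrival X t i w
  else fresh X t i w.

Definition next_state : state := State
  next_queue
  ((queue s agent1, bid s agent1, wins agent1, payment agent1) :: hist s)
  (alive s && survives X t agent1 w).

End Stage.

Fixpoint trajectory (t : nat) (w : Om) : state :=
  if t is t'.+1 then next_state t' w (trajectory t' w)
  else State (fun i => if i == agent1 then q1 else init X i w) [::] true.

Definition stage_cost (C : R -> R) (t : nat) (w : Om) : R :=
  let s := trajectory t w in
  if alive s then C (queue s agent1) + payment t w s agent1 else 0.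

End FiniteSystem.

Definition finite_value d (Om : measurableType d) (R : realType)
    (P : probability Om R) (N M : nat) (X : noise R (N * M) Om)
    (C : R -> R) (agent1 : 'I_(N * M)) (q : R)
    (theta : seq (stage R) -> R -> R) (theta_others : R -> R) : \bar R :=
  (\int[P]_w \sum_(0 <= t <oo)
     (stage_cost X agent1 q theta theta_others C t w)%:E)%E.

Lemma agents_gt0 (n M : nat) : (1 < M)%N -> (0 < n.+1 * M)%N.
Proof. by move=> hM; rewrite muln_gt0 /= ltnW. Qed.

Definition first_agent (n M : nat) (hM : (1 < M)%N) : 'I_(n.+1 * M) :=
  Ordinal (agents_gt0 n hM).

(* Main.v *)
(* Let Y be the highest of M - 1 independent rival bids in equilibrium, so that
   P(Y <= u) = p(u) = rho(u)^(M-1) and H(x) := int_0^x p = E(x - Y)^+.  The mean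
   field value W solves W = C + L - H(D), where L and S are the discounted
   expected values of W after a lost and after a won auction, and D = L - S is
   the optimal bid.  In the finite system let Y be the highest rival bid met by
   agent 1.  Given the past, a round changes [cost so far + W(queue)] in mean by
   H(D) + [win](Y - D) >= H(D) - (D - Y)^+, with equality when agent 1 bids D.
   Hence the advantage of any policy over theta_hat is at most a sum over the
   rounds of |E[H(D) - (D - Y)^+]|.  Once all the assignments and tie-breaks are
   fixed, the rivals of agent 1 are exactly i.i.d. with law Pi and independent of
   his past, unless two branches of the tree of past interactions meet, which
   has probability O(1/N) for a fixed round.  Late rounds contribute a geometric
   tail because C grows polynomially. *)

Require Import Defs.
From HB Require Import structures.
From mathcomp Require Import all_boot all_order all_algebra all_fingroup.
From mathcomp Require Import all_classical all_reals all_analysis.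
From mathcomp Require Import measurable_realfun zify ring lra.

Import Order.TTheory GRing.Theory Num.Theory.
Import numFieldNormedType.Exports.

Local Open Scope classical_set_scope.
Local Open Scope ring_scope.

Set Implicit Arguments.
Unset Strict Implicit.
Unset Printing Implicit Defensive.

(** * Growth of the holding cost and primitives of monotone functions *)

(** The policy of agent 1 may use his whole history, so no law is available for his queue, and his
    costs are not known to be finite. Hence the comparison goes through the fixed function W: an
    inequality valid for every outcome of an auction is integrated and telescoped, and only
    expectations known to be finite are cancelled. Agent 1 also disturbs the agents he meets. This
    influence disappears on the event that the trees of his rivals' past avoid his own; there the
    laws are exact, since Pi is invariant, and no approximation has to be propagated through time. W
    is built as the increasing limit of value iteration, which makes it monotone and measurable, and
    is identified with the infimum defining the mean field value afterwards. Independence is handled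
    by giving the sample space the sigma-algebra of a group of sources: measurability of a quantity
    then says which sources determine it, and disjoint groups are independent. The collision bound
    grows exponentially with the round, so it serves only for a fixed number of rounds, chosen
    before N. *)

Section Growth.
Variable R : realType.

(** Each of the k terms of the geometric sum (1 - s^k)/(1 - s) is at least s^k. *)
Lemma nat_mul_expr_le (s : R) k : 0 <= s <= 1 ->
  k%:R * s ^+ k * (1 - s) <= 1 - s ^+ k.
Proof.
move=> /andP[s0 s1]; elim: k => [|k IH]; first by rewrite !mul0r expr0 subrr.
have sk0 : 0 <= s ^+ k by rewrite exprn_ge0.
have sk1 : s ^+ k <= 1 by rewrite exprn_ile1.
rewrite -natr1 exprS.
have h1 := ler_wpM2l s0 IH.
have h2 : 0 <= (1 - s) * (1 - s * s ^+ k).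
  by rewrite mulr_ge0 ?subr_ge0// -exprS exprn_ile1.
lra.
Qed.

(** Induction on m with s split as the square of its root: one root absorbs a single linear factor,
    the other is left for the remaining power. *)
Lemma poly_mul_geometric_bounded (a b s : R) m : 0 <= a -> 0 <= b -> 0 < s < 1 ->
  exists2 K : R, 0 <= K & forall k, (a + b * k%:R) ^+ m * s ^+ k <= K.
Proof.
move=> a0 b0; elim: m s => [|m IH] s /andP[s0 s1].
  by exists 1 => // k; rewrite expr0 mul1r exprn_ile1// ltW.
have r0 : 0 < Num.sqrt s by rewrite sqrtr_gt0.
have r1 : Num.sqrt s < 1 by rewrite -[ltRHS]sqrtr1 ltr_sqrt// ltr01.
have [K K0 HK] := IH (Num.sqrt s) (introT andP (conj r0 r1)).
exists (K * (a + b / (1 - Num.sqrt s))).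
  by rewrite mulr_ge0// addr_ge0// divr_ge0// subr_ge0 ltW.
move=> k; rewrite -[in s ^+ k](sqr_sqrtr (ltW s0)) exprSr -exprM mul2n -addnn exprD.
have -> : forall x y z : R, x * y * (z * z) = (x * z) * (y * z) by move=> *; ring.
have k0 : 0 <= a + b * k%:R by rewrite addr_ge0// mulr_ge0.
have rk0 : 0 <= Num.sqrt s ^+ k by rewrite exprn_ge0// ltW.
have rk1 : Num.sqrt s ^+ k <= 1 by rewrite exprn_ile1// ltW.
apply: ler_pM => //; [by rewrite mulr_ge0// exprn_ge0|by rewrite mulr_ge0|].
rewrite mulrDl lerD//; first by rewrite ler_piMr.
rewrite -mulrA ler_wpM2l// -[leRHS]mul1r ler_pdivlMr ?subr_gt0//.
apply: le_trans (nat_mul_expr_le k _) _; first by rewrite (ltW r0) (ltW r1).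
by rewrite lerBlDr lerDl.
Qed.

(** The queue grows by at most A per round. Half of the discount, sqrt(beta)^k, pays for the
    polynomial growth of C along this worst path; the other half remains as a geometric rate. *)
Lemma holding_cost_geometric (C : R -> R) (beta A : R) : holding_cost C ->
  0 < beta < 1 -> 0 <= A -> forall q, 0 <= q ->
  exists2 K : R, 0 <= K &
    forall k, beta ^+ k * C (q + A * k%:R) <= K * Num.sqrt beta ^+ k.
Proof.
move=> [C0 _ Cm _ [m [K HC]]] /andP[b0 b1] A0 q q0.
have r0 : 0 < Num.sqrt beta by rewrite sqrtr_gt0.
have r1 : Num.sqrt beta < 1 by rewrite -[ltRHS]sqrtr1 ltr_sqrt// ltr01.
case: HC => M0 [_ HC].
(* The polynomial bound on C is available only beyond [M0]; shifting the argument by [M] brings it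
   beyond that threshold for every k, and C only increases. *)
pose M := Num.max 0 (M0 + 1).
have M_ge0 : 0 <= M by rewrite le_max lexx.
have [K1 K10 HK1] := @poly_mul_geometric_bounded (M + q) A (Num.sqrt beta) m
   (addr_ge0 M_ge0 q0) A0 (introT andP (conj r0 r1)).
exists (`|K| * K1); first by rewrite mulr_ge0.
move=> k; rewrite -[in beta ^+ k](sqr_sqrtr (ltW b0)) -exprM mul2n -addnn exprD.
rewrite mulrAC ler_wpM2r ?exprn_ge0 ?(ltW r0)//.
have k0 : 0 <= A * k%:R by rewrite mulr_ge0.
have HCM : C (q + A * k%:R) <= `|K| * (M + q + A * k%:R) ^+ m.
  apply: (@le_trans _ _ (C (M + q + A * k%:R))).
    apply: Cm; rewrite ?inE /nneg /= ?in_itv/= ?andbT ?addr_ge0// -addrA.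
    by rewrite lerDr.
  apply: (@le_trans _ _ (K * (M + q + A * k%:R) ^+ m)).
    apply: HC; rewrite -addrA; apply: (@lt_le_trans _ _ (M0 + 1)).
      by rewrite ltrDl.
    apply: (@le_trans _ _ M); first by rewrite /M le_max lexx orbT.
    by rewrite lerDl addr_ge0.
  by rewrite ler_wpM2r ?ler_norm// exprn_ge0// !addr_ge0.
apply: (@le_trans _ _ (Num.sqrt beta ^+ k * (`|K| * (M + q + A * k%:R) ^+ m))).
  by rewrite ler_wpM2l// exprn_ge0// ltW.
by rewrite mulrCA ler_wpM2l// mulrC.
Qed.

End Growth.

Section WinPrimitive.
Variables (R : realType) (p : R -> R).
Hypotheses (p_mono : {homo p : x y / x <= y}) (p01 : forall x, 0 <= p x <= 1).

(** The function H of the overview. It vanishes for x <= 0, where the interval is empty or a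
    point. *)
Definition primitive (x : R) : R := \int[lebesgue_measure]_(u in `[0, x]) p u.

Lemma monotone_integrable_itv (a b : R) :
  lebesgue_measure.-integrable `[a, b] (EFin \o p).
Proof.
apply: measurable_bounded_integrable => //.
- by rewrite /= lebesgue_measure_itv/=; case: ifPn => _; rewrite -?EFinB ?ltry.
- exact: nondecreasing_measurable.
- exists 1; split => // M M1 x _ /=; rewrite ger0_norm; have /andP[p0 p1] := p01 x => //.
  by rewrite (le_trans p1)// ltW.
Qed.

Lemma primitive_lt0 x : x <= 0 -> primitive x = 0.
Proof.
rewrite le_eqVlt => /predU1P[->|x0]; first by rewrite /primitive set_itv1 Rintegral_set1.
by rewrite /primitive set_itv_ge ?Rintegral_set0// -leNgt bnd_simp.
Qed.

Lemma primitiveB x y : 0 <= x -> x <= y ->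
  primitive y - primitive x = \int[lebesgue_measure]_(u in `]x, y]) p u.
Proof.
move=> x0 xy; rewrite /primitive Rintegral_itvB ?bnd_simp//.
exact: monotone_integrable_itv.
Qed.

(** Since p is monotone, its mean over ]x, y] lies between its end values. This replaces
    differentiation in all later estimates on H. *)
Lemma primitive_slope x y : 0 <= x -> x <= y ->
  (y - x) * p x <= primitive y - primitive x <= (y - x) * p y.
Proof.
move=> x0 xy; rewrite primitiveB//.
have mxy : measurable `]x, y] by [].
have mu : (lebesgue_measure `]x, y] = (y - x)%:E)%E.
  rewrite lebesgue_measure_itv/= lte_fin -EFinB.
  by move: xy; rewrite le_eqVlt => /predU1P[->|->]; rewrite ?ltxx ?subrr.
have ip : lebesgue_measure.-integrable `]x, y] (EFin \o p).
  apply: integrableS (monotone_integrable_itv x y) => //.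
  exact: subset_itv_oc_cc.
have ic c : lebesgue_measure.-integrable `]x, y] (EFin \o cst (c : R)).
  apply: measurable_bounded_integrable => //; first by rewrite /= mu ltry.
  exists `|c|; split => [|K cK z _ /=]; [exact: num_real|exact: ltW].
have ec c : (y - x) * c = \int[lebesgue_measure]_(u in `]x, y]) c.
  rewrite Rintegral_cst; last exact: mxy.
  rewrite mulrC; congr (_ * _); exact: esym (congr1 fine mu).
rewrite !ec; apply/andP; split; apply: le_Rintegral => //;
  by [exact: ic|move=> u; rewrite /= in_itv/= => /andP[xu uy]; apply: p_mono => //; exact: ltW].
Qed.

Lemma primitive_mono : {homo primitive : x y / x <= y}.
Proof.
move=> x y xy; have [x0|x0] := leP 0 x; last first.
  rewrite (primitive_lt0 (ltW x0)); apply: Rintegral_ge0 => u _.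
  by have /andP[] := p01 u.
rewrite -subr_ge0; have /andP[h _] := primitive_slope x0 xy.
by apply: le_trans h; rewrite mulr_ge0 ?subr_ge0//; have /andP[] := p01 x.
Qed.

Lemma primitive_ge0 x : 0 <= primitive x.
Proof. by apply: Rintegral_ge0 => u _; have /andP[] := p01 u. Qed.

Lemma primitive_lip x y : x <= y -> primitive y - primitive x <= y - x.
Proof.
have lip0 u v : 0 <= u -> u <= v -> primitive v - primitive u <= v - u.
  move=> u0 uv; have /andP[_ h] := primitive_slope u0 uv.
  by apply: le_trans h _; rewrite ler_piMr ?subr_ge0//; have /andP[] := p01 v.
move=> xy; have [x0|x0] := leP 0 x; first exact: lip0.
rewrite (primitive_lt0 (ltW x0)) subr0.
have [y0|y0] := leP 0 y; last by rewrite primitive_lt0 ?subr_ge0// ltW.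
have := lip0 _ _ (lexx 0) y0; rewrite (primitive_lt0 (lexx 0)) !subr0; lra.
Qed.

Lemma primitive_le x : 0 <= x -> primitive x <= x.
Proof. by move=> x0; have := primitive_lip x0; rewrite (primitive_lt0 (lexx 0)) !subr0. Qed.

(* The derivative in x of x p(x) - int_0^x p - p(x) D is (x - D) p'(x), whence
   the bid D is optimal. *)
Lemma primitive_optimal x D : 0 <= x -> 0 <= D ->
  - primitive D <= x * p x - primitive x - p x * D.
Proof.
move=> x0 D0; have [xD|/ltW Dx] := leP x D.
- have /andP[h _] := primitive_slope x0 xD; lra.
- have /andP[_ h] := primitive_slope D0 Dx; lra.
Qed.

End WinPrimitive.

(** * Means under the arrival law *)

Section Prob1.
Context d (T : measurableType d) (R : realType) (P : probability T R).

Lemma prob1_setC (D : set T) : measurable D -> P D = 1%E -> P (~` D) = 0%E.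
Proof. by move=> mD PD; rewrite probability_setC// PD subee. Qed.

Lemma prob1_integral (D : set T) (F : T -> \bar R) : measurable D -> P D = 1%E ->
  measurable_fun setT F -> (forall x, 0 <= F x)%E ->
  (\int[P]_(x in D) F x = \int[P]_x F x)%E.
Proof.
move=> mD PD mF F0.
rewrite [RHS](@ge0_negligible_integral _ _ _ _ _ (~` D))//.
- by rewrite setTD setCK.
- exact: measurableC.
- exact: prob1_setC.
Qed.

End Prob1.

(** The class of candidate value functions: monotonicity on the whole line gives measurability and
    bounds means over the arrivals by end values, and the Bellman operator preserves the class. *)
Definition nonneg_mono (R : realType) (f : R -> R) :=
  (forall x, 0 <= f x) /\ {homo f : x y / x <= y}.

Lemma nonneg_mono_measurable (R : realType) (f : R -> R) D :
  nonneg_mono f -> measurable D -> measurable_fun D f.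
Proof. by move=> [_ fm] mD; apply: nondecreasing_measurable. Qed.

Section Mean.
Variables (R : realType) (Phi : probability R R) (Abar : R).
Hypothesis Phi1 : Phi `[0, Abar]%classic = 1%E.
Implicit Types f g : R -> R.

Definition mean f q : R := \int[Phi]_(a in nneg R) f (q + a).

Lemma Abar_ge0 : 0 <= Abar.
Proof.
rewrite leNgt; apply/negP => A0; move: Phi1.
rewrite set_itv_ge ?measure0 ?bnd_simp -?ltNge// => /eqP.
by rewrite eq_sym onee_eq0.
Qed.

Lemma measurable_nneg : measurable (nneg R).
Proof. exact: measurable_itv. Qed.

Lemma Phi_nneg : Phi (nneg R) = 1%E.
Proof.
apply/eqP; rewrite eq_le probability_le1 ?andTb; last exact: measurable_nneg.
rewrite -Phi1; apply: le_measure; rewrite ?inE//; first exact: measurable_nneg.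
by move=> x; rewrite /nneg /= !in_itv/= => /andP[->].
Qed.

Lemma Phi_nneg_integral (F : R -> \bar R) : measurable_fun setT F ->
  (forall x, 0 <= F x)%E ->
  (\int[Phi]_(a in nneg R) F a = \int[Phi]_(a in `[0%R, Abar]) F a)%E.
Proof.
move=> mF F0; rewrite prob1_integral//; [|exact: measurable_nneg|exact: Phi_nneg].
by rewrite -(@prob1_integral _ _ _ Phi `[0, Abar]%classic).
Qed.

Lemma shift_measurable f q : nonneg_mono f ->
  measurable_fun setT (fun a : R => (f (q + a))%:E).
Proof.
move=> [_ fm]; apply/measurable_EFinP.
by apply: nondecreasing_measurable => // x y xy; apply: fm; rewrite lerD2l.
Qed.

Lemma mean_bounds f q : nonneg_mono f ->
  ((f q)%:E <= \int[Phi]_(a in nneg R) (f (q + a))%:E <= (f (q + Abar))%:E)%E.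
Proof.
move=> fP; have [f0 fm] := fP.
rewrite Phi_nneg_integral; [|exact: shift_measurable|by move=> x; rewrite lee_fin].
have mi : measurable `[0, Abar]%classic by [].
have E c : (c%:E = \int[Phi]_(a in `[0%R, Abar]) (cst c%:E a))%E.
  by rewrite integral_cst// -[LHS]mule1 -Phi1.
rewrite (E (f q)) (E (f (q + Abar))); apply/andP; split; apply: ge0_le_integral => //=.
- by move=> x _; rewrite lee_fin.
- by apply: measurable_funTS; apply: shift_measurable.
- by move=> x; rewrite in_itv/= => /andP[x0 _]; rewrite lee_fin fm// lerDl.
- by move=> x _; rewrite lee_fin.
- by apply: measurable_funTS; apply: shift_measurable.
- by move=> x; rewrite in_itv/= => /andP[_ x1]; rewrite lee_fin fm// lerD2l.
Qed.

Lemma meanE f q : nonneg_mono f ->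
  (\int[Phi]_(a in nneg R) (f (q + a))%:E = (mean f q)%:E)%E.
Proof.
move=> fP; have /andP[h1 h2] := mean_bounds q fP.
rewrite /mean /Rintegral fineK// ge0_fin_numE.
  exact: le_lt_trans h2 (ltry _).
by apply: le_trans h1; rewrite lee_fin; case: fP.
Qed.

Lemma mean_ge f q : nonneg_mono f -> f q <= mean f q.
Proof. by move=> fP; have := mean_bounds q fP; rewrite meanE// !lee_fin => /andP[]. Qed.

Lemma mean_le f q : nonneg_mono f -> mean f q <= f (q + Abar).
Proof. by move=> fP; have := mean_bounds q fP; rewrite meanE// !lee_fin => /andP[]. Qed.

Lemma mean_homo f g q q' : nonneg_mono f -> nonneg_mono g ->
  (forall a, f (q + a) <= g (q' + a)) -> mean f q <= mean g q'.
Proof.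
move=> fP gP fg; rewrite -lee_fin -!meanE//; apply: ge0_le_integral.
- exact: measurable_nneg.
- by move=> x _; rewrite lee_fin; case: fP.
- by apply: measurable_funTS; apply: shift_measurable.
- by apply: measurable_funTS; apply: shift_measurable.
- by move=> x _; rewrite lee_fin.
Qed.

Lemma mean_nonneg_mono f : nonneg_mono f -> nonneg_mono (mean f).
Proof.
move=> fP; split=> [q|q q' qq']; first by apply: le_trans (mean_ge q fP); case: fP.
by apply: mean_homo => // a; case: (fP) => _; apply; rewrite lerD2r.
Qed.

Lemma mean_cvg (F : nat -> R -> R) f q : (forall k, nonneg_mono (F k)) ->
  nonneg_mono f -> (forall x, {homo F ^~ x : m n / (m <= n)%N >-> m <= n}) ->
  (forall x, F ^~ x @ \oo --> f x) -> (fun k => mean (F k) q) @ \oo --> mean f q.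
Proof.
move=> FP fP Fm Ff; apply: fine_cvg; rewrite -meanE//.
have -> : (fun k => \int[Phi]_(a in nneg R) (F k (q + a))%:E)%E =
          (fun k => \int[Phi]_(a in nneg R) (fun a => (F k (q + a))%:E) a)%E by [].
rewrite (_ : \int[Phi]_(a in nneg R) (f (q + a))%:E =
  \int[Phi]_(a in nneg R) (limn (fun k => (F k (q + a))%:E)))%E.
  apply: cvg_monotone_convergence.
  - exact: measurable_nneg.
  - by move=> k; apply: measurable_funTS; apply: shift_measurable.
  - by move=> k x _; rewrite lee_fin; case: (FP k).
  - by move=> x _ m n mn; rewrite lee_fin; apply: Fm.
by apply: eq_integral => a _; apply/esym/cvg_lim => //; apply: cvg_EFin (Ff _); near=> n.
Unshelve. all: by end_near. Qed.

End Mean.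

(** * The Bellman equation of the mean field problem *)

Section Bellman.
Variables (R : realType) (Phi : probability R R) (Abar beta : R).
Hypothesis Phi1 : Phi `[0, Abar]%classic = 1%E.
Hypothesis beta01 : 0 < beta < 1.
Variable p : R -> R.
Hypotheses (p_mono : {homo p : x y / x <= y}) (p01 : forall x, 0 <= p x <= 1).
Variable Cp : R -> R.
Hypothesis CpP : nonneg_mono Cp.
Implicit Types f g : R -> R.

Local Notation mean := (mean Phi).

(** The bid D = L - S computed from a candidate value function f. *)
Definition gap f q : R := beta * (mean f q - mean f (served q)).

(* The minimum over x of mean_payment x + p x * S + (1 - p x) * L is attained at
   x = L - S and equals L - int_0^(L-S) p.  Clipping q at 0 keeps the iterates
   monotone on the whole line. *)
Definition bellman f q : R :=
  let q' := Num.max q 0 in Cp q + beta * mean f q' - primitive p (gap f q').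

Lemma served_ge0 (q : R) : 0 <= served q.
Proof. by rewrite /served le_max lexx orbT. Qed.

Lemma served_le (q : R) : 0 <= q -> served q <= q.
Proof. by move=> q0; rewrite /served ge_max q0 andbT; lra. Qed.

Lemma served_mono (q q' : R) : q <= q' -> served q <= served q'.
Proof. by move=> h; rewrite /served ge_max !le_max lexx orbT andbT lerD2r h. Qed.

Lemma max0_mono (q q' : R) : q <= q' -> Num.max q 0 <= Num.max q' 0.
Proof. by move=> h; rewrite ge_max !le_max lexx orbT andbT h. Qed.

Lemma beta_ge0 : 0 <= beta. Proof. by case/andP: beta01 => /ltW. Qed.

Lemma gap_ge0 f q : nonneg_mono f -> 0 <= q -> 0 <= gap f q.
Proof.
move=> fP q0; rewrite /gap mulr_ge0 ?beta_ge0// subr_ge0.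
by have [_] := mean_nonneg_mono Phi1 fP; apply; exact: served_le.
Qed.

Lemma gap_le f q : nonneg_mono f -> gap f q <= beta * f (q + Abar).
Proof.
move=> fP; rewrite /gap ler_wpM2l ?beta_ge0//.
have := mean_le Phi1 q fP; have := (mean_nonneg_mono Phi1 fP).1 (served q); lra.
Qed.

(* L - H (L - S) is nondecreasing in both L and S since H is nondecreasing and
   1-Lipschitz. *)
Lemma sub_primitive_mono (L S L' S' : R) : L <= L' -> S <= S' ->
  L - primitive p (L - S) <= L' - primitive p (L' - S').
Proof.
move=> LL SS; have [h|/ltW h] := leP (L - S) (L' - S').
- have := primitive_lip p_mono p01 h; lra.
- have := primitive_mono p_mono p01 h; lra.
Qed.

Lemma bellman_homo f g q q' : nonneg_mono f -> nonneg_mono g ->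
  (forall x, f x <= g x) -> q <= q' -> bellman f q <= bellman g q'.
Proof.
move=> fP gP fg qq'; rewrite /bellman -!addrA; apply: lerD; first exact: CpP.2.
have H x y : x <= y -> beta * mean f x <= beta * mean g y.
  move=> xy; rewrite ler_wpM2l ?beta_ge0//; apply: (mean_homo Phi1) => // a.
  by apply: le_trans (fg _); case: fP => _; apply; rewrite lerD2r.
by rewrite /gap !mulrBr; apply: sub_primitive_mono; apply: H; rewrite ?served_mono// max0_mono.
Qed.

Lemma bellman_nonneg_mono f : nonneg_mono f -> nonneg_mono (bellman f).
Proof.
move=> fP; split=> [q|q q' qq']; last exact: bellman_homo.
have q0 : 0 <= Num.max q 0 by rewrite le_max lexx orbT.
have h : primitive p (gap f (Num.max q 0)) <= gap f (Num.max q 0).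
  by apply: primitive_le => //; exact: gap_ge0.
have m0 : 0 <= beta * mean f (served (Num.max q 0)).
  by rewrite mulr_ge0 ?beta_ge0//; case: (mean_nonneg_mono Phi1 fP).
have C0 := CpP.1 q; rewrite /bellman; move: h; rewrite {2}/gap; lra.
Qed.

(** Value iteration. Starting from 0 makes the iterates increase, so that limits can be taken by
    monotone convergence. *)
Definition value_iter k : R -> R := iter k bellman (fun=> 0).

Lemma value_iter_nonneg_mono k : nonneg_mono (value_iter k).
Proof. by elim: k => [|k IH]; [split|exact: bellman_nonneg_mono]. Qed.

Lemma value_iter_step k x : value_iter k x <= value_iter k.+1 x.
Proof.
elim: k x => [|k IH] x; first exact: (value_iter_nonneg_mono 1).1.
apply: (@bellman_homo (value_iter k) (value_iter k.+1)) => //; exact: value_iter_nonneg_mono.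
Qed.

Lemma value_iter_homo x : {homo value_iter ^~ x : m n / (m <= n)%N >-> m <= n}.
Proof. by apply: homo_leq => // [y z t|k]; [exact: le_trans|exact: value_iter_step]. Qed.

(** Dropping the gain from the auctions leaves the cost of a queue that is never served and receives
    at most Abar per round. *)
Lemma value_iter_le k q : 0 <= q ->
  value_iter k q <= \sum_(t < k) beta ^+ t * Cp (q + Abar * t%:R).
Proof.
elim: k q => [|k IH] q q0; first by rewrite big_ord0.
have fP := value_iter_nonneg_mono k.
rewrite big_ord_recl expr0 mul1r mulr0 addr0 /= /bellman max_l//.
apply: (@le_trans _ _ (Cp q + beta * value_iter k (q + Abar))).
  have := primitive_ge0 p01 (gap (value_iter k) q).
  have : beta * mean (value_iter k) q <= beta * value_iter k (q + Abar).
    by rewrite ler_wpM2l ?beta_ge0//; exact: mean_le.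
  rewrite -/(value_iter k); lra.
rewrite lerD2l; have qA : 0 <= q + Abar by rewrite addr_ge0//; exact: Abar_ge0 Phi1.
apply: le_trans (ler_wpM2l beta_ge0 (IH _ qA)) _.
rewrite mulr_sumr le_eqVlt; apply/orP; left; apply/eqP; apply: eq_bigr => t _.
by rewrite mulrA -exprS /= /bump leq0n natrD mulrDr mulr1 addrA.
Qed.

Hypothesis Cp_geometric : forall q, 0 <= q -> exists2 K : R, 0 <= K &
  forall k, beta ^+ k * Cp (q + Abar * k%:R) <= K * Num.sqrt beta ^+ k.

Lemma sqrt_beta01 : 0 < Num.sqrt beta < 1.
Proof.
case/andP: beta01 => b0 b1.
by rewrite sqrtr_gt0 b0 -[ltRHS]sqrtr1 ltr_sqrt// ltr01.
Qed.

Lemma geometric_sum_le (r : R) k : 0 < r < 1 -> \sum_(t < k) r ^+ t <= (1 - r)^-1.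
Proof.
move=> /andP[r0 r1]; rewrite -[leRHS]mul1r ler_pdivlMr ?subr_gt0// mulrC.
by rewrite -opprB mulNr -subrX1 opprB lerBlDr lerDl exprn_ge0// ltW.
Qed.

(** The shift by T rounds merges with the index t of the sum: beta^T beta^t C(q + Abar (T + t)) is
    one term of the geometric bound. The constant depends on neither T nor k. *)
Lemma value_iter_geometric q : 0 <= q -> exists2 K : R, 0 <= K & forall T k,
  beta ^+ T * value_iter k (q + Abar * T%:R) <= K * Num.sqrt beta ^+ T.
Proof.
move=> q0; have [K K0 HK] := Cp_geometric q0.
have A0 := Abar_ge0 Phi1; have /andP[r0 r1] := sqrt_beta01.
exists (K / (1 - Num.sqrt beta)); first by rewrite divr_ge0// subr_ge0 ltW.
move=> T k; apply: (@le_trans _ _ (\sum_(t < k) K * Num.sqrt beta ^+ T * Num.sqrt beta ^+ t)).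
  apply: le_trans (ler_wpM2l (exprn_ge0 _ beta_ge0) (value_iter_le k _)) _.
    by rewrite addr_ge0// mulr_ge0.
  rewrite mulr_sumr; apply: ler_sum => t _.
  by rewrite mulrA -exprD -mulrA -exprD -addrA -mulrDr -natrD.
rewrite -mulr_sumr [leRHS]mulrAC; apply: ler_wpM2l; last exact: geometric_sum_le sqrt_beta01.
by rewrite mulr_ge0// exprn_ge0// ltW.
Qed.

(** W is the pointwise limit of value iteration, finite by the geometric bound. The equation
    survives the limit because means converge monotonically and H is 1-Lipschitz. *)
Lemma bellman_fixpoint : exists W : R -> R, [/\ nonneg_mono W,
  forall q, W q = bellman W q
  & forall q, 0 <= q -> exists2 K : R, 0 <= K & forall T,
      beta ^+ T * W (q + Abar * T%:R) <= K * Num.sqrt beta ^+ T].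
Proof.
have bnd x : has_ubound (range (value_iter ^~ x)).
  have x0 : 0 <= Num.max x 0 by rewrite le_max lexx orbT.
  have [K K0 HK] := value_iter_geometric x0.
  exists K => _ [k _ <-]; have := HK 0 k; rewrite !expr0 mul1r mulr1 mulr0 addr0.
  by apply: le_trans; case: (value_iter_nonneg_mono k) => _; apply; rewrite le_max lexx.
pose W x := limn (value_iter ^~ x).
have WC x : value_iter ^~ x @ \oo --> W x.
  by apply: nondecreasing_is_cvgn => //; exact: value_iter_homo.
have W_ge k x : value_iter k x <= W x.
  by apply: nondecreasing_cvgn_le; [exact: value_iter_homo|exact: WC].
have WP : nonneg_mono W.
  split=> [x|x y xy]; first exact: le_trans (W_ge 0%N x).
  apply: limr_le; first exact: WC.
  near=> k; apply: le_trans (W_ge k y).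
  by case: (value_iter_nonneg_mono k) => _; apply.
exists W; split => //.
- move=> q; have h1 : (fun k => value_iter k.+1 q) @ \oo --> W q.
    by move: (WC q); rewrite -(cvg_shiftS (value_iter ^~ q)).
  apply: (cvg_unique _ h1) => //.
  have mc x : (fun k => mean (value_iter k) x) @ \oo --> mean W x.
    apply: (mean_cvg Phi1) => //; [exact: value_iter_nonneg_mono|exact: value_iter_homo].
  rewrite /= /bellman; apply: cvgB.
    by apply: cvgD; [exact: cvg_cst|apply: cvgM; [exact: cvg_cst|exact: mc]].
  set q' := Num.max q 0.
  have gc : (fun k => gap (value_iter k) q') @ \oo --> gap W q'.
    by apply: cvgM; [exact: cvg_cst|apply: cvgB; exact: mc].
  apply/cvgrPdist_le => e e0; near=> k.
  apply: (@le_trans _ _ `|gap W q' - gap (value_iter k) q'|).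
    have lip x y : x <= y -> `|primitive p x - primitive p y| <= `|x - y|.
      move=> xy; rewrite distrC [leRHS]distrC !ger0_norm ?subr_ge0//.
        exact: primitive_lip.
      exact: primitive_mono.
    case: (leP (gap W q') (gap (value_iter k) q')) => [|/ltW] /lip h; first exact: h.
    rewrite distrC; apply: le_trans h _.
    by rewrite distrC lexx.
  by near: k; move/cvgrPdist_le : gc; apply.
- move=> q q0; have [K K0 HK] := value_iter_geometric q0.
  exists K => // T; have : beta ^+ T * value_iter k (q + Abar * T%:R) @[k --> \oo] -->
     beta ^+ T * W (q + Abar * T%:R) by apply: cvgM; [exact: cvg_cst|exact: WC].
  move=> h; rewrite -(cvg_lim (@norm_hausdorff _ _) h).
  apply: limr_le; first by apply/cvg_ex; eexists; exact: h.
  by near=> k; exact: HK.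
Unshelve. all: by end_near. Qed.

End Bellman.

(** * Verification: the fixed point is the mean field value *)

Section MeanFieldValue.
Variables (R : realType) (M : nat) (Phi : probability R R) (Abar beta : R).
Hypothesis Phi1 : Phi `[0, Abar]%classic = 1%E.
Hypothesis beta01 : 0 < beta < 1.
Variable rho : R -> R.
Local Notation p := (win_prob M rho).
Hypotheses (p_mono : {homo p : x y / x <= y}) (p01 : forall x, 0 <= p x <= 1).
Variable C : R -> R.
(** C is controlled on R^+ only; clipping yields a cost that is nonnegative and monotone on the
    whole line. *)
Let Cp q := C (Num.max q 0).
Hypothesis CpP : nonneg_mono Cp.
Variable W : R -> R.
Hypothesis WP : nonneg_mono W.
Hypothesis W_fix : forall q, W q = bellman Phi beta p Cp W q.
Hypothesis W_geometric : forall q, 0 <= q -> exists2 K : R, 0 <= K & forall T,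
  beta ^+ T * W (q + Abar * T%:R) <= K * Num.sqrt beta ^+ T.

Local Notation mean := (mean Phi).
Local Notation gap := (gap Phi beta).
Let beta_ge0 : 0 <= beta := beta_ge0 beta01.

Lemma mean_payment_ge0 x : 0 <= x -> 0 <= mean_payment M rho x.
Proof.
move=> x0; rewrite /mean_payment -/(primitive p x) subr_ge0.
have /andP[_] := primitive_slope p_mono p01 (lexx 0) x0.
by rewrite (primitive_lt0 _ (lexx 0)) !subr0.
Qed.

Lemma bellman_ge q x : 0 <= q -> 0 <= x ->
  W q <= C q + mean_payment M rho x +
    beta * (p x * mean W (served q) + (1 - p x) * mean W q).
Proof.
move=> q0 x0; rewrite W_fix /bellman /Cp !max_l//.
have := primitive_optimal p_mono p01 x0 (gap_ge0 Phi1 beta01 WP q0).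
rewrite /mean_payment -/(primitive p x) {2}/gap; lra.
Qed.

Lemma bellman_eq q : 0 <= q ->
  W q = C q + mean_payment M rho (gap W q) +
    beta * (p (gap W q) * mean W (served q) + (1 - p (gap W q)) * mean W q).
Proof.
move=> q0; rewrite {1}W_fix /bellman /Cp !max_l//.
rewrite /mean_payment -/(primitive p (gap W q)).
suff : gap W q * p (gap W q) =
  p (gap W q) * (beta * mean W q - beta * mean W (served q)) by lra.
by rewrite mulrC {2}/gap mulrBr.
Qed.

(** Clipping makes the policy measurable and nonnegative on the whole line; on R^+ it will turn out
    to be [mf_policy], about which nothing is known at negative arguments. *)
Definition optimal_policy q := gap W (Num.max q 0).

Lemma mean_measurable f : nonneg_mono f -> measurable_fun setT (mean f).
Proof. by move=> fP; apply: nonneg_mono_measurable => //; exact: (mean_nonneg_mono Phi1). Qed.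

Lemma max0_measurable : measurable_fun setT (fun q : R => Num.max q 0).
Proof. by apply: measurable_maxr => //; exact: measurable_id. Qed.

Lemma served_measurable : measurable_fun setT (@served R).
Proof. by apply: nondecreasing_measurable => // x y; exact: served_mono. Qed.

Lemma gap_measurable : measurable_fun setT (gap W).
Proof.
apply: measurable_funM => //; apply: measurable_funB; first exact: mean_measurable.
by apply: measurableT_comp; [exact: mean_measurable|exact: served_measurable].
Qed.

Lemma optimal_policy_stationary : stationary_policy optimal_policy.
Proof.
split; first by apply: measurableT_comp; [exact: gap_measurable|exact: max0_measurable].
by move=> q; apply: (gap_ge0 Phi1 beta01 WP); rewrite le_max lexx orbT.
Qed.

Section Policy.
Variable theta : R -> R.
Hypothesis thetaP : stationary_policy theta.

Local Notation trans := (mf_transition M Phi rho theta).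
Implicit Types f g : R -> \bar R.

Definition nonneg_measurable f := measurable_fun setT f /\ forall x, (0 <= f x)%E.

Lemma win_measurable : measurable_fun setT (fun q => p (theta q)).
Proof.
by apply: measurableT_comp; [exact: nondecreasing_measurable|case: thetaP].
Qed.

Lemma trans_nonneg_measurable f : nonneg_measurable f -> nonneg_measurable (trans f).
Proof.
move=> [mf f0]; have sub (s : R -> R) : measurable_fun setT s ->
    measurable_fun setT (fun q : R => \int[Phi]_(a in nneg R) f (s q + a)%R)%E.
  move=> ms; have -> : (fun q : R => \int[Phi]_(a in nneg R) f (s q + a)%R)%E =
     fubini_F Phi (fun z : R * R => f (s z.1 + z.2)).
    apply/funext => q; rewrite /fubini_F prob1_integral//.
    - exact: measurable_nneg.
    - exact: Phi_nneg Phi1.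
    - by apply: measurableT_comp => //; apply: measurable_funD.
  apply: measurable_fun_fubini_tonelli_F => //.
  apply: measurableT_comp => //; apply: measurable_funD => //.
  exact: measurableT_comp.
split.
  apply: emeasurable_funD; apply: emeasurable_funM.
  - by apply/measurable_EFinP; exact: win_measurable.
  - by apply: sub; exact: served_measurable.
  - by apply/measurable_EFinP; apply: measurable_funB => //; exact: win_measurable.
  - by apply: sub; exact: measurable_id.
move=> q; have /andP[p0 p1] := p01 (theta q).
by rewrite /mf_transition adde_ge0// mule_ge0 ?lee_fin ?subr_ge0//; apply: integral_ge0.
Qed.

Lemma trans_le f g : nonneg_measurable f -> nonneg_measurable g ->
  (forall q, 0 <= q -> (f q <= g q)%E) -> forall q, 0 <= q -> (trans f q <= trans g q)%E.
Proof.
move=> [mf f0] [mg g0] fg q q0; have /andP[p0 p1] := p01 (theta q).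
have H (x : R) : 0 <= x -> (\int[Phi]_(a in nneg R) f (x + a)%R <= \int[Phi]_(a in nneg R) g (x + a)%R)%E.
  move=> x0; apply: ge0_le_integral => //; first exact: measurable_nneg.
  - by apply: measurable_funTS; apply: measurableT_comp => //; exact: measurable_funD.
  - by apply: measurable_funTS; apply: measurableT_comp => //; exact: measurable_funD.
  - by move=> a; rewrite /nneg /= in_itv/= andbT => a0; apply: fg; rewrite addr_ge0.
by rewrite /mf_transition leeD// lee_wpmul2l ?lee_fin ?subr_ge0// H// served_ge0.
Qed.

Lemma trans_ext f g : (forall q, 0 <= q -> f q = g q) ->
  forall q, 0 <= q -> trans f q = trans g q.
Proof.
move=> fg q q0; rewrite /mf_transition.
have H (x : R) : 0 <= x -> (\int[Phi]_(a in nneg R) f (x + a)%R = \int[Phi]_(a in nneg R) g (x + a)%R)%E.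
  move=> x0; apply: eq_integral => a.
  by rewrite inE /nneg /= in_itv/= andbT => a0; apply: fg; rewrite addr_ge0.
by rewrite !H// served_ge0.
Qed.

Lemma trans_linear f g (b : R) : 0 <= b -> nonneg_measurable f -> nonneg_measurable g ->
  trans (fun x => f x + b%:E * g x)%E = (fun x => trans f x + b%:E * trans g x)%E.
Proof.
move=> b0 [mf f0] [mg g0]; apply/funext => q; have /andP[p0 p1] := p01 (theta q).
have bg x : (0 <= b%:E * g x)%E by rewrite mule_ge0// lee_fin.
have H (x : R) : (\int[Phi]_(a in nneg R) (f (x + a)%R + b%:E * g (x + a)%R) =
    \int[Phi]_(a in nneg R) f (x + a)%R + b%:E * \int[Phi]_(a in nneg R) g (x + a)%R)%E.
  have mfx (h : R -> \bar R) : measurable_fun setT h -> measurable_fun (nneg R) (fun a => h (x + a) : \bar R).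
    by move=> mh; apply: measurable_funTS; apply: measurableT_comp => //; exact: measurable_funD.
  rewrite ge0_integralD//; [|exact: measurable_nneg|exact: mfx|]; last first.
    by apply: measurable_funeM; exact: mfx.
  by rewrite ge0_integralZl_EFin//; [exact: measurable_nneg|exact: mfx].
have I0 (h : R -> \bar R) x : (forall x, 0 <= h x)%E -> (0 <= \int[Phi]_(a in nneg R) h (x + a)%R)%E.
  by move=> h0; apply: integral_ge0.
rewrite /mf_transition !H.
move: (I0 _ (served q) f0) (I0 _ (served q) g0) (I0 _ q f0) (I0 _ q g0).
move: (\int[Phi]_(a in nneg R) f (served q + a)%R)%E => A.
move: (\int[Phi]_(a in nneg R) g (served q + a)%R)%E => B.
move: (\int[Phi]_(a in nneg R) f (q + a)%R)%E => A'.
move: (\int[Phi]_(a in nneg R) g (q + a)%R)%E => B' A0 B0 A'0 B'0.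
rewrite !ge0_muleDr ?mule_ge0 ?lee_fin ?subr_ge0//.
by rewrite !(muleCA b%:E) addeACA.
Qed.

Lemma iter_nonneg_measurable T f : nonneg_measurable f -> nonneg_measurable (iter T trans f).
Proof. by move=> fP; elim: T => //= T; exact: trans_nonneg_measurable. Qed.

Lemma iter_le T f g : nonneg_measurable f -> nonneg_measurable g ->
  (forall q, 0 <= q -> (f q <= g q)%E) ->
  forall q, 0 <= q -> (iter T trans f q <= iter T trans g q)%E.
Proof.
move=> fP gP fg; elim: T => //= T IH; apply: trans_le => //; exact: iter_nonneg_measurable.
Qed.

Lemma iter_ext T f g : (forall q, 0 <= q -> f q = g q) ->
  forall q, 0 <= q -> iter T trans f q = iter T trans g q.
Proof. by move=> fg; elim: T => //= T; exact: trans_ext. Qed.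

Lemma iter_linear T f g (b : R) : 0 <= b -> nonneg_measurable f -> nonneg_measurable g ->
  iter T trans (fun x => f x + b%:E * g x)%E =
  (fun x => iter T trans f x + b%:E * iter T trans g x)%E.
Proof.
move=> b0 fP gP; elim: T => //= T ->; rewrite trans_linear//; exact: iter_nonneg_measurable.
Qed.

Lemma nonneg_mono_EFin (f : R -> R) : nonneg_mono f -> nonneg_measurable (EFin \o f).
Proof.
move=> fP; split; last by move=> x; rewrite lee_fin; case: fP.
by apply/measurable_EFinP; exact: nonneg_mono_measurable.
Qed.

Lemma trans_mean (f : R -> R) q : nonneg_mono f -> trans (EFin \o f) q =
  (p (theta q) * mean f (served q) + (1 - p (theta q)) * mean f q)%:E.
Proof. by move=> fP; rewrite /mf_transition !(meanE Phi1). Qed.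

Lemma iter_value_le T q : 0 <= q -> (iter T trans (EFin \o W) q <= (W (q + Abar * T%:R))%:E)%E.
Proof.
elim: T q => [|T IH] q q0; first by rewrite mulr0 addr0.
have A0 := Abar_ge0 Phi1.
pose WT x := W (x + Abar * T%:R).
have WTP : nonneg_mono WT.
  by split=> [x|x y xy]; [exact: WP.1|apply: WP.2; rewrite lerD2r].
rewrite iterS; apply: (@le_trans _ _ (trans (EFin \o WT) q)).
  apply: trans_le => //; last exact: nonneg_mono_EFin.
  by apply: iter_nonneg_measurable; exact: nonneg_mono_EFin.
have -> : q + Abar * T.+1%:R = q + Abar + Abar * T%:R by rewrite -natr1; ring.
rewrite trans_mean// lee_fin -/(WT _).
have /andP[p0 p1] := p01 (theta q).
have h1 := mean_le Phi1 q WTP.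
have h2 : mean WT (served q) <= mean WT q.
  by case: (mean_nonneg_mono Phi1 WTP) => _; apply; exact: served_le.
nra.
Qed.

Let cost q := (Cp q + mean_payment M rho (theta q))%:E.

Lemma cost_nonneg_measurable : nonneg_measurable cost.
Proof.
split; last first.
  move=> q; rewrite lee_fin addr_ge0//; first by case: CpP.
  by apply: mean_payment_ge0; case: thetaP.
apply/measurable_EFinP; apply: measurable_funD; first exact: nonneg_mono_measurable.
apply: measurable_funB; first by apply: measurable_funM; [case: thetaP|exact: win_measurable].
apply: (@measurableT_comp _ _ _ _ _ _ (primitive p)); last by case: thetaP.
by apply: nondecreasing_measurable => // x y; exact: primitive_mono.
Qed.

Lemma mf_costE q : 0 <= q -> mf_cost M C rho theta q = cost q.
Proof. by move=> q0; rewrite /mf_cost /cost /Cp max_l. Qed.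

(** The one-round Bellman inequality unrolled T times; what is left over is the discounted mean of W
    after T rounds. *)
Lemma value_ge T q : 0 <= q -> ((W q)%:E <=
  \sum_(0 <= t < T) (beta ^+ t)%:E * iter t trans (mf_cost M C rho theta) q +
  (beta ^+ T)%:E * iter T trans (EFin \o W) q)%E.
Proof.
move=> q0; elim: T => [|T IH]; first by rewrite big_nil add0e expr0 mul1e.
apply: le_trans IH _; rewrite big_nat_recr//= -addeA leeD//.
have WEP := nonneg_mono_EFin WP; have TWP := trans_nonneg_measurable WEP.
(* On R^+ the cost agrees with its clipped version, which is nonnegative and measurable everywhere,
   as linearity of the iterates requires. *)
rewrite (iter_ext _ mf_costE)//.
rewrite exprSr EFinM -muleA -ge0_muleDr; last 2 first.
- by have [_ ->] := iter_nonneg_measurable T cost_nonneg_measurable.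
- by rewrite mule_ge0 ?lee_fin//; have [_ ->] := iter_nonneg_measurable T.+1 WEP.
(* The extra transition is moved innermost, where the one-round inequality applies pointwise. *)
rewrite -iterS iterSr lee_wpmul2l ?lee_fin ?exprn_ge0//.
have := iter_linear T beta_ge0 cost_nonneg_measurable TWP.
move/(congr1 (fun h => h q)) => /= <-.
apply: iter_le => // [|x x0].
  split; last first.
    move=> x; apply: adde_ge0; first exact: cost_nonneg_measurable.2.
    by apply: mule_ge0; [rewrite lee_fin|exact: TWP.2].
  by apply: emeasurable_funD; [case: cost_nonneg_measurable|apply: measurable_funeM; case: TWP].
rewrite trans_mean// /= -EFinM -EFinD lee_fin /Cp max_l//; apply: bellman_ge => //.
by case: thetaP.
Qed.

End Policy.

Lemma optimal_value_eq T q : 0 <= q ->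
  ((W q)%:E = \sum_(0 <= t < T) (beta ^+ t)%:E *
     iter t (mf_transition M Phi rho optimal_policy) (mf_cost M C rho optimal_policy) q +
  (beta ^+ T)%:E * iter T (mf_transition M Phi rho optimal_policy) (EFin \o W) q)%E.
Proof.
move=> q0; have sP := optimal_policy_stationary.
elim: T => [|T ->]; first by rewrite big_nil add0e expr0 mul1e.
rewrite big_nat_recr//= -addeA; congr (_ + _)%E.
have WEP := nonneg_mono_EFin WP; have TWP := trans_nonneg_measurable sP WEP.
have cP := cost_nonneg_measurable sP.
rewrite (iter_ext _ _ (@mf_costE optimal_policy))//.
rewrite exprSr EFinM -muleA -ge0_muleDr; last 2 first.
- by have [_ ->] := iter_nonneg_measurable sP T cP.
- by rewrite mule_ge0 ?lee_fin//; have [_ ->] := iter_nonneg_measurable sP T.+1 WEP.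
rewrite -iterS iterSr; congr (_ * _)%E.
have := iter_linear sP T beta_ge0 cP TWP.
move/(congr1 (fun h => h q)) => /= <-.
apply: iter_ext => // x x0.
rewrite trans_mean// /= -EFinM -EFinD /Cp /optimal_policy max_l//.
by congr EFin; exact: bellman_eq.
Qed.

Lemma partial_cost_ge0 theta t q : stationary_policy theta -> 0 <= q ->
  (0 <= (beta ^+ t)%:E * iter t (mf_transition M Phi rho theta) (mf_cost M C rho theta) q)%E.
Proof.
move=> sP q0; rewrite mule_ge0 ?lee_fin ?exprn_ge0//.
rewrite (iter_ext _ _ (@mf_costE theta))//.
by have [_ ->] := iter_nonneg_measurable sP t (cost_nonneg_measurable sP).
Qed.

(** Under any policy the queue after T rounds is at most q + Abar T, so the leftover term is at most
    K sqrt(beta)^T and vanishes. *)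
Lemma mf_policy_value_ge theta q : stationary_policy theta -> 0 <= q ->
  ((W q)%:E <= mf_policy_value M beta C Phi rho theta q)%E.
Proof.
move=> sP q0; apply/lee_addgt0Pr => e e0.
have [K K0 HK] := W_geometric q0.
have /andP[r0 r1] := sqrt_beta01 beta01.
have [T HT] : exists T, K * Num.sqrt beta ^+ T <= e.
  have h : `|Num.sqrt beta| < 1 by rewrite gtr0_norm.
  have /cvgrPdist_le/(_ e e0) [N _ HN] := cvg_geometric K h.
  exists N; have := HN N (leqnn N); rewrite /= sub0r normrN.
  by apply: le_trans; exact: ler_norm.
apply: le_trans (value_ge sP T q0) _; apply: leeD.
  by apply: nneseries_lim_ge => n _ _; exact: partial_cost_ge0.
apply: le_trans (lee_wpmul2l _ (iter_value_le sP T q0)) _.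
  by rewrite lee_fin exprn_ge0.
by rewrite -EFinM lee_fin (le_trans _ HT).
Qed.

(** For the converse bound the optimal policy turns the unrolled inequality into an equality, from
    which the nonnegative leftover term is dropped. *)
Lemma mf_valueE q : 0 <= q -> mf_value M beta C Phi rho q = (W q)%:E.
Proof.
move=> q0; apply/eqP; rewrite eq_le; apply/andP; split; last first.
  by apply: le_ereal_inf_tmp => _ [theta sP <-]; exact: mf_policy_value_ge.
have sP := optimal_policy_stationary.
apply: (@le_trans _ _ (mf_policy_value M beta C Phi rho optimal_policy q)).
  by apply: ereal_inf_lbound; exists optimal_policy.
apply: lime_le.
  by apply: is_cvg_nneseries => n _ _; exact: partial_cost_ge0.
near=> T; rewrite (optimal_value_eq T q0) leeDl// mule_ge0 ?lee_fin ?exprn_ge0//.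
by have [_ ->] := iter_nonneg_measurable sP T (nonneg_mono_EFin WP).
Unshelve. all: by end_near. Qed.

Lemma mf_policyE q : 0 <= q -> mf_policy M beta C Phi rho q = gap W q.
Proof.
move=> q0; rewrite /mf_policy /gap; congr (_ * _).
have ig x : Phi.-integrable (nneg R) (EFin \o (fun a => W (x + a))).
  apply/integrableP; split; first exact: measurable_funTS (shift_measurable x WP).
  under eq_integral do rewrite gee0_abs ?lee_fin ?(WP.1)//.
  by rewrite (meanE Phi1)// ltry.
rewrite -RintegralB//; last exact: measurable_nneg.
congr fine; apply: eq_integral => a; rewrite inE /nneg/= in_itv/= andbT => a0.
by rewrite !mf_valueE ?addr_ge0// served_ge0.
Qed.

End MeanFieldValue.

(** * Consequences for the equilibrium bid distribution *)

Section BidCdf.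
Variables (R : realType) (E : R) (rho : R -> R).
Hypothesis hrho : bid_cdf E rho.

Lemma bid_cdf_mono : {homo rho : x y / x <= y}.
Proof.
case: hrho => -[mu [_ rhoE]] _ _ x y xy; rewrite -lee_fin !rhoE.
apply: le_measure; rewrite ?inE//.
by apply: subset_itvl; rewrite bnd_simp.
Qed.

Lemma bid_cdf01 x : 0 <= rho x <= 1.
Proof.
case: hrho => -[mu [_ rhoE]] _ _; rewrite -!lee_fin rhoE measure_ge0/=.
exact: probability_le1.
Qed.

(** [rho] vanishes on the negative axis and is continuous at 0. Together with M > 1 this later rules
    out ties at bid 0. *)
Lemma bid_cdf0 : rho 0 = 0.
Proof.
case: (hrho) => -[mu [mu1 rhoE]] cont _.
have neg x : x < 0 -> rho x = 0.
  move=> x0; apply: EFin_inj; rewrite rhoE; apply/eqP; rewrite -measure_le0.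
  rewrite -(prob1_setC (@measurable_nneg R) mu1); apply: le_measure; rewrite ?inE//.
    by apply: measurableC; exact: measurable_nneg.
  move=> y; rewrite /nneg /= !in_itv/= andbT => yx; apply/negP; rewrite -ltNge.
  exact: le_lt_trans yx x0.
have h : rho x @[x --> 0^'-] --> rho 0 by exact/cvg_at_left_filter/cont.
rewrite -(cvg_lim (@norm_hausdorff _ _) h); apply/cvg_lim => //.
apply: cvg_near_cst; near=> x; apply: neg; near: x.
by exists 1 => //= y _ ; exact.
Unshelve. all: by end_near. Qed.

Lemma win_prob_mono M : {homo win_prob M rho : x y / x <= y}.
Proof.
move=> x y xy; rewrite /win_prob lerXn2r ?nnegrE ?bid_cdf_mono//.
  by have /andP[] := bid_cdf01 x.
by have /andP[] := bid_cdf01 y.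
Qed.

Lemma win_prob01 M x : 0 <= win_prob M rho x <= 1.
Proof. by have /andP[? ?] := bid_cdf01 x; rewrite /win_prob exprn_ge0//= exprn_ile1. Qed.

End BidCdf.

Lemma holding_cost_nonneg_mono (R : realType) (C : R -> R) : holding_cost C ->
  nonneg_mono (fun q => C (Num.max q 0)).
Proof.
move=> [C0 _ Cm _ _]; split=> [q|x y xy]; first by apply: C0; rewrite le_max lexx orbT.
apply: Cm; last exact: max0_mono.
  by rewrite inE /nneg/= in_itv/= andbT le_max lexx orbT.
by rewrite inE /nneg/= in_itv/= andbT le_max lexx orbT.
Qed.

(** Everything the finite system needs from the mean field problem; from here on the infimum over
    policies is replaced by the equation for W. *)
Lemma mean_field_solution (R : realType) M beta C (Phi : probability R R) rho E Abar :
  arrival_distribution Abar Phi -> holding_cost C -> bid_cdf E rho -> 0 < beta < 1 ->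
  exists W : R -> R, [/\ nonneg_mono W,
    forall q, 0 <= q -> W q = C q + beta * mean Phi W q -
                             primitive (win_prob M rho) (gap Phi beta W q),
    forall q, 0 <= q -> mf_policy M beta C Phi rho q = gap Phi beta W q
  & forall q, 0 <= q -> exists2 K : R, 0 <= K & forall T,
      beta ^+ T * W (q + Abar * T%:R) <= K * Num.sqrt beta ^+ T].
Proof.
move=> [Phi1 _] hC hrho b01.
have pm := win_prob_mono hrho M; have p01 := win_prob01 hrho M.
have CP := holding_cost_nonneg_mono hC.
have Cgeo q : 0 <= q -> exists2 K : R, 0 <= K & forall k,
    beta ^+ k * C (Num.max (q + Abar * k%:R) 0) <= K * Num.sqrt beta ^+ k.
  move=> q0; have A0 := Abar_ge0 Phi1.
  have [K K0 HK] := holding_cost_geometric hC b01 A0 q0.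
  by exists K => // k; rewrite max_l// addr_ge0// mulr_ge0.
have [W [WP Wfix Wgeo]] := bellman_fixpoint Phi1 b01 pm p01 CP Cgeo.
exists W; split; [exact: WP| | |exact: Wgeo] => q q0.
- by rewrite {1}Wfix /bellman max_l.
- exact: (mf_policyE Phi1 b01 pm p01 CP WP Wfix Wgeo q0).
Qed.

(** * Independence of groups of random sources *)

Section SigmaGroups.
Context d (Om : measurableType d) (R : realType) (P : probability Om R).
Variables (J : Type) (F : J -> set (set Om)).
Hypothesis F_T : forall j, F j setT.
Hypothesis F_I : forall j A B, F j A -> F j B -> F j (A `&` B).
Hypothesis F_measurable : forall j A, F j A -> measurable A.
Hypothesis F_indep : mutually_independent P F.

Definition generators (K : set J) : set (set Om) := \bigcup_(j in K) F j.

(** A pi-system generating the sigma-algebra of the sources in K; [{classic J}] supplies the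
    decidable equality behind duplicate-free lists. *)
Definition cylinders (K : set J) : set (set Om) :=
  [set B | exists (s : seq {classic J}) (A : {classic J} -> set Om),
    [/\ uniq s, forall j, F j (A j), forall j, j \in s -> K j
      & B = \bigcap_(j in [set` s]) A j]].

Lemma cylinder_prob (s : seq {classic J}) (A : {classic J} -> set Om) : uniq s ->
  (forall j, F j (A j)) ->
  P (\bigcap_(j in [set` s]) A j) = (\prod_(j <- s) P (A j))%E.
Proof.
move=> us FA; rewrite bigcap_seq !(big_tnth _ _ s).
apply: (F_indep (j := fun k => tnth (in_tuple s) k)) => //.
exact: (elimT (tuple_uniqP (in_tuple s)) us).
Qed.

Lemma cylindersI K : setI_closed (cylinders K).
Proof.
move=> _ _ [s [A [us FA sK ->]]] [s' [A' [us' FA' sK' ->]]].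
exists (undup (s ++ s')), (fun j => (if j \in s then A j else setT) `&`
                                    (if j \in s' then A' j else setT)).
split=> [|j|j|]; first exact: undup_uniq.
- by apply: F_I; case: ifP.
- by rewrite mem_undup mem_cat => /orP[/sK|/sK'].
- apply/seteqP; split=> [x [h h'] j /=|x h].
    by rewrite mem_undup mem_cat => _; split; case: ifPn => // js; [apply: h|apply: h'].
  split=> j js; have := h j; rewrite /= mem_undup mem_cat js ?orbT => /(_ isT) [].
    by [].
  by move=> _.
Qed.

Lemma cylinders_indep K K' A B : K `&` K' = set0 -> cylinders K A -> cylinders K' B ->
  P (A `&` B) = (P A * P B)%E.
Proof.
move=> KK' [s [f [us Ff sK ->]]] [s' [f' [us' Ff' sK' ->]]].
have dis j : j \in s -> j \in s' = false.
  move=> js; apply/negP => js'; have : (K `&` K') j by split; [exact: sK|exact: sK'].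
  by rewrite KK'.
pose g j := if j \in s then f j else f' j.
have Fg j : F j (g j) by rewrite /g; case: ifP.
have us2 : uniq (s ++ s').
  rewrite cat_uniq us us' andbT /=; apply/hasPn => j js' /=; apply/negP => js.
  by rewrite dis in js'.
have := cylinder_prob us2 Fg.
rewrite big_cat /= [in RHS]big_seq [X in (X * _)%E](eq_bigr (fun j => P (f j))); last first.
  by move=> j js; rewrite /g js.
rewrite -big_seq [X in (_ * X)%E]big_seq [X in (_ * X)%E](eq_bigr (fun j => P (f' j))); last first.
  by move=> j js'; rewrite /g ifF//; apply/negP => /dis; rewrite js'.
rewrite -big_seq -!cylinder_prob// => <-; congr (P _).
apply/seteqP; split=> [x [h h'] j /=|x h].
  by rewrite mem_cat /g; case: ifPn => [js _|js /= js']; [exact: h|exact: h'].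
split=> j js; have := h j; rewrite /= mem_cat js ?orbT => /(_ isT); rewrite /g.
  by rewrite js.
by rewrite ifF//; apply/negP => /dis; rewrite js.
Qed.

Lemma generators_cylinders K : <<s generators K >> = <<s cylinders K >>.
Proof.
apply/seteqP; split; apply: smallest_sub; do ?exact: smallest_sigma_algebra.
  move=> A [j Kj FA]; apply: sub_sigma_algebra.
  exists [:: (j : {classic J})], (fun i => if pselect (i = j) then A else setT).
  split=> // [i|i|].
  - by case: pselect => /= [ij|_]; [rewrite ij|exact: F_T].
  - by rewrite inE => /eqP ->.
  - apply/seteqP; split=> [x Ax i /=|x /(_ j)/=].
      by rewrite inE => /eqP ->; case: pselect.
    by rewrite inE eqxx => /(_ isT); case: pselect.
move=> _ [s [A [us FA sK ->]]].
have -> : \bigcap_(j in [set` s]) A j = \big[setI/setT]_(j <- s) A j by rewrite bigcap_seq.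
rewrite big_seq; apply: (big_ind (fun B => <<s generators K >> B)).
- exact: (@measurableT _ (g_sigma_algebraType (generators K))).
- by move=> B B'; exact: (@measurableI _ (g_sigma_algebraType (generators K))).
- by move=> j js; apply: sub_sigma_algebra; exists j => //; exact: sK.
Qed.

Lemma generators_measurable K : <<s generators K >> `<=` measurable.
Proof.
apply: smallest_sub; first exact: sigma_algebra_measurable.
by move=> A [j _ /F_measurable].
Qed.

Lemma cylinders_measurable K : cylinders K `<=` measurable.
Proof.
move=> A cA; apply: (@generators_measurable K); rewrite generators_cylinders.
exact: sub_sigma_algebra.
Qed.

Lemma cylinders_setT K : cylinders K setT.
Proof.
exists [::], (fun=> setT); split=> //.
by apply/seteqP; split.
Qed.

(** In A, both P(A & B) and P(A) P(B) are finite measures, the restriction and a multiple of P;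
    agreeing on a pi-system, they agree on the sigma-algebra it generates. Applied to each side in
    turn, this gives full independence. *)
Lemma sigma_indep_half K (B : set Om) : measurable B ->
  (forall A, cylinders K A -> P (A `&` B) = (P A * P B)%E) ->
  forall A, <<s generators K >> A -> P (A `&` B) = (P A * P B)%E.
Proof.
move=> mB h A; rewrite generators_cylinders => sA.
have PB0 : 0 <= fine (P B) by rewrite fine_ge0.
pose r : {nonneg R} := NngNum PB0.
have fPB : (P B)%E = (r%:num)%:E.
  by rewrite /= fineK// fin_num_measure.
have E := @g_sigma_algebra_measure_unique _ R Om (cylinders K)
  (@cylinders_measurable K) (fun=> setT) (fun=> cylinders_setT K) _
  (mrestr P mB) (mscale r P) (@cylindersI K) _ _ A sA.
rewrite -[LHS]/(mrestr P mB A) E.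
- by rewrite /mscale muleC fPB.
- by rewrite bigcup_const//; exists 0%N.
- by move=> C cC; rewrite -[LHS]/(P (C `&` B)) h// -[RHS]/((r%:num)%:E * P C)%E muleC fPB.
- by move=> _; rewrite -[ltLHS]/(P (setT `&` B)) setTI fPB ltry.
Qed.

Lemma sigma_indep K K' A B : K `&` K' = set0 ->
  <<s generators K >> A -> <<s generators K' >> B -> P (A `&` B) = (P A * P B)%E.
Proof.
move=> KK' sA sB; apply: (sigma_indep_half _ _ sA); first exact: generators_measurable sB.
move=> A' cA'; rewrite setIC muleC; apply: (sigma_indep_half _ _ sB).
  exact: cylinders_measurable cA'.
by move=> B' cB'; rewrite setIC muleC; exact: cylinders_indep KK' cA' cB'.
Qed.

Lemma generatorsS K K' : K `<=` K' -> generators K `<=` generators K'.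
Proof. by move=> KK' A [j Kj FA]; exists j => //; exact: KK'. Qed.

End SigmaGroups.

Section IndependentPair.
Context d (Om : measurableType d) (R : realType) (P : probability Om R).
Context d1 d2 (T1 : measurableType d1) (T2 : measurableType d2).
Variables (X : Om -> T1) (Y : Om -> T2).
Hypotheses (mX : measurable_fun setT X) (mY : measurable_fun setT Y).

Definition independent_pair := forall A B, measurable A -> measurable B ->
  P (X @^-1` A `&` Y @^-1` B) = (P (X @^-1` A) * P (Y @^-1` B))%E.

(** The joint law is the product of the two laws, so by Tonelli X may be frozen while Y is
    averaged. *)
Lemma independent_pair_integral (f : T1 * T2 -> \bar R) : independent_pair ->
  measurable_fun setT f -> (forall x, 0 <= f x)%E ->
  (\int[P]_w f (X w, Y w) = \int[P]_w \int[P]_w' f (X w, Y w'))%E.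
Proof.
move=> XY mf f0.
pose X' : {mfun Om >-> T1} := HB.pack X (isMeasurableFun.Build _ _ _ _ X mX).
pose Y' : {mfun Om >-> T2} := HB.pack Y (isMeasurableFun.Build _ _ _ _ Y mY).
have mXY : measurable_fun setT (fun w => (X w, Y w)) by exact: measurable_fun_pair.
pose Z : {mfun Om >-> (T1 * T2)%type} := HB.pack (fun w => (X w, Y w))
  (isMeasurableFun.Build _ _ _ _ (fun w => (X w, Y w)) mXY).
pose mu := distribution P X'; pose nu := distribution P Y'.
have E A : measurable A -> (mu \x nu)%E A = distribution P Z A.
  by apply: product_measure_unique => A1 A2 mA1 mA2; rewrite -[RHS]XY.
transitivity (\int[distribution P Z]_z f z)%E.
  by rewrite ge0_integral_distribution.
rewrite (eq_measure_integral (mu \x nu)%E); last by move=> A mA _; first [exact: E|exact/esym/E].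
rewrite fubini_tonelli1// ge0_integral_distribution//=.
- apply: eq_integral => w _ /=; rewrite /fubini_F ge0_integral_distribution//.
  exact: measurableT_comp mf (measurable_pair1 _).
- exact: measurable_fun_fubini_tonelli_F.
- by move=> x; apply: integral_ge0.
Qed.

End IndependentPair.

(** * The finite system *)

Section MeasurableBool.
Context d (T : measurableType d).

Lemma measurable_bool_set (f : T -> bool) : measurable_fun setT f ->
  measurable [set w | f w].
Proof. by move=> mf; rewrite -[X in measurable X]setTI; exact: (mf measurableT [set true]). Qed.

Lemma measurable_andb (f g : T -> bool) : measurable_fun setT f ->
  measurable_fun setT g -> measurable_fun setT (fun w => f w && g w).
Proof.
move=> mf mg; rewrite (_ : (fun w => _) = (fun w => if f w then g w else false)).
  exact: measurable_fun_ifT.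
by apply/funext => w; case: (f w).
Qed.

Lemma measurable_orb (f g : T -> bool) : measurable_fun setT f ->
  measurable_fun setT g -> measurable_fun setT (fun w => f w || g w).
Proof.
move=> mf mg; rewrite (_ : (fun w => _) = (fun w => if f w then true else g w)).
  exact: measurable_fun_ifT.
by apply/funext => w; case: (f w).
Qed.

Lemma measurable_implyb (f g : T -> bool) : measurable_fun setT f ->
  measurable_fun setT g -> measurable_fun setT (fun w => f w ==> g w).
Proof.
move=> mf mg; rewrite (_ : (fun w => _) = (fun w => if f w then g w else true)).
  exact: measurable_fun_ifT.
by apply/funext => w; case: (f w).
Qed.

Lemma measurable_forallb (I : finType) (f : I -> T -> bool) :
  (forall i, measurable_fun setT (f i)) ->
  measurable_fun setT (fun w => [forall i, f i w]).
Proof.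
move=> mf; apply: (measurable_fun_bool true); rewrite setTI.
rewrite (_ : _ @^-1` _ = \bigcap_(i in [set: I]) (f i @^-1` [set true])).
  apply: fin_bigcap_measurable => [|i _]; first exact: finite_finset.
  by rewrite -[X in measurable X]setTI; apply: mf.
apply/seteqP; split=> w /= h; first by move=> i _; move/forallP: h => /(_ i).
by apply/forallP => i; exact: h.
Qed.

Lemma measurable_finite_comp (I : finType) (s : T -> I) (f : I -> bool) :
  (forall i, measurable (s @^-1` [set i])) -> measurable_fun setT (f \o s).
Proof.
move=> ms; apply: (measurable_fun_bool true); rewrite setTI.
rewrite (_ : _ @^-1` _ = \bigcup_(i in [set i | f i]) (s @^-1` [set i])).
  by apply: fin_bigcup_measurable => // i _; exact: ms.
apply/seteqP; split=> w /= => [h|[i fi /= ->]] //.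
by exists (s w).
Qed.

End MeasurableBool.

(** The Y of the overview, defined whether or not the agent wins; it is his payment when he does. *)
Definition rival_max (R : realType) (N M : nat) (Om : Type) (X : noise R (N * M) Om)
    (agent1 : 'I_(N * M)) (theta : seq (stage R) -> R -> R) (theta_o : R -> R)
    (t : nat) (i : 'I_(N * M)) (w : Om) (s : state R N M) : R :=
  \big[Num.max/0]_(j | rival X t w i j) bid agent1 theta theta_o s j.

Section Trajectory.
Variables (R : realType) (N M : nat).
Local Notation n := (N * M)%N.
Context d (T : measurableType d).
Variables (Y : noise R n T) (agent1 : 'I_n) (q1 : R).
Variables (theta : seq (stage R) -> R -> R) (theta_o : R -> R).
Hypotheses (thetaP : history_policy theta) (m_o : measurable_fun setT theta_o).
(* [meet t i j] allows i and j to share a cell at time t; the agents whose sources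
   may affect the queue of i at time t are then those in [influence t i]. *)
Variable meet : nat -> 'I_n -> 'I_n -> bool.
Hypothesis meetP : forall t w i j,
  (assign Y t w j %/ M == assign Y t w i %/ M)%N -> meet t i j.

Local Notation traj := (trajectory Y agent1 q1 theta theta_o).

Fixpoint influence (t : nat) (i : 'I_n) : {set 'I_n} :=
  if t is t'.+1 then \bigcup_(j | meet t' i j) influence t' j else [set i].

Definition available (t : nat) (i : 'I_n) : Prop :=
  (forall j, j \in influence t i -> measurable_fun setT (init Y j) /\
     forall s, (s < t)%N -> [/\ measurable_fun setT (arrival Y s j),
       measurable_fun setT (survives Y s j) & measurable_fun setT (fresh Y s j)]) /\
  forall s, (s < t)%N -> forall p, measurable (assign Y s @^-1` [set p]) /\
                                   measurable (tiebreak Y s @^-1` [set p]).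

Lemma available_meet t i j : available t.+1 i -> meet t i j -> available t j.
Proof.
move=> [h1 h2] ij; split=> [k kj|s st]; last by apply: h2; exact: ltnW.
have ki : k \in influence t.+1 i by apply/bigcupP; exists j.
by have [h3 h4] := h1 _ ki; split=> // s st; apply: h4; exact: ltnW.
Qed.

Hypothesis meet_refl : forall t i, meet t i i.

Lemma influence_refl t i : i \in influence t i.
Proof. by elim: t => [|t IH]; [rewrite inE|apply/bigcupP; exists i]. Qed.

Lemma available_source t i : available t.+1 i ->
  [/\ measurable_fun setT (arrival Y t i), measurable_fun setT (survives Y t i),
      measurable_fun setT (fresh Y t i)
    & forall p, measurable (assign Y t @^-1` [set p]) /\
                measurable (tiebreak Y t @^-1` [set p])].
Proof.
move=> [h1 h2]; have [_ /(_ t (ltnSn t)) [? ? ?]] := h1 i (influence_refl t.+1 i).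
by split=> //; exact: h2.
Qed.

(** At time t the history has length t, so it can be measured as a tuple, the form in which
    [history_policy] states measurability. *)
Definition measurable_state t : Prop :=
  [/\ measurable_fun setT (fun w => queue (traj t w) agent1),
      measurable_fun setT (fun w => alive (traj t w))
    & exists2 h : T -> t.-tuple (stage R), measurable_fun setT h &
        forall w, hist (traj t w) = h w].

Lemma measurable_bid t i : measurable_fun setT (fun w => queue (traj t w) i) ->
  (i = agent1 -> measurable_state t) ->
  measurable_fun setT (fun w => bid agent1 theta theta_o (traj t w) i).
Proof.
move=> mq; rewrite /bid; have [->|_] := eqVneq i agent1; last first.
  by move=> _; exact: measurableT_comp.
move=> /(_ erefl) [mq1 _ [h mh hE]].
rewrite (_ : (fun w => _) = (fun z : t.-tuple (stage R) * R => theta z.1 z.2) \o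
  (fun w => (h w, queue (traj t w) agent1))); last first.
  by apply/funext => w /=; rewrite hE.
apply: measurableT_comp; first exact: thetaP.1.
exact: measurable_fun_pair.
Qed.

Section Round.
Variables (t : nat) (i : 'I_n).
Hypothesis m_assign : forall p, measurable (assign Y t @^-1` [set p]).
Hypothesis m_tie : forall p, measurable (tiebreak Y t @^-1` [set p]).
Hypothesis m_bid : forall j, meet t i j ->
  measurable_fun setT (fun w => bid agent1 theta theta_o (traj t w) j).

Lemma measurable_rival j : measurable_fun setT (fun w => rival Y t w i j).
Proof.
exact: (measurable_finite_comp
  (fun s : 'S_n => (j != i) && (s j %/ M == s i %/ M)%N) m_assign).
Qed.

Lemma rival_meet j w : ~~ meet t i j -> rival Y t w i j = false.
Proof. by move=> ij; apply/negP => /andP[_ /meetP]; rewrite (negbTE ij). Qed.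

Lemma measurable_wins :
  measurable_fun setT (fun w => wins Y agent1 theta theta_o t w (traj t w) i).
Proof.
apply: measurable_forallb => j; have [ij|ij] := boolP (meet t i j); last first.
  rewrite (_ : (fun w => _) = cst true); first exact: measurable_cst.
  by apply/funext => w; rewrite rival_meet.
apply: measurable_implyb; first exact: measurable_rival.
apply: measurable_orb.
  by apply: measurable_fun_ltr; exact: m_bid.
apply: measurable_andb; first by apply: measurable_fun_eqr; exact: m_bid.
exact: (measurable_finite_comp (fun s : 'S_n => (s i < s j)%N) m_tie).
Qed.

Lemma measurable_rival_max : 
  measurable_fun setT (fun w => rival_max Y agent1 theta theta_o t i w (traj t w)).
Proof.
rewrite /rival_max; elim: (index_enum _) => [|j r IH].
  by under eq_fun do rewrite big_nil; exact: measurable_cst.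
under eq_fun do rewrite big_cons.
have [ij|ij] := boolP (meet t i j); last first.
  by under eq_fun do rewrite (rival_meet _ ij).
apply: measurable_fun_ifT => //; first exact: measurable_rival.
by apply: measurable_maxr => //; exact: m_bid.
Qed.

End Round.

(** The space T is arbitrary so that it can be Om with the sigma-algebra of a group of sources; the
    conclusion then says that these sources alone determine the queue. For agent 1 the history is
    carried through the induction because his bid depends on it. *)
Lemma measurable_trajectory t i : available t i ->
  measurable_fun setT (fun w => queue (traj t w) i) /\
  (i = agent1 -> measurable_state t).
Proof.
elim: t i => [|t IH] i avi.
  have mq : measurable_fun setT (fun w => queue (traj 0 w) i).
    rewrite /=; have [_|_] := eqVneq i agent1; first exact: measurable_cst.
    by have [/(_ i (influence_refl 0 i)) []] := avi.
  split; [exact: mq|move=> ia; split; [by rewrite ia in mq|exact: measurable_cst|]].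
  by exists (fun=> [tuple]); first exact: measurable_cst.
have [mA mS mF mp] := available_source avi.
have avj j : meet t i j -> available t j by exact: available_meet.
have [mqi msi] := IH i (avj _ (meet_refl t i)).
have mb j : meet t i j ->
    measurable_fun setT (fun w => bid agent1 theta theta_o (traj t w) j).
  by move=> /avj/IH [mq ms]; exact: measurable_bid.
have mw : measurable_fun setT (fun w => wins Y agent1 theta theta_o t w (traj t w) i).
  by apply: measurable_wins => // p; have [] := mp p.
have mq' : measurable_fun setT (fun w => queue (traj t.+1 w) i).
  rewrite /= /next_queue; apply: measurable_fun_ifT => //.
  apply: measurable_funD => //; apply: measurable_fun_ifT => //.
  apply: (@measurableT_comp _ _ _ _ _ _ (@served R)) => //.
  apply: nondecreasing_measurable => // x y xy.
  by rewrite /served ge_max !le_max lexx orbT andbT lerD2r xy.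
split=> // ia; rewrite ia in mq' mw mqi mA mS mF mp mb *.
have [mq ma [h mh hE]] := msi ia.
split=> //; first exact: measurable_andb.
exists (fun w => [the t.+1.-tuple (stage R) of
  (queue (traj t w) agent1, bid agent1 theta theta_o (traj t w) agent1,
   wins Y agent1 theta theta_o t w (traj t w) agent1,
   payment Y agent1 theta theta_o t w (traj t w) agent1) :: h w]); last first.
  by move=> w /=; rewrite hE.
apply: measurable_cons => //.
apply: measurable_fun_pair; first apply: measurable_fun_pair; first apply: measurable_fun_pair => //.
- exact: mb.
- exact: mw.
- apply: measurable_fun_ifT => //; apply: (@measurable_rival_max t agent1) => // p.
  by have [] := mp p.
Qed.

End Trajectory.

Section Sources.
Context d (Om : measurableType d) (R : realType) (P : probability Om R).
Variables (n : nat) (X : noise R n Om) (beta : R) (Phi Psi Pi : probability R R).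
Hypothesis hX : noise_law P X beta Phi Psi Pi.

Local Notation F := (source_events X).

Lemma preimage_system_T (T : Type) (f : Om -> T) (G : set (set T)) : G setT ->
  preimage_set_system setT f G setT.
Proof. by move=> GT; exists setT => //; rewrite preimage_setT setTI. Qed.

Lemma preimage_system_I (T : Type) (f : Om -> T) (G : set (set T)) : setI_closed G ->
  setI_closed (preimage_set_system setT f G).
Proof.
move=> GI _ _ [A GA <-] [B GB <-]; exists (A `&` B); first exact: GI.
by rewrite !setTI preimage_setI.
Qed.

Lemma source_events_T j : F j setT.
Proof. by case: j => [i|t|t|t i|t i|t i]; apply: preimage_system_T. Qed.

Lemma source_events_I j A B : F j A -> F j B -> F j (A `&` B).
Proof.
case: j => [i|t|t|t i|t i|t i]; apply: preimage_system_I => // C D;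
  exact: measurableI.
Qed.

Lemma finite_preimage_measurable (I : finType) (f : Om -> I) (B : set I) :
  (forall i, measurable (f @^-1` [set i])) -> measurable (f @^-1` B).
Proof.
move=> mf; rewrite (_ : f @^-1` B = \bigcup_(i in B) f @^-1` [set i]).
  by apply: fin_bigcup_measurable => [|i _]; [exact: finite_finset|exact: mf].
by apply/seteqP; split=> [w Bw|w [i Bi /= ->]] //; exists (f w).
Qed.

Lemma source_events_measurable j A : F j A -> measurable A.
Proof.
case: hX => _ hi hp ha hs; case: j => [i|t|t|t i|t i|t i] [B mB <-].
- by have [m _ _] := hi i; exact: m.
- rewrite setTI; apply: finite_preimage_measurable => p.
  by have [/(_ p) []] := hp t.
- rewrite setTI; apply: finite_preimage_measurable => p.
  by have [_ /(_ p) []] := hp t.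
- by have [[m _ _] _] := ha t i; exact: m.
- by have [m _] := hs t i; apply: m.
- by have [_ [m _ _]] := ha t i; exact: m.
Qed.

(* Om with the sigma-algebra generated by the sources in K. *)
Definition sub (K : set (source n)) : Type := g_sigma_algebraType (generators F K).
HB.instance Definition _ K := Measurable.on (sub K).

Lemma subP K (A : set Om) : measurable (A : set (sub K)) = <<s generators F K >> A.
Proof. by []. Qed.

Lemma sub_source K j A : K j -> F j A -> measurable (A : set (sub K)).
Proof. by move=> Kj FA; rewrite subP; apply: sub_sigma_algebra; exists j. Qed.

Lemma sub_init K i : K (Init i) -> measurable_fun setT (init X i : sub K -> R).
Proof. by move=> Ki _ B mB; apply: (@sub_source _ (Init i)) => //; exists B. Qed.

Lemma sub_arrival K t i : K (Arrival t i) ->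
  measurable_fun setT (arrival X t i : sub K -> R).
Proof. by move=> Ki _ B mB; apply: (@sub_source _ (Arrival t i)) => //; exists B. Qed.

Lemma sub_fresh K t i : K (Fresh t i) -> measurable_fun setT (fresh X t i : sub K -> R).
Proof. by move=> Ki _ B mB; apply: (@sub_source _ (Fresh t i)) => //; exists B. Qed.

Lemma sub_survives K t i : K (Survives t i) ->
  measurable_fun setT (survives X t i : sub K -> bool).
Proof. by move=> Ki _ B mB; apply: (@sub_source _ (Survives t i)) => //; exists B. Qed.

Lemma sub_assign K t p : K (Assign _ t) -> measurable (assign X t @^-1` [set p] : set (sub K)).
Proof.
by move=> Ki; apply: (@sub_source _ (Assign _ t)) => //; exists [set p] => //; rewrite setTI.
Qed.

Lemma sub_tiebreak K t p : K (Tiebreak _ t) ->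
  measurable (tiebreak X t @^-1` [set p] : set (sub K)).
Proof.
by move=> Ki; apply: (@sub_source _ (Tiebreak _ t)) => //; exists [set p] => //; rewrite setTI.
Qed.

Lemma sub_measurable K d' (T : measurableType d') (f : sub K -> T) :
  measurable_fun setT f -> measurable_fun setT (f : Om -> T).
Proof.
move=> mf _ B mB; apply: (generators_measurable source_events_measurable (K := K)).
exact: mf.
Qed.

Lemma sub_event K (A : set Om) : measurable (A : set (sub K)) -> measurable A.
Proof. by move=> mA; apply: (generators_measurable source_events_measurable (K := K)). Qed.

Lemma sub_widen_event K K' (A : set Om) : K `<=` K' ->
  measurable (A : set (sub K)) -> measurable (A : set (sub K')).
Proof.
move=> KK'; apply: sub_smallest2r; first exact: smallest_sigma_algebra.
exact: generatorsS.
Qed.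

Lemma sub_indep_events K K' A B : K `&` K' = set0 ->
  measurable (A : set (sub K)) -> measurable (B : set (sub K')) ->
  P (A `&` B) = (P A * P B)%E.
Proof.
case: hX => ind _ _ _ _.
exact: (sigma_indep source_events_T source_events_I source_events_measurable ind).
Qed.

Lemma sub_independent_pair K K' d1 d2 (T1 : measurableType d1) (T2 : measurableType d2)
  (f : Om -> T1) (g : Om -> T2) : K `&` K' = set0 ->
  measurable_fun setT (f : sub K -> T1) -> measurable_fun setT (g : sub K' -> T2) ->
  independent_pair P f g.
Proof.
move=> KK' mf mg A B mA mB; apply: (sub_indep_events KK').
  by rewrite -[X in measurable X]setTI; exact: mf.
by rewrite -[X in measurable X]setTI; exact: mg.
Qed.

End Sources.

Section Cells.
Variables (n M : nat) (a : nat -> 'S_n).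

Definition same_cell (t : nat) (i j : 'I_n) : bool := (a t j %/ M == a t i %/ M)%N.

Lemma same_cell_refl t i : same_cell t i i.
Proof. by rewrite /same_cell. Qed.

Definition cells_of (s : 'S_n) (S : {set 'I_n}) : {set 'I_n} :=
  [set j | [exists i in S, (s j %/ M == s i %/ M)%N]].

Definition separated (s : 'S_n) (S : {set 'I_n}) : bool :=
  [forall i in S, forall j in S, (s j %/ M == s i %/ M)%N ==> (i == j)].

(* The interaction histories of the agents of S up to round t form disjoint trees. *)
Fixpoint tree_like (t : nat) (S : {set 'I_n}) : bool :=
  if t is t'.+1 then separated (a t') S && tree_like t' (cells_of (a t') S) else true.

End Cells.

(** * Fixed assignments: interaction trees and laws of the queues *)

Section Trees.
Variables (N M : nat) (a : nat -> 'S_(N * M)).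
Local Notation n := (N * M)%N.
Local Notation meet := (same_cell M a).
Local Notation influence := (influence meet).

(** If x influences i through a cell mate k and j through a cell mate l, then k = l would put i and
    j in one cell, against separation, while k and l distinct are covered by induction in
    [cells_of]. *)
Lemma influence_disjoint t (S : {set 'I_n}) i j : tree_like M a t S ->
  i \in S -> j \in S -> i != j ->
  forall x, x \in influence t i -> x \in influence t j -> False.
Proof.
elim: t S i j => [|t IH] S i j.
  by move=> _ _ _ ij x; rewrite !inE => /eqP -> /eqP h; rewrite h eqxx in ij.
move=> /andP[/forall_inP sep gt] iS jS ij.
move=> x /bigcupP[k ik xk] /bigcupP[l jl xl].
have kc : k \in cells_of M (a t) S by rewrite inE; apply/exists_inP; exists i.
have lc : l \in cells_of M (a t) S by rewrite inE; apply/exists_inP; exists j.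
have [kl|kl] := eqVneq k l.
  move/forall_inP: (sep i iS) => /(_ j jS)/implyP h.
  move: ij; rewrite h//; move: ik jl; rewrite kl /same_cell => /eqP <- /eqP <-.
  by [].
exact: IH gt kc lc kl x xk xl.
Qed.

Lemma tree_like_cell t (S : {set 'I_n}) i j : i \in S -> meet t i j ->
  j \in cells_of M (a t) S.
Proof. by move=> iS ij; rewrite inE; apply/exists_inP; exists i. Qed.

Lemma separated_cell t (S : {set 'I_n}) i j : separated M (a t) S ->
  i \in S -> j \in S -> i != j -> ~~ meet t i j.
Proof.
move=> /forall_inP sep iS jS; apply: contra => ij.
by move/forall_inP: (sep i iS) => /(_ j jS)/implyP; apply.
Qed.

Lemma card_cell t i : (0 < M)%N -> #|[pred j | meet t i j]| = M.
Proof.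
move=> M0; set c := (a t i %/ M)%N.
have cN : (c < N)%N by rewrite ltn_divLR.
have lt (r : 'I_M) : (c * M + r < n)%N.
  by apply: (@leq_trans (c.+1 * M)); rewrite ?leq_mul2r ?cN ?orbT// mulSn addnC ltn_add2r.
(* Counted by slots instead of agents, the cell c consists of the slots c M + r with r < M. *)
rewrite -sum1_card (reindex_inj (@perm_inj _ (a t)^-1%g)).
rewrite (reindex_onto (fun r : 'I_M => Ordinal (lt r))
  (fun k : 'I_n => Ordinal (ltn_pmod k M0))) => [|k].
  rewrite (eq_bigl xpredT) ?sum1_card ?card_ord// => r.
  rewrite inE /same_cell permKV -/c /= divnMDl// divn_small// addn0 eqxx/=.
  by apply/eqP/val_inj; rewrite /= modnMDl modn_small.
rewrite inE /same_cell permKV -/c => /eqP kc.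
by apply/val_inj; rewrite /= -kc -divn_eq.
Qed.

Definition rivals t i : {set 'I_n} := [set j | (j != i) && meet t i j].

Lemma card_rivals t i : (0 < M)%N -> #|rivals t i| = M.-1.
Proof.
move=> M0; have := cardD1 i [pred j | meet t i j].
rewrite card_cell// inE same_cell_refl add1n => h.
transitivity #|[predD1 [pred j | meet t i j] & i]|; last exact/esym/(congr1 predn h).
by apply: eq_card => j; rewrite !inE.
Qed.

End Trees.

(** * Outcome of an auction in terms of the highest rival bid *)

Section Auction.
Variables (R : realType) (N M : nat) (Om : Type) (X : noise R (N * M) Om).
Variables (agent1 : 'I_(N * M)) (theta : seq (stage R) -> R -> R) (theta_o : R -> R).
Hypotheses (theta0 : forall h q, 0 <= theta h q) (theta_o0 : forall q, 0 <= theta_o q).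
Variables (t : nat) (w : Om) (s : state R N M) (i : 'I_(N * M)).

Local Notation bid := (bid agent1 theta theta_o s).
Local Notation rmax := (rival_max X agent1 theta theta_o t i w s).

Lemma bid_ge0 j : 0 <= bid j.
Proof. by rewrite /Defs.bid; case: ifP. Qed.

Lemma rival_max_ge0 : 0 <= rmax.
Proof.
rewrite /rival_max; elim/big_rec: _ => // j x _ x0.
by rewrite le_max x0 orbT.
Qed.

(** This and the next lemma enclose winning between Y < bid and Y <= bid, so that the tie-break
    never has to be analysed. *)
Lemma wins_of_rival_max_lt : rmax < bid i -> wins X agent1 theta theta_o t w s i.
Proof.
move=> h; apply/forall_inP => j jr; rewrite (le_lt_trans _ h)//.
exact: le_bigmax_cond.
Qed.

Lemma rival_max_le_of_wins : wins X agent1 theta theta_o t w s i -> rmax <= bid i.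
Proof.
move=> /forall_inP h; apply: bigmax_le => [|j jr]; first exact: bid_ge0.
by have /orP[/ltW|/andP[/eqP ->]] := h j jr.
Qed.

End Auction.

Section Law.
Context d (Om : measurableType d) (R : realType) (P : probability Om R).

Lemma law_integral (f : Om -> R) (mu : probability R R) (k : R -> \bar R) :
  measurable_fun setT f ->
  (forall B : set R, measurable B -> P [set w | B (f w)] = mu B) ->
  measurable_fun setT k -> (forall x, 0 <= k x)%E ->
  (\int[P]_w k (f w) = \int[mu]_x k x)%E.
Proof.
move=> mf fE mk k0.
pose f' : {mfun Om >-> R} := HB.pack f (isMeasurableFun.Build _ _ _ _ f mf).
transitivity (\int[distribution P f']_x k x)%E.
  by rewrite ge0_integral_distribution.
by apply: eq_measure_integral => A mA _; first [exact: fE|exact/esym/fE].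
Qed.

Lemma integral_indic_comp (T : Type) (f : Om -> T) (E : set T) :
  measurable (f @^-1` E) -> (\int[P]_w (\1_E (f w) : R)%:E = P (f @^-1` E))%E.
Proof.
move=> mE; rewrite -[in RHS](setIT (f @^-1` E)) -integral_indic//.
Qed.

Lemma measurable_slice (D : set (R * R)) x : measurable D -> measurable [set y | D (x, y)].
Proof.
move=> mD; rewrite (_ : [set y | _] = xsection D x); first exact: measurable_xsection.
by apply/seteqP; split=> y /=; rewrite /xsection /= inE.
Qed.

Lemma measurable_section (mu : probability R R) (D : set (R * R)) : measurable D ->
  measurable_fun setT (fun x => mu [set y | D (x, y)]).
Proof.
move=> mD; have := measurable_fun_xsection mu mD.
congr (measurable_fun _ _); apply/funext => x /=; congr (mu _).
by apply/seteqP; split=> y /=; rewrite /xsection /= inE.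
Qed.

End Law.

Section FixedAssignments.
Context d (Om : measurableType d) (R : realType) (P : probability Om R).
Variables (N M : nat).
Local Notation n := (N * M)%N.
Hypothesis M_gt1 : (1 < M)%N.
Variables (X : noise R n Om) (beta : R) (Phi Psi Pi : probability R R).
Hypothesis hX : noise_law P X beta Phi Psi Pi.
Variables (agent1 : 'I_n) (q1 : R).
Variables (theta : seq (stage R) -> R -> R) (theta_o : R -> R).
Hypotheses (thetaP : history_policy theta) (theta_oP : stationary_policy theta_o).
Variable rho : R -> R.
Hypotheses (rho_cont : continuous rho) (rho0 : rho 0 = 0).
Hypothesis Pi_cdf : forall x, 0 <= x -> Pi [set q | theta_o q <= x] = (rho x)%:E.
Variables a b : nat -> 'S_n.

(** With assignments and tie-breaks frozen, who meets whom is deterministic, and each remaining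
    source belongs to a single agent. *)
Definition fixed_noise : noise R n Om :=
  Noise (init X) (fun t _ => a t) (fun t _ => b t) (arrival X) (survives X) (fresh X).

Local Notation Y := fixed_noise.
Local Notation meet := (same_cell M a).
Local Notation infl := (influence meet).
Local Notation traj := (trajectory Y agent1 q1 theta theta_o).
Local Notation p := (win_prob M rho).

Definition group (t : nat) (A : {set 'I_n}) : set (source n) :=
  [set j | match j with
           | Init i => i \in A
           | Arrival s i | Survives s i | Fresh s i => (i \in A) && (s < t)%N
           | _ => false
           end].

Lemma group_disjoint t t' (A B : {set 'I_n}) :
  (forall x, x \in A -> x \in B -> False) -> group t A `&` group t' B = set0.
Proof.
move=> AB; apply/seteqP; split=> // -[i|s|s|s i|s i|s i] [] //=.
- exact: AB.
- by move=> /andP[iA _] /andP[iB _]; exact: AB iA iB.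
- by move=> /andP[iA _] /andP[iB _]; exact: AB iA iB.
- by move=> /andP[iA _] /andP[iB _]; exact: AB iA iB.
Qed.

Lemma groupS t t' (A B : {set 'I_n}) : (t <= t')%N -> A \subset B ->
  group t A `<=` group t' B.
Proof.
move=> tt /fintype.subsetP AB [i|s|s|s i|s i|s i] //=; first exact: AB.
- by move=> /andP[iA st]; rewrite AB// (leq_trans st).
- by move=> /andP[iA st]; rewrite AB// (leq_trans st).
- by move=> /andP[iA st]; rewrite AB// (leq_trans st).
Qed.

Lemma fixed_available t i K : group t (infl t i) `<=` K ->
  available (Y : noise R n (sub X K)) meet t i.
Proof.
move=> gK; split=> [j jt|s st q].
  split; first by apply: sub_init; apply: gK.
  by move=> s st; split;
    [apply: sub_arrival|apply: sub_survives|apply: sub_fresh]; apply: gK; rewrite /= jt.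
have c (s0 : 'S_n) : measurable (((fun=> s0) : sub X K -> 'S_n) @^-1` [set q]).
  by rewrite preimage_cst; case: ifP.
by split; exact: c.
Qed.

Lemma fixed_trajectory t i K : group t (infl t i) `<=` K ->
  measurable_fun setT ((fun w => queue (traj t w) i) : sub X K -> R) /\
  (i = agent1 -> measurable_state (Y : noise R n (sub X K)) agent1 q1 theta theta_o t).
Proof.
move=> gK; apply: (@measurable_trajectory R N M _ (sub X K) Y agent1 q1 theta theta_o
  thetaP theta_oP.1 meet _ (same_cell_refl M a) t i (fixed_available gK)).
by [].
Qed.

Lemma fixed_bid t i K : group t (infl t i) `<=` K ->
  measurable_fun setT ((fun w => bid agent1 theta theta_o (traj t w) i) : sub X K -> R).
Proof.
by move=> /fixed_trajectory[mq ms]; apply: (measurable_bid thetaP theta_oP.1 mq ms).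
Qed.

Definition fixed_max t i w := rival_max Y agent1 theta theta_o t i w (traj t w).

Definition influence_set t (A : {set 'I_n}) : {set 'I_n} := \bigcup_(j in A) infl t j.

Lemma fixed_max_measurable t i K : group t (influence_set t (rivals a t i)) `<=` K ->
  measurable_fun setT (fixed_max t i : sub X K -> R).
Proof.
move=> gK; rewrite /fixed_max /rival_max; elim: (index_enum _) => [|j r IH].
  by under eq_fun do rewrite big_nil; exact: measurable_cst.
under eq_fun do rewrite big_cons.
have rE w : rival Y t w i j = (j \in rivals a t i) by rewrite inE.
under eq_fun do rewrite rE.
have [jr|jr] := boolP (j \in rivals a t i); last exact: IH.
apply: measurable_maxr => //; apply: fixed_bid; apply: subset_trans gK.
by apply: groupS => //; apply: finset.bigcup_sup.
Qed.

Lemma fixed_wins_measurable t i K : group t (infl t.+1 i) `<=` K ->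
  measurable_fun setT
    ((fun w => wins Y agent1 theta theta_o t w (traj t w) i) : sub X K -> bool).
Proof.
move=> gK; have c (s s0 : 'S_n) : measurable (((fun=> s) : sub X K -> 'S_n) @^-1` [set s0]).
  by rewrite preimage_cst; case: ifP.
apply: (@measurable_wins R N M _ (sub X K) Y agent1 q1 theta theta_o meet _ (same_cell_refl M a) t i) => //.
- by move=> s0; exact: c.
- by move=> s0; exact: c.
- move=> j ij; apply: fixed_bid; apply: subset_trans gK.
  by apply: groupS => //; apply: (finset.bigcup_sup j).
Qed.

(** One agent is peeled off at a time: his influence set is disjoint from the union of the others.
    The induction therefore also records which sources the remaining intersection depends on. *)
Lemma indep_bigcap t (S : {set 'I_n}) (r : seq 'I_n) (E : 'I_n -> set Om) :
  tree_like M a t S -> uniq r -> {subset r <= S} ->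
  (forall j, j \in r -> measurable (E j : set (sub X (group t (infl t j))))) ->
  P (\big[setI/setT]_(j <- r) E j) = (\prod_(j <- r) P (E j))%E /\
  measurable (\big[setI/setT]_(j <- r) E j :
     set (sub X (group t (\bigcup_(j in r) infl t j)%SET))).
Proof.
move=> gS; elim: r => [|i r IH] /=.
  by move=> _ _ _; rewrite !big_nil probability_setT; split=> //; exact: measurableT.
move=> /andP[ir ur] rS mE.
have {}IH : P (\big[setI/setT]_(j <- r) E j) = (\prod_(j <- r) P (E j))%E /\
  measurable (\big[setI/setT]_(j <- r) E j :
     set (sub X (group t (\bigcup_(j in r) infl t j)%SET))).
  apply: IH => // [j jr|j jr]; first by apply: rS; rewrite inE jr orbT.
  by apply: mE; rewrite inE jr orbT.
have [IH1 IH2] := IH.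
rewrite !big_cons; split.
  rewrite -IH1; apply: (sub_indep_events hX _ _ IH2); last by apply: mE; rewrite inE eqxx.
  apply: group_disjoint => x xi /finset.bigcupP[j jr xj].
  apply: (influence_disjoint gS (rS i _) (rS j _) _ xi xj); rewrite ?inE ?eqxx ?jr ?orbT//.
  by apply: contraNneq ir => ->.
apply: measurableI.
  apply: sub_widen_event (mE i _); last by rewrite inE eqxx.
  by apply: groupS => //; apply: finset.bigcup_sup; rewrite inE eqxx.
apply: sub_widen_event IH2; apply: groupS => //.
apply/finset.bigcupsP => j jr; apply: (finset.bigcup_sup j) => //.
by rewrite inE jr orbT.
Qed.

Lemma fixed_max_le t i w x : 0 <= x -> agent1 \notin rivals a t i ->
  (fixed_max t i w <= x) = [forall j in rivals a t i, theta_o (queue (traj t w) j) <= x].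
Proof.
move=> x0 i1; rewrite /fixed_max /rival_max.
apply/idP/forall_inP => [h j jr|h].
  have jb : bid agent1 theta theta_o (traj t w) j = theta_o (queue (traj t w) j).
    by rewrite /bid; case: eqP => // j1; rewrite -j1 jr in i1.
  rewrite -jb; apply: le_trans h; apply: le_bigmax_cond.
  by move: jr; rewrite inE.
apply: bigmax_le => // j; rewrite -[rival _ _ _ _ _]/((j != i) && meet t i j) => jr.
have {}jr : j \in rivals a t i by rewrite inE.
have -> : bid agent1 theta theta_o (traj t w) j = theta_o (queue (traj t w) j).
  by rewrite /bid; case: eqP => // j1; rewrite -j1 jr in i1.
exact: h.
Qed.

Lemma bigsetI_forall (I : finType) (A : {set I}) (E : I -> set Om) :
  \big[setI/setT]_(j <- enum A) E j = [set w | forall j, j \in A -> E j w].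
Proof.
rewrite -bigcap_seq; apply/seteqP; split=> w h j.
  by move=> jA; apply: h; rewrite /= mem_enum.
by rewrite /= mem_enum; exact: h.
Qed.

Section Rivals.
Variables (t : nat) (i : 'I_n) (S : {set 'I_n}).
Hypothesis tS : tree_like M a t S.
Hypothesis rS : {subset rivals a t i <= S}.
Hypothesis r1 : agent1 \notin rivals a t i.
Hypothesis r_law : forall j, j \in rivals a t i -> forall B : set R, measurable B ->
  P [set w | B (queue (traj t w) j)] = Pi B.

Lemma fixed_max_cdf x : 0 <= x -> P [set w | fixed_max t i w <= x] = (p x)%:E.
Proof.
move=> x0; pose E j := [set w | theta_o (queue (traj t w) j) <= x].
have -> : [set w | fixed_max t i w <= x] = \big[setI/setT]_(j <- enum (rivals a t i)) E j.
  rewrite bigsetI_forall; apply/seteqP; split=> w /=.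
    by rewrite fixed_max_le// => /forall_inP h j jr; exact: h.
  by move=> h; rewrite fixed_max_le//; apply/forall_inP => j jr; exact: h.
have mB : measurable [set q | theta_o q <= x].
  rewrite -[X in measurable X]setTI; apply: measurable_fun_le => //.
  exact: theta_oP.1.
have sub_r : {subset enum (rivals a t i) <= S} by move=> j; rewrite mem_enum; exact: rS.
have mE j : j \in enum (rivals a t i) -> measurable (E j : set (sub X (group t (infl t j)))).
  move=> _; have [mq _] := @fixed_trajectory t j _ (@subset_refl _ _).
  by rewrite /E -[X in measurable X]setTI; exact: (mq measurableT _ mB).
have [-> _] := indep_bigcap tS (enum_uniq _) sub_r mE.
rewrite big_seq (eq_bigr (fun=> (rho x)%:E)); last first.
  by move=> j; rewrite mem_enum => jr; rewrite (r_law jr mB) Pi_cdf.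
rewrite -big_seq prodEFin big_const_seq count_predT -cardE card_rivals ?(ltnW M_gt1)//.
by rewrite /win_prob; congr EFin; elim: (M.-1) => //= k ->; rewrite exprS.
Qed.

Lemma fixed_max_measurable_Om : measurable_fun setT (fixed_max t i).
Proof. exact: (sub_measurable hX (fixed_max_measurable (@subset_refl _ _))). Qed.

Lemma p_cont : continuous p.
Proof.
move=> x; rewrite /continuous_at /win_prob; elim: (M.-1) => [|k IH].
  exact: cvg_cst.
have -> : (fun y => rho y ^+ k.+1) = (fun y => rho y * rho y ^+ k).
  by apply/funext => y; rewrite exprS.
by rewrite /= exprS; apply: cvgM => //; exact: rho_cont.
Qed.

(** The highest rival bid has no atom: for x > 0 because p is left continuous, for x = 0 because p 0
    = 0, where M > 1 enters. *)
Lemma fixed_max_lt x : 0 <= x -> P [set w | fixed_max t i w < x] = (p x)%:E.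
Proof.
move=> x0; have mY := fixed_max_measurable_Om.
have mlt y : measurable [set w | fixed_max t i w < y].
  by apply: measurable_bool_set; apply: measurable_fun_ltr.
have mle y : measurable [set w | fixed_max t i w <= y].
  by apply: measurable_bool_set; apply: measurable_fun_ler.
apply/eqP; rewrite eq_le; apply/andP; split.
  rewrite -(fixed_max_cdf x0); apply: le_measure; rewrite ?inE//.
  by move=> w /= /ltW.
have [->|xN0] := eqVneq x 0.
  have M1 : (M.-1 == 0)%N = false by rewrite -subn1 subn_eq0 leqNgt M_gt1.
  by rewrite /win_prob rho0 expr0n M1 mulr0n measure_ge0.
have {x0 xN0} x0 : 0 < x by rewrite lt_neqAle eq_sym xN0.
have fin : P [set w | fixed_max t i w < x] \is a fin_num by apply: fin_num_measure.
rewrite -(fineK fin) lee_fin.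
have h : p y @[y --> x^'-] --> p x by exact/cvg_at_left_filter/p_cont.
rewrite -(cvg_lim (@norm_hausdorff _ _) h); apply: limr_le.
  by apply/cvg_ex; eexists; exact: h.
near=> y.
have yx : y < x by near: y; exists 1 => //= z _.
have y0 : 0 <= y.
  near: y; exists x => //= z; rewrite /ball/= => zx _.
  by have := ler_norm (x - z); lra.
rewrite -lee_fin (fineK fin) -(fixed_max_cdf y0); apply: le_measure; rewrite ?inE//.
by move=> w /= /le_lt_trans; exact.
Unshelve. all: by end_near. Qed.


Lemma fixed_max_ge x : 0 <= x -> P [set w | x <= fixed_max t i w] = (1 - p x)%:E.
Proof.
move=> x0; have -> : [set w | x <= fixed_max t i w] = ~` [set w | fixed_max t i w < x].
  by apply/seteqP; split=> w /=; rewrite leNgt => /negP.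
rewrite probability_setC ?fixed_max_lt//; apply: measurable_bool_set.
by apply: measurable_fun_ltr => //; exact: fixed_max_measurable_Om.
Qed.

Lemma fixed_max_gt x : 0 <= x -> P [set w | x < fixed_max t i w] = (1 - p x)%:E.
Proof.
move=> x0; have -> : [set w | x < fixed_max t i w] = ~` [set w | fixed_max t i w <= x].
  by apply/seteqP; split=> w /=; rewrite ltNge => /negP.
rewrite probability_setC ?fixed_max_cdf//; apply: measurable_bool_set.
by apply: measurable_fun_ler => //; exact: fixed_max_measurable_Om.
Qed.

Lemma fixed_max_ge0 w : 0 <= fixed_max t i w.
Proof. exact: rival_max_ge0. Qed.

(* (x - Y)^+ is the integral over [0, x] of the indicator of Y <= u. *)
Lemma expected_shortfall x : {homo p : x y / x <= y} -> (forall x, 0 <= p x <= 1) -> 0 <= x ->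
  (\int[P]_w (Num.max (x - fixed_max t i w) 0)%:E = (primitive p x)%:E)%E.
Proof.
move=> p_mono p01 x0.
pose E : set (Om * R) := [set z | fixed_max t i z.1 <= z.2 /\ z.2 \in `[0, x]].
have mE : measurable E.
  apply: measurableI.
    apply: (measurable_bool_set (f := fun z : Om * R => fixed_max t i z.1 <= z.2)).
    apply: measurable_fun_ler => //.
    by apply: (measurableT_comp fixed_max_measurable_Om); exact: measurable_fst.
  rewrite (_ : (fun z => _) = snd @^-1` `[0, x]%classic); last by apply/seteqP; split.
  rewrite -[X in measurable X]setTI.
  exact: (@measurable_snd _ _ Om R measurableT).
have mfE : measurable_fun setT (fun z : Om * R => (\1_E z : R)%:E).
  by apply/measurable_EFinP; exact: measurable_indic.
have := @fubini_tonelli _ _ _ _ R P (@lebesgue_measure R) _ mfE (fun z => _).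
move=> /(_ _)/wrap[z|]; first by rewrite lee_fin.
have L w : (\int[@lebesgue_measure R]_u (\1_E (w, u) : R)%:E =
    (Num.max (x - fixed_max t i w) 0)%:E)%E.
  transitivity (\int[@lebesgue_measure R]_u (\1_`[fixed_max t i w, x]%classic u : R)%:E)%E.
    apply: eq_integral => u _; rewrite !indicE; congr ((nat_of_bool _)%:R%:E).
    apply/idP/idP; rewrite !inE /E /= !in_itv/=.
      by move=> [-> /andP[_ ->]].
    by move=> /andP[h1 h2]; rewrite h1 h2 (le_trans (fixed_max_ge0 w)).
  rewrite integral_indic// setIT.
  apply: eq_trans (lebesgue_measure_itv `[fixed_max t i w, x]) _; rewrite /= lte_fin.
  case: ifPn => h; first by rewrite max_l ?subr_ge0 1?ltW// EFinB.
  by rewrite max_r// subr_le0 leNgt.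
have RR u : (\int[P]_w (\1_E (w, u) : R)%:E = ((fun u => (p u)%:E) \_ `[0%R, x]) u)%E.
  rewrite patchE; case: ifPn => ux.
    have u0 : 0 <= u by move: ux; rewrite inE /= in_itv/= => /andP[].
    rewrite -(fixed_max_cdf u0).
    transitivity (\int[P]_w (\1_[set w | fixed_max t i w <= u] w : R)%:E)%E.
      apply: eq_integral => w _; rewrite !indicE; congr ((nat_of_bool _)%:R%:E).
      apply/idP/idP; rewrite !inE /E /=; first by case.
      by move=> h; split=> //; move: ux; rewrite inE.
    rewrite integral_indic ?setIT//; apply: measurable_bool_set.
    by apply: measurable_fun_ler => //; exact: fixed_max_measurable_Om.
  transitivity (\int[P]_w (cst 0%E w : \bar R))%E; last by rewrite integral0.
  apply: eq_integral => w _; rewrite indicE memNset//= => -[_].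
  by move: ux; rewrite notin_setE.
under eq_integral do rewrite L.
move=> ->; under eq_integral do rewrite RR.
rewrite -integral_mkcond /primitive /Rintegral fineK//.
exact: integrable_fin_num (monotone_integrable_itv p_mono p01 0 x).
Qed.

Hypothesis iS : i \in S.

Lemma rivals_influence_disjoint x :
  x \in infl t i -> x \in influence_set t (rivals a t i) -> False.
Proof.
move=> xi /finset.bigcupP[j jr xj].
apply: (influence_disjoint tS iS (rS jr) _ xi xj).
by move: jr; rewrite inE eq_sym => /andP[].
Qed.

(** The queue of i, his highest rival bid and his arrival depend on disjoint groups of sources. The
    comparison c ranges over weak and strict order in both directions, so one computation serves the
    two bounds on winning and the two on losing. *)
Lemma compare_prob (c : R -> R -> bool) (g : R -> R) (D : set (R * R)) :
  measurable_fun setT (fun z : R * R => c z.1 z.2) ->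
  (forall x, 0 <= x -> P [set w | c (fixed_max t i w) x] = (g x)%:E) ->
  measurable D ->
  P [set w | c (fixed_max t i w) (theta_o (queue (traj t w) i)) /\
             D (queue (traj t w) i, arrival X t i w)] =
  (\int[P]_w ((g (theta_o (queue (traj t w) i)))%:E *
              Phi [set u | D (queue (traj t w) i, u)]))%E.
Proof.
move=> mc cg mD.
pose E : set (R * (R * R)) := [set z | c z.2.1 (theta_o z.1) /\ D (z.1, z.2.2)].
have mE : measurable E.
  apply: measurableI.
    apply: (measurable_bool_set (f := fun z : R * (R * R) => c z.2.1 (theta_o z.1))).
    apply: (measurableT_comp mc) (_ : measurable_fun _ (fun z : R * (R * R) => (z.2.1, theta_o z.1))).
    apply: measurable_fun_pair; first exact: measurableT_comp.
    by apply: measurableT_comp; first exact: theta_oP.1.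
  rewrite -[X in measurable X]setTI.
  apply: (_ : measurable_fun setT (fun z : R * (R * R) => (z.1, z.2.2))) => //.
  by apply: measurable_fun_pair => //; exact: measurableT_comp.
pose K := group t (influence_set t (rivals a t i)) `|` [set Arrival t i].
have [mq _] := @fixed_trajectory t i _ (@subset_refl _ _).
have mZ : measurable_fun setT ((fun w => (fixed_max t i w, arrival X t i w)) : sub X K -> R * R).
  apply: measurable_fun_pair.
    by apply: fixed_max_measurable; exact: subsetUl.
  by apply: sub_arrival; right.
have KK : group t (infl t i) `&` K = set0.
  rewrite setIUr (group_disjoint t t rivals_influence_disjoint) set0U.
  by apply/seteqP; split=> // j [h] /= jE; move: h; rewrite jE /= ltnn andbF.
have ind := sub_independent_pair hX KK mq mZ.
have H : (\int[P]_w (\1_E (queue (traj t w) i, (fixed_max t i w, arrival X t i w)))%:E =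
    \int[P]_w \int[P]_w' (\1_E (queue (traj t w) i, (fixed_max t i w', arrival X t i w')))%:E)%E.
  apply: (independent_pair_integral (sub_measurable hX mq) (sub_measurable hX mZ)
    (f := fun z : R * (R * R) => (\1_E z)%:E) ind) => [|x]; last by rewrite lee_fin.
  by apply/measurable_EFinP; exact: measurable_indic.
have mqZ : measurable_fun setT
    (fun w : Om => (queue (traj t w) i, (fixed_max t i w, arrival X t i w))).
  exact: (measurable_fun_pair (sub_measurable hX mq) (sub_measurable hX mZ)).
rewrite integral_indic_comp in H; last first.
  by rewrite -[X in measurable X]setTI; exact: mqZ.
rewrite -[LHS]/(P ((fun w => (queue (traj t w) i, (fixed_max t i w, arrival X t i w))) @^-1` E)).
rewrite H; apply: eq_integral => w _.
set x := queue (traj t w) i.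
have mDx : measurable [set u | D (x, u)] by exact: measurable_slice.
have x0 : 0 <= theta_o x by exact: theta_oP.2.
pose K0 := group t (influence_set t (rivals a t i)).
have mEx : measurable (([set w' | c (fixed_max t i w') (theta_o x)]) : set (sub X K0)).
  have mp : measurable_fun setT ((fun w => (fixed_max t i w, theta_o x)) : sub X K0 -> R * R).
    by apply: measurable_fun_pair => //; apply: fixed_max_measurable.
  exact: (measurable_bool_set (measurableT_comp mc mp)).
have mAx : measurable ((arrival X t i @^-1` [set u | D (x, u)]) : set (sub X [set Arrival t i])).
  rewrite -[X in measurable X]setTI; apply: (_ : measurable_fun setT _) => //.
  exact: sub_arrival.
rewrite (@integral_indic_comp _ _ _ _ _ (fun w' => (x, (fixed_max t i w', arrival X t i w')))); last first.
  exact: (measurableI _ _ (sub_event hX mEx) (sub_event hX mAx)).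
rewrite -[LHS]/(P ([set w' | c (fixed_max t i w') (theta_o x)] `&`
    arrival X t i @^-1` [set u | D (x, u)])).
rewrite (sub_indep_events hX _ mEx mAx).
  rewrite cg//; congr (_ * _)%E; case: hX => _ _ _ ha _.
  by have [[_ _ ->]] := ha t i.
by apply/seteqP; split=> // j [h] /= jE; move: h; rewrite jE /= ltnn andbF.
Qed.


Hypothesis i1 : i != agent1.
Hypothesis beta01 : 0 <= beta <= 1.

Let queue_measurable : measurable_fun setT (fun w => queue (traj t w) i).
Proof.
have [mq _] := @fixed_trajectory t i _ (@subset_refl _ _).
exact: (sub_measurable hX mq).
Qed.

Let arrival_measurable : measurable_fun setT (arrival X t i).
Proof. by case: hX => _ _ _ ha _; have [[]] := ha t i. Qed.

Let wins_measurable :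
  measurable_fun setT (fun w => wins Y agent1 theta theta_o t w (traj t w) i).
Proof. exact: (sub_measurable hX (fixed_wins_measurable (@subset_refl _ _))). Qed.

Let event_measurable (c : Om -> bool) (D : set (R * R)) :
  measurable_fun setT c -> measurable D ->
  measurable [set w | c w /\ D (queue (traj t w) i, arrival X t i w)].
Proof.
move=> mc mD; apply: (measurableI [set w | c w]); first exact: measurable_bool_set.
have := measurable_fun_pair queue_measurable arrival_measurable.
by move=> /(_ measurableT D mD); rewrite setTI.
Qed.

Let bidE w : bid agent1 theta theta_o (traj t w) i = theta_o (queue (traj t w) i).
Proof. by rewrite /bid (negbTE i1). Qed.

Let theta_queue_measurable : measurable_fun setT (fun w => theta_o (queue (traj t w) i)).
Proof. by apply: measurableT_comp => //; exact: theta_oP.1. Qed.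

Let max_m := fixed_max_measurable_Om.

(* Ties are negligible: the events Y < bid and Y <= bid, between which winning
   lies, have the same probability. *)
Lemma wins_prob (D : set (R * R)) : measurable D ->
  P [set w | wins Y agent1 theta theta_o t w (traj t w) i /\
             D (queue (traj t w) i, arrival X t i w)] =
  (\int[P]_w ((p (theta_o (queue (traj t w) i)))%:E *
              Phi [set u | D (queue (traj t w) i, u)]))%E.
Proof.
move=> mD; apply/eqP; rewrite eq_le; apply/andP; split.
  rewrite -(compare_prob (c := fun y x => y <= x) _ fixed_max_cdf mD); last first.
    exact: measurable_fun_ler.
  apply: le_measure; rewrite ?inE.
  - exact: event_measurable.
  - by apply: (event_measurable _ mD); exact: measurable_fun_ler.
  - move=> w [win Dw]; split=> //; rewrite -bidE.
    by apply: (rival_max_le_of_wins thetaP.2 theta_oP.2 win).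
rewrite -(compare_prob (c := fun y x => y < x) _ fixed_max_lt mD); last first.
  exact: measurable_fun_ltr.
apply: le_measure; rewrite ?inE.
- by apply: (event_measurable _ mD); exact: measurable_fun_ltr.
- exact: event_measurable.
- move=> w [lt Dw]; split=> //; apply: wins_of_rival_max_lt.
  by rewrite bidE.
Qed.

Lemma loses_prob (D : set (R * R)) : measurable D ->
  P [set w | ~~ wins Y agent1 theta theta_o t w (traj t w) i /\
             D (queue (traj t w) i, arrival X t i w)] =
  (\int[P]_w ((1 - p (theta_o (queue (traj t w) i)))%:E *
              Phi [set u | D (queue (traj t w) i, u)]))%E.
Proof.
move=> mD; have mN : measurable_fun setT
    (fun w => ~~ wins Y agent1 theta theta_o t w (traj t w) i) by exact: measurable_neg.
apply/eqP; rewrite eq_le; apply/andP; split.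
  rewrite -(compare_prob (c := fun y x => x <= y) (g := fun x => 1 - p x) _ fixed_max_ge mD); last first.
    exact: measurable_fun_ler.
  apply: le_measure; rewrite ?inE.
  - exact: event_measurable.
  - by apply: (event_measurable _ mD); exact: measurable_fun_ler.
  - move=> w [win Dw]; split=> //; rewrite -bidE leNgt; apply: contra win.
    exact: wins_of_rival_max_lt.
rewrite -(compare_prob (c := fun y x => x < y) (g := fun x => 1 - p x) _ fixed_max_gt mD); last first.
  exact: measurable_fun_ltr.
apply: le_measure; rewrite ?inE.
- by apply: (event_measurable _ mD); exact: measurable_fun_ltr.
- exact: event_measurable.
- move=> w [lt Dw]; split=> //; apply: contraL lt => win.
  by rewrite -leNgt -bidE; apply: (rival_max_le_of_wins thetaP.2 theta_oP.2 win).
Qed.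

Hypothesis p01 : forall x, 0 <= p x <= 1.
Hypothesis p_mono : {homo p : x y / x <= y}.
Hypothesis q_law : forall B : set R, measurable B ->
  P [set w | B (queue (traj t w) i)] = Pi B.
Hypothesis Pi_inv : forall B : set R, measurable B -> Pi B =
  (\int[Pi]_q ((beta * p (theta_o q))%:E * Phi [set u | B (served q + u)%R]
     + (beta * (1 - p (theta_o q)))%:E * Phi [set u | B (q + u)%R]
     + (1 - beta)%:E * Psi B))%E.

(** Against M - 1 independent rivals with law Pi, one round of the finite system moves the queue
    exactly by the mean field kernel, under which Pi is invariant. *)
Lemma next_queue_law (B : set R) : measurable B ->
  P [set w | B (queue (traj t.+1 w) i)] = Pi B.
Proof.
move=> mB; have /andP[b0 b1] := beta01.
have b1' : 0 <= 1 - beta by rewrite subr_ge0.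
pose win w := wins Y agent1 theta theta_o t w (traj t w) i.
pose D1 : set (R * R) := [set z | B (served z.1 + z.2)].
pose D2 : set (R * R) := [set z | B (z.1 + z.2)].
have mD1 : measurable D1.
  have m : measurable_fun setT (fun z : R * R => served z.1 + z.2).
    by apply: measurable_funD => //; apply: measurableT_comp => //; exact: served_measurable.
  by have := m measurableT B mB; rewrite setTI.
have mD2 : measurable D2.
  have m : measurable_fun setT (fun z : R * R => z.1 + z.2) by exact: measurable_funD.
  by have := m measurableT B mB; rewrite setTI.
pose S' := [set w | survives X t i w].
pose G := [set w | B ((if win w then served (queue (traj t w) i) else queue (traj t w) i)
                      + arrival X t i w)].
pose Fr := [set w | B (fresh X t i w)].
(* The past of the whole cell of i, which decides the auction, and his arrival; his survival and
   regeneration value of this round lie outside. *)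
pose KG := group t (infl t.+1 i) `|` [set Arrival t i].
have sS : measurable (S' : set (sub X [set Survives t i])).
  by apply: measurable_bool_set; exact: sub_survives.
have sF : measurable (Fr : set (sub X [set Fresh t i])).
  have m : measurable_fun setT (fresh X t i : sub X [set Fresh t i] -> R) by exact: sub_fresh.
  by have := m measurableT B mB; rewrite setTI.
have sG : measurable (G : set (sub X KG)).
  have m : measurable_fun setT ((fun w => (if win w then served (queue (traj t w) i)
      else queue (traj t w) i) + arrival X t i w) : sub X KG -> R).
    have mq : measurable_fun setT ((fun w => queue (traj t w) i) : sub X KG -> R).
      apply: (fixed_trajectory (i := i) (K := KG) _).1; apply: subset_trans (@subsetUl _ _ _).
      by apply: groupS => //; apply: (finset.bigcup_sup i) => //; exact: same_cell_refl.
    apply: measurable_funD; last by apply: sub_arrival; right.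
    apply: measurable_fun_ifT => //.
      by apply: fixed_wins_measurable; exact: subsetUl.
    by apply: (measurableT_comp (@served_measurable R) mq).
  by have := m measurableT B mB; rewrite setTI.
have mS := sub_event hX sS; have mF := sub_event hX sF; have mG := sub_event hX sG.
have PS : P S' = beta%:E.
  case: hX => _ _ _ _ hs; have [_ <-] := hs t i; congr (P _).
have PF : P Fr = Psi B by case: hX => _ _ _ ha _; have [_ [_ _ ->]] := ha t i.
have PSG : P (S' `&` G) = (beta%:E * P G)%E.
  rewrite -PS; apply: (sub_indep_events hX _ sS sG).
  by apply/seteqP; split=> // j [/= -> []] //=; rewrite ltnn andbF.
have PSF : P (~` S' `&` Fr) = ((1 - beta)%:E * Psi B)%E.
  rewrite -PF (sub_indep_events hX _ (measurableC sS) sF).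
    by rewrite probability_setC// PS.
  by apply/seteqP; split=> // j [/= ->].
have PG : P G = (\int[P]_w ((p (theta_o (queue (traj t w) i)))%:E *
              Phi [set u | D1 (queue (traj t w) i, u)]) +
   \int[P]_w ((1 - p (theta_o (queue (traj t w) i)))%:E *
              Phi [set u | D2 (queue (traj t w) i, u)]))%E.
  rewrite -wins_prob// -loses_prob// -measureU.
  - congr (P _); apply/seteqP; split=> w; rewrite /G/= -/(win w).
      by case: (win w) => h; [left|right].
    by case=> -[]; case: (win w).
  - exact: event_measurable.
  - by apply: event_measurable => //; exact: measurable_neg.
  - by apply/seteqP; split=> // w [[/= h _] [/= /negP h' _]].
have mp : measurable_fun setT (fun q => p (theta_o q)).
  by apply: measurableT_comp theta_oP.1; exact: nondecreasing_measurable.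
have mf1 : measurable_fun setT (fun q => (p (theta_o q))%:E * Phi [set u | D1 (q, u)])%E.
  apply: emeasurable_funM; first exact/measurable_EFinP.
  exact: measurable_section.
have mf2 : measurable_fun setT (fun q => (1 - p (theta_o q))%:E * Phi [set u | D2 (q, u)])%E.
  apply: emeasurable_funM; first by apply/measurable_EFinP; apply: measurable_funB.
  exact: measurable_section.
have f10 q : (0 <= (p (theta_o q))%:E * Phi [set u | D1 (q, u)])%E.
  by rewrite mule_ge0// lee_fin; have /andP[] := p01 (theta_o q).
have f20 q : (0 <= (1 - p (theta_o q))%:E * Phi [set u | D2 (q, u)])%E.
  by rewrite mule_ge0// lee_fin subr_ge0; have /andP[] := p01 (theta_o q).
have -> : [set w | B (queue (traj t.+1 w) i)] = (S' `&` G) `|` (~` S' `&` Fr).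
  apply/seteqP; split=> w; rewrite /= /next_queue /= -/(win w) /S' /G /Fr /=.
    by case: (survives X t i w) => h; [left|right].
  by case: (survives X t i w) => -[] [].
rewrite measureU; last 3 first.
- exact: measurableI.
- by apply: measurableI => //; exact: measurableC.
- by apply/seteqP; split=> // w [[h _] [h' _]].
transitivity (beta%:E * P G + (1 - beta)%:E * Psi B)%E.
  by congr (_ + _)%E; [exact: PSG|exact: PSF].
rewrite PG.
rewrite (law_integral queue_measurable q_law mf1 f10) (law_integral queue_measurable q_law mf2 f20).
rewrite [RHS]Pi_inv//.
under [RHS]eq_integral => q _ do rewrite !EFinM -!muleA.
rewrite ge0_integralD//; last 3 first.
- move=> q _; apply: adde_ge0; apply: mule_ge0; rewrite ?lee_fin//; do ?[exact: f10|exact: f20].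
- by apply: emeasurable_funD; apply: measurable_funeM.
- by move=> q _; rewrite mule_ge0 ?lee_fin.
rewrite ge0_integralD//; last 4 first.
- by move=> q _; apply: mule_ge0; rewrite ?lee_fin//; do ?exact: f10.
- exact: measurable_funeM.
- by move=> q _; apply: mule_ge0; rewrite ?lee_fin//; do ?exact: f20.
- exact: measurable_funeM.
have Ic (c : \bar R) : (\int[Pi]_q c = c)%E.
  transitivity (c * Pi setT)%E; first exact: (integral_cst Pi measurableT c).
  by transitivity (c * 1)%E; [congr (_ * _)%E; exact: probability_setT|rewrite mule1].
rewrite !ge0_integralZl_EFin//; congr (_ + _)%E; last by congr (_ * _)%E; exact/esym/Ic.
by rewrite ge0_muleDr//; apply: integral_ge0.
Qed.

End Rivals.

Hypothesis beta01 : 0 <= beta <= 1.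
Hypothesis p01 : forall x, 0 <= p x <= 1.
Hypothesis p_mono : {homo p : x y / x <= y}.
Hypothesis Pi_inv : forall B : set R, measurable B -> Pi B =
  (\int[Pi]_q ((beta * p (theta_o q))%:E * Phi [set u | B (served q + u)%R]
     + (beta * (1 - p (theta_o q)))%:E * Phi [set u | B (q + u)%R]
     + (1 - beta)%:E * Psi B))%E.

Lemma agent1_not_rival t (S : {set 'I_n}) i : separated M (a t) S ->
  agent1 \in S -> i \in S -> agent1 \notin rivals a t i.
Proof.
move=> sS S1 iS; rewrite inE; apply/negP => /andP[i1 m].
by have := separated_cell sS iS S1; rewrite eq_sym m => /(_ i1).
Qed.

(** Exact for every t, by induction along the tree. Keeping agent 1 in S makes his tree disjoint
    from that of i, so his arbitrary policy never enters the past of i. *)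
Lemma queue_law t (S : {set 'I_n}) i : tree_like M a t S -> agent1 \in S -> i \in S ->
  i != agent1 -> forall B : set R, measurable B ->
  P [set w | B (queue (traj t w) i)] = Pi B.
Proof.
elim: t S i => [|t IH] S i tS S1 iS i1 B mB.
  rewrite /= (negbTE i1); case: hX => _ hi _ _ _; have [_ _ <-//] := hi i.
have /andP[sep tC] := tS.
have cell k l : k \in S -> meet t k l -> l \in cells_of M (a t) S by exact: tree_like_cell.
have C1 : agent1 \in cells_of M (a t) S by exact: cell S1 (same_cell_refl _ _ _ _).
have Ci : i \in cells_of M (a t) S by exact: cell iS (same_cell_refl _ _ _ _).
have rC : {subset rivals a t i <= cells_of M (a t) S}.
  by move=> j; rewrite inE => /andP[_]; exact: cell.
have r1 := agent1_not_rival sep S1 iS.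
apply: (next_queue_law tC rC r1 _ Ci i1 beta01 p01 p_mono _ Pi_inv mB).
  move=> j jr; apply: (IH _ _ tC C1 (rC _ jr)).
  by apply: contraNneq r1 => <-.
exact: IH tC C1 Ci i1.
Qed.

(** The trees of the rivals are disjoint from that of agent 1, so Y is independent of his queue and
    survival, whatever policy produced them. Averaging over Y first gives H(D). *)
Lemma agent1_shortfall t (D : R -> R) : tree_like M a t.+1 [set agent1] ->
  measurable_fun setT D -> (forall q, 0 <= D q) ->
  (\int[P]_w (if alive (traj t w)
              then Num.max (D (queue (traj t w) agent1) - fixed_max t agent1 w) 0
              else 0)%:E =
   \int[P]_w (if alive (traj t w) then primitive p (D (queue (traj t w) agent1))
              else 0)%:E)%E.
Proof.
move=> /andP[sep tC] mD D0.
have S1 : agent1 \in [set agent1]%SET by rewrite inE.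
set C := cells_of _ _ _ in tC.
have cell l : meet t agent1 l -> l \in C by exact: tree_like_cell.
have C1 : agent1 \in C by exact: cell (same_cell_refl _ _ _ _).
have rC : {subset rivals a t agent1 <= C}.
  by move=> j; rewrite inE => /andP[_]; exact: cell.
have r1 : agent1 \notin rivals a t agent1 by rewrite inE eqxx.
have rlaw j : j \in rivals a t agent1 -> forall B : set R, measurable B ->
    P [set w | B (queue (traj t w) j)] = Pi B.
  move=> jr; apply: (queue_law tC C1 (rC _ jr)).
  by apply: contraNneq r1 => jE; rewrite -{1}jE.
have [mq /(_ erefl) [_ ma _]] := @fixed_trajectory t agent1 _ (@subset_refl _ _).
have mX := measurable_fun_pair ma mq.
have mY := fixed_max_measurable (@subset_refl _ (group t (influence_set t (rivals a t agent1)))).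
have KK := group_disjoint t t (rivals_influence_disjoint tC rC C1).
have ind := sub_independent_pair hX KK mX mY.
pose f (z : bool * R * R) : \bar R := (if z.1.1 then Num.max (D z.1.2 - z.2) 0 else 0)%:E.
have mf : measurable_fun setT f.
  apply/measurable_EFinP; apply: measurable_fun_ifT.
  - by apply: measurableT_comp; exact: measurable_fst.
  - apply: measurable_maxr => //; apply: measurable_funB => //.
    by apply: (measurableT_comp mD); apply: measurableT_comp; [exact: measurable_snd|exact: measurable_fst].
  - exact: measurable_cst.
have f0 z : (0 <= f z)%E by rewrite /f lee_fin; case: ifP => // _; rewrite le_max lexx orbT.
rewrite [LHS](independent_pair_integral (sub_measurable hX mX) (sub_measurable hX mY)
  (f := f) ind mf f0).
apply: eq_integral => w _; rewrite /f /=; case: (alive _); last by rewrite integral0.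
exact: (expected_shortfall tC rC r1 rlaw p_mono p01).
Qed.

End FixedAssignments.

(** * Random assignments *)

Lemma fin_exists_measurable d (T : measurableType d) (I : finType) (Q : pred I)
  (E : I -> set T) : (forall i, measurable (E i)) ->
  measurable [set w | exists2 i, Q i & E i w].
Proof.
move=> mE; rewrite (_ : [set w | _] = \bigcup_(i in [set i | Q i]) E i).
  by apply: fin_bigcup_measurable => [|i _]; [exact: finite_finset|exact: mE].
by apply/seteqP; split=> w /= [i Qi Ei]; exists i.
Qed.

Lemma prob_exists_le d (Om : measurableType d) (R : realType) (P : probability Om R)
  (I : finType) (Q : pred I) (E : I -> set Om) : (forall i, measurable (E i)) ->
  (P [set w | exists2 i, Q i & E i w] <= \sum_(i | Q i) P (E i))%E.
Proof.
move=> mE; have -> : [set w | exists2 i, Q i & E i w] =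
    [set w | exists2 i, i \in enum Q & E i w].
  apply/seteqP; split=> w /= [i Qi Ei]; exists i => //; first by rewrite mem_enum.
  by move: Qi; rewrite mem_enum.
have -> : (\sum_(i | Q i) P (E i) = \sum_(i <- enum Q) P (E i))%E by rewrite big_enum.
elim: (enum Q) => [|i s IH].
  rewrite big_nil (_ : [set w | _] = set0) ?measure0//.
  by apply/seteqP; split=> // w /= [].
have mU : measurable [set w | exists2 j, j \in s & E j w].
  exact: (fin_exists_measurable (mem s)).
rewrite big_cons; apply: le_trans (leeD (le_refl _) IH).
rewrite (_ : [set w | _] = E i `|` [set w | exists2 j, j \in s & E j w]).
  exact: measureU2.
apply/seteqP; split=> w /=.
  by move=> [k]; rewrite inE => /predU1P[->|ks] Ek; [left|right; exists k].
by move=> [Ej|[k ks Ek]]; [exists i; rewrite ?inE ?eqxx|exists k; rewrite ?inE ?ks ?orbT].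
Qed.

(** * Probability that interaction trees meet *)

Section SameCell.
Variables (N M : nat).
Local Notation n := (N * M)%N.
Hypotheses (M_gt1 : (1 < M)%N) (N_gt0 : (0 < N)%N).

(** By symmetry under transpositions, the number of permutations placing k with i is the same for
    every k other than i. These numbers sum to n! (M - 1), and N (M - 1) <= N M - 1. *)
Lemma card_same_cell (i j : 'I_n) : i != j ->
  (N * #|[pred s : 'S_n | (s j %/ M == s i %/ M)%N]| <= n`!)%N.
Proof.
move=> ij; pose c k := #|[pred s : 'S_n | (s k %/ M == s i %/ M)%N]|.
have cE k : k != i -> c k = c j.
  move=> ki; rewrite /c -!sum1_card (reindex_inj (mulgI (tperm j k))) /=.
  apply: eq_bigl => s; rewrite !inE !permM tpermR tpermD// 1?eq_sym//.
have total : (\sum_(k | k != i) c k = n`! * M.-1)%N.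
  transitivity (\sum_(s : 'S_n) M.-1)%N; last first.
    by rewrite sum_nat_const card_Sn.
  transitivity (\sum_(s : 'S_n) \sum_(k | (k != i) && (s k %/ M == s i %/ M)%N) 1)%N.
    rewrite (exchange_big_dep (fun k => k != i)) /=; last by move=> s k _ /andP[].
    apply: eq_bigr => k ki; rewrite /c -sum1_card; apply: eq_bigl => s.
    by rewrite inE ki.
  apply: eq_bigr => s _; rewrite -(card_rivals (fun=> s) 0 i (ltnW M_gt1)) -sum1_card.
  by apply: eq_bigl => k; rewrite inE.
have {}total : (n.-1 * c j = n`! * M.-1)%N.
  rewrite -total (eq_bigr (fun=> c j)) => [|k ki]; last exact: cE.
  rewrite sum_nat_const; congr (_ * _)%N.
  by have := cardC1 i; rewrite card_ord => <-; apply: eq_card => k; rewrite !inE.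
have n1 : (0 < n.-1)%N by rewrite -subn1 subn_gt0; nia.
have h : (N * M.-1 <= n.-1)%N by nia.
by rewrite -/(c j) -(leq_pmul2l n1) mulnCA total mulnCA [leqRHS]mulnC leq_mul2l h orbT.
Qed.

End SameCell.

Section BadTrees.
Context d (Om : measurableType d) (R : realType) (P : probability Om R).
Variables (N M : nat).
Local Notation n := (N * M)%N.
Hypotheses (M_gt1 : (1 < M)%N) (N_gt0 : (0 < N)%N).
Variables (X : noise R n Om) (beta : R) (Phi Psi Pi : probability R R).
Hypothesis hX : noise_law P X beta Phi Psi Pi.

Lemma assign_measurable t p : measurable (assign X t @^-1` [set p]).
Proof. by case: hX => _ _ hp _ _; have [/(_ p) []] := hp t. Qed.

Lemma assign_prob t (f : pred 'S_n) :
  (P [set w | f (assign X t w)] <= (#|f|%:R / n`!%:R)%:E)%E.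
Proof.
have -> : [set w | f (assign X t w)] = [set w | exists2 p, f p & (assign X t @^-1` [set p]) w].
  apply/seteqP; split=> w /=; first by move=> fw; exists (assign X t w).
  by move=> [p fp ->].
apply: le_trans (prob_exists_le _ _ (assign_measurable t)) _.
rewrite (eq_bigr (fun=> (n`!%:R^-1)%:E)) => [|p _]; last first.
  by case: hX => _ _ hp _ _; have [/(_ p) []] := hp t.
by rewrite sumEFin lee_fin sumr_const mulr_natl.
Qed.

Lemma same_cell_prob t (i j : 'I_n) : i != j ->
  (P [set w | (assign X t w j %/ M == assign X t w i %/ M)%N] <= (N%:R^-1)%:E)%E.
Proof.
move=> ij; apply: le_trans (assign_prob t (fun s : 'S_n => (s j %/ M == s i %/ M)%N)) _.
have f0 : 0 < (n`!%:R : R) by rewrite ltr0n fact_gt0.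
have N0 : 0 < (N%:R : R) by rewrite ltr0n.
rewrite lee_fin ler_pdivrMr// ler_pdivlMl// -natrM ler_nat.
exact: card_same_cell.
Qed.

Definition tree_like_at (t : nat) (S : {set 'I_n}) (w : Om) : bool :=
  tree_like M (fun s => assign X s w) t S.

Definition past_assignments t : set (source n) :=
  [set j | if j is Assign s then (s < t)%N else False].

Lemma tree_like_measurable t S :
  measurable ([set w | tree_like_at t S w] : set (sub X (past_assignments t))).
Proof.
elim: t S => [|t IH] S.
  rewrite (_ : [set w | _] = setT); first exact: measurableT.
  by apply/seteqP; split.
rewrite (_ : [set w | _] = \bigcup_(s in [set s : 'S_n | separated M s S])
  (assign X t @^-1` [set s] `&` [set w | tree_like_at t (cells_of M s S) w])).
  apply: fin_bigcup_measurable => [|s _]; first exact: finite_finset.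
  apply: measurableI; first by apply: sub_assign => /=.
  by apply: sub_widen_event (IH _) => -[] //= s' /ltnW.
apply/seteqP; split=> w /=; first by move=> /andP[h1 h2]; exists (assign X t w).
by move=> [s h1 [/= sE h2]]; rewrite /tree_like_at /= sE; apply/andP; split.
Qed.

Lemma bad_tree_measurable t S : measurable [set w | ~~ tree_like_at t S w].
Proof.
rewrite (_ : [set w | _] = ~` [set w | tree_like_at t S w]).
  by apply: measurableC; exact: (sub_event hX (tree_like_measurable S)).
by apply/seteqP; split=> w /negP.
Qed.

(* A set of k agents collides in some cell with probability at most k^2/N, and its
   cells contain at most k M agents. *)
Fixpoint tree_bound t k : nat :=
  if t is t'.+1 then (k * k + tree_bound t' (k * M))%N else 0%N.

Lemma tree_bound_mono t k l : (k <= l)%N -> (tree_bound t k <= tree_bound t l)%N.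
Proof. by elim: t k l => //= t IH k l kl; rewrite leq_add ?leq_mul// IH// leq_mul. Qed.

Lemma card_cells_of (s : 'S_n) (S : {set 'I_n}) : (#|cells_of M s S| <= #|S| * M)%N.
Proof.
rewrite -sum1_card; apply: (@leq_trans (\sum_(i in S) \sum_(j | (s j %/ M == s i %/ M)%N) 1)).
  rewrite (exchange_big_dep xpredT)//= big_mkcond; apply: leq_sum => j _.
  case: ifP => //; rewrite inE => /exists_inP[i iS h].
  by rewrite (bigD1 i) ?iS.
rewrite -sum_nat_const; apply: leq_sum => i iS; rewrite sum1_card; apply: eq_leq.
apply: etrans (card_cell (fun=> s) 0 i (ltnW M_gt1)).
exact: eq_card.
Qed.

(** The latest assignment is examined first. A collision within S is handled by a union bound over
    pairs. For each value s of this assignment the induction hypothesis applies to the deterministic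
    set [cells_of M s S], the earlier assignments being independent of it. *)
Lemma bad_tree_prob t (S : {set 'I_n}) :
  (P [set w | ~~ tree_like_at t S w] <= ((tree_bound t #|S|)%:R / N%:R)%:E)%E.
Proof.
have N0 : 0 < (N%:R : R) by rewrite ltr0n.
elim: t S => [|t IH] S.
  by rewrite mul0r (_ : [set w | _] = set0) ?measure0//; apply/seteqP; split.
pose E1 := [set w | exists2 ij : 'I_n * 'I_n, [&& ij.1 \in S, ij.2 \in S & ij.1 != ij.2] &
  [set w | (assign X t w ij.2 %/ M == assign X t w ij.1 %/ M)%N] w].
pose E2 := [set w | exists2 s : 'S_n, xpredT s & (assign X t @^-1` [set s] `&`
  [set w | ~~ tree_like_at t (cells_of M s S) w]) w].
have mE2 (s : 'S_n) : measurable (assign X t @^-1` [set s] `&`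
    [set w | ~~ tree_like_at t (cells_of M s S) w]).
  by apply: measurableI; [exact: assign_measurable|exact: bad_tree_measurable].
have mE1 (ij : 'I_n * 'I_n) :
    measurable [set w | (assign X t w ij.2 %/ M == assign X t w ij.1 %/ M)%N].
  apply: measurable_bool_set.
  exact: (measurable_finite_comp (fun s : 'S_n => (s ij.2 %/ M == s ij.1 %/ M)%N)
    (assign_measurable t)).
have sub12 : [set w | ~~ tree_like_at t.+1 S w] `<=` E1 `|` E2.
  move=> w /=; rewrite /tree_like_at /= negb_and => /orP[|h]; last first.
    by right; exists (assign X t w).
  move=> /forall_inPn[i iS /forall_inPn[j jS]]; rewrite negb_imply => /andP[h ij].
  by left; exists (i, j) => //=; rewrite iS jS ij.
have P1 : (P E1 <= ((#|S| * #|S|)%:R / N%:R)%:E)%E.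
  apply: le_trans (prob_exists_le _ _ mE1) _.
  apply: (@le_trans _ _ (\sum_(ij : 'I_n * 'I_n | (ij.1 \in S) && (ij.2 \in S)) (N%:R^-1)%:E)%E).
    rewrite [leRHS](bigID (fun ij : 'I_n * 'I_n => ij.1 != ij.2)) /=.
    under [X in (_ <= X + _)%E]eq_bigl do rewrite -andbA.
    apply: (@le_trans _ _ (\sum_(ij : 'I_n * 'I_n | [&& ij.1 \in S, ij.2 \in S & ij.1 != ij.2])
       (N%:R^-1)%:E)%E).
      by apply: lee_sum => ij /and3P[_ _ h]; exact: same_cell_prob.
    by rewrite leeDl// sume_ge0// => ij _; rewrite lee_fin invr_ge0 ltW.
  rewrite sumEFin lee_fin sumr_const -[X in X <= _]mulr_natl ler_wpM2r ?invr_ge0 ?(ltW N0)// ler_nat.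
  by rewrite -cardsX; apply: eq_leq; apply: eq_card => ij; rewrite !inE.
have P2 : (P E2 <= ((tree_bound t (#|S| * M))%:R / N%:R)%:E)%E.
  apply: le_trans (prob_exists_le _ _ mE2) _.
  apply: (@le_trans _ _ (\sum_(s : 'S_n) (n`!%:R^-1 * ((tree_bound t (#|S| * M))%:R / N%:R))%:E)%E).
    apply: lee_sum => s _.
    rewrite (sub_indep_events hX (K := [set Assign _ t]) (K' := past_assignments t)); last 3 first.
    - by apply/seteqP; split=> // j [/= ->]; rewrite /= ltnn.
    - exact: sub_assign.
    - rewrite (_ : [set w | _] = ~` [set w | tree_like_at t (cells_of M s S) w]).
        by apply: measurableC; exact: tree_like_measurable.
      by apply/seteqP; split=> w /negP.
    rewrite EFinM; apply: lee_pmul => //.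
      by case: hX => _ _ hp _ _; have [/(_ s) [_ ->]] := hp t.
    apply: le_trans (IH _) _; rewrite lee_fin ler_wpM2r ?invr_ge0 ?(ltW N0)// ler_nat.
    by apply: tree_bound_mono; exact: card_cells_of.
  rewrite sumEFin lee_fin sumr_const card_Sn -[X in X <= _]mulr_natl -?mulrA mulVKf; first exact: lexx.
  by rewrite pnatr_eq0 -lt0n fact_gt0.
apply: (@le_trans _ _ (P (E1 `|` E2))).
  apply: le_measure; rewrite ?inE//; first exact: bad_tree_measurable.
  by apply: measurableU; exact: fin_exists_measurable.
apply: (@le_trans _ _ (P E1 + P E2)%E).
  by apply: measureU2; apply: fin_exists_measurable.
by apply: le_trans (leeD P1 P2) _; rewrite -EFinD -mulrDl -natrD.
Qed.


End BadTrees.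

(** * Conditioning on assignments and tie-breaks *)

Section FiniteDecomposition.
Context d (Om : measurableType d) (R : realType) (P : probability Om R).
Variables (n : nat) (X : noise R n Om) (beta : R) (Phi Psi Pi : probability R R).
Hypothesis hX : noise_law P X beta Phi Psi Pi.
Variables (K K' : set (source n)) (Z : finType) (code : Om -> Z) (good : pred Z).
Hypothesis KK' : K `&` K' = set0.
Hypothesis m_code : forall z, measurable (code @^-1` [set z] : set (sub X K)).

Definition nonneg_sub (f : Om -> R) : Prop :=
  measurable_fun setT (f : sub X K' -> R) /\ forall w, 0 <= f w.

Lemma integral_on_code z (f : Om -> R) : nonneg_sub f ->
  (\int[P]_w (if code w == z then f w else 0)%:E =
   \int[P]_w (if code w == z then \int[P]_w' (f w')%:E else 0))%E.
Proof.
move=> [mf f0]; have mb : measurable_fun setT ((fun w => code w == z) : sub X K -> bool).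
  apply: (measurable_fun_bool true); rewrite setTI (_ : _ @^-1` _ = code @^-1` [set z]) //.
  by apply/seteqP; split=> w /= /eqP.
have ind := sub_independent_pair hX KK' mb mf.
(* Truncation at 0 makes the integrand nonnegative on the whole product space; it does not change
   the values of the nonnegative f. *)
pose g (x : bool * R) : \bar R := (if x.1 then Num.max x.2 0 else 0)%:E.
have mg : measurable_fun setT g.
  apply/measurable_EFinP; apply: measurable_fun_ifT => //.
  by apply: measurable_maxr.
have g0 x : (0 <= g x)%E.
  by rewrite /g lee_fin; case: ifP => // _; rewrite le_max lexx orbT.
have := independent_pair_integral (sub_measurable hX mb) (sub_measurable hX mf) ind mg g0.
rewrite /g /=; under eq_integral do rewrite max_l//.
move=> ->; apply: eq_integral => w _; case: ifP => _; last by rewrite integral0.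
by apply: eq_integral => w' _; rewrite max_l.
Qed.

(** [code] takes finitely many values and is independent of the sources in K', so on each event
    [code w = z] the function [Fz z] may be averaged separately. *)
Lemma decomposed_integral (F : Om -> R) (Fz : Z -> Om -> R) :
  (forall w, F w = Fz (code w) w) -> (forall z, nonneg_sub (Fz z)) ->
  (\int[P]_w (if good (code w) then F w else 0)%:E =
   \sum_(z <- enum good) \int[P]_w (if code w == z then \int[P]_w' (Fz z w')%:E else 0))%E.
Proof.
move=> FE FzP.
transitivity (\int[P]_w \sum_(z <- enum good) (if code w == z then Fz z w else 0)%:E)%E.
  apply: eq_integral => w _; rewrite sumEFin big_enum /=; congr EFin.
  case: ifPn => gw.
    rewrite (bigD1 (code w))//= eqxx big1 ?addr0// => z /andP[_ zw].
    by rewrite eq_sym (negbTE zw).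
  by rewrite big1// => z gz; case: eqP => // wz; move: gw; rewrite wz => /negP.
rewrite ge0_integral_sum//.
- by apply: eq_bigr => z _; exact: integral_on_code.
- move=> z; apply/measurable_EFinP; apply: measurable_fun_ifT => //.
    apply: (measurable_fun_bool true); rewrite setTI (_ : _ @^-1` _ = code @^-1` [set z]).
      exact: (sub_event hX (m_code z)).
    by apply/seteqP; split=> w /= /eqP.
  exact: (sub_measurable hX (FzP z).1).
- by move=> z w _; rewrite lee_fin; case: ifP => // _; exact: (FzP z).2.
Qed.

Lemma decomposed_integral_eq (F G : Om -> R) (Fz Gz : Z -> Om -> R) :
  (forall w, F w = Fz (code w) w) -> (forall w, G w = Gz (code w) w) ->
  (forall z, nonneg_sub (Fz z)) -> (forall z, nonneg_sub (Gz z)) ->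
  (forall z, good z -> \int[P]_w (Fz z w)%:E = \int[P]_w (Gz z w)%:E)%E ->
  (\int[P]_w (if good (code w) then F w else 0)%:E =
   \int[P]_w (if good (code w) then G w else 0)%:E)%E.
Proof.
move=> FE GE FP GP FG; rewrite (decomposed_integral FE FP) (decomposed_integral GE GP).
by apply: eq_big_seq => z; rewrite mem_enum => gz; rewrite FG.
Qed.

End FiniteDecomposition.

Section Extensionality.
Variables (R : realType) (N M : nat) (Om : Type) (X X' : noise R (N * M) Om).
Variables (agent1 : 'I_(N * M)) (q1 : R) (theta : seq (stage R) -> R -> R) (theta_o : R -> R).
Variable w : Om.
Hypothesis same : [/\ forall i, init X i w = init X' i w,
  forall t i, arrival X t i w = arrival X' t i w,
  forall t i, survives X t i w = survives X' t i w
  & forall t i, fresh X t i w = fresh X' t i w].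

Lemma rival_max_ext t i s : assign X t w = assign X' t w ->
  rival_max X agent1 theta theta_o t i w s = rival_max X' agent1 theta theta_o t i w s.
Proof. by move=> aE; apply: eq_bigl => j; rewrite /rival aE. Qed.

Lemma wins_ext t s i : assign X t w = assign X' t w -> tiebreak X t w = tiebreak X' t w ->
  wins X agent1 theta theta_o t w s i = wins X' agent1 theta theta_o t w s i.
Proof. by move=> aE bE; apply: eq_forallb => j; rewrite /rival aE bE. Qed.

Lemma trajectory_ext t :
  (forall s, (s < t)%N -> assign X s w = assign X' s w /\ tiebreak X s w = tiebreak X' s w) ->
  trajectory X agent1 q1 theta theta_o t w = trajectory X' agent1 q1 theta theta_o t w.
Proof.
case: same => iE aE sE fE; elim: t => [|t IH] h /=.
  by congr State; apply/funext => i; rewrite iE.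
rewrite IH; last by move=> s st; apply: h; exact: ltnW.
have [asE tbE] := h t (ltnSn t).
rewrite /next_state; congr State.
- by apply/funext => i; rewrite /next_queue (wins_ext _ _ asE tbE) sE aE fE.
- rewrite (wins_ext _ _ asE tbE) /payment (wins_ext _ _ asE tbE).
  by rewrite -!/(rival_max _ _ _ _ _ _ _ _) (rival_max_ext _ _ asE).
- by rewrite sE.
Qed.

End Extensionality.

Section GoodShortfall.
Context d (Om : measurableType d) (R : realType) (P : probability Om R).
Variables (N M : nat).
Local Notation n := (N * M)%N.
Hypothesis M_gt1 : (1 < M)%N.
Variables (X : noise R n Om) (beta : R) (Phi Psi Pi : probability R R).
Hypothesis hX : noise_law P X beta Phi Psi Pi.
Variables (agent1 : 'I_n) (q1 : R).
Variables (theta : seq (stage R) -> R -> R) (theta_o : R -> R).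
Hypotheses (thetaP : history_policy theta) (theta_oP : stationary_policy theta_o).
Variable rho : R -> R.
Hypotheses (rho_cont : continuous rho) (rho0 : rho 0 = 0).
Hypothesis Pi_cdf : forall x, 0 <= x -> Pi [set q | theta_o q <= x] = (rho x)%:E.
Local Notation p := (win_prob M rho).
Hypothesis beta01 : 0 <= beta <= 1.
Hypothesis p01 : forall x, 0 <= p x <= 1.
Hypothesis p_mono : {homo p : x y / x <= y}.
Hypothesis Pi_inv : forall B : set R, measurable B -> Pi B =
  (\int[Pi]_q ((beta * p (theta_o q))%:E * Phi [set u | B (served q + u)%R]
     + (beta * (1 - p (theta_o q)))%:E * Phi [set u | B (q + u)%R]
     + (1 - beta)%:E * Psi B))%E.

(** The term (D - Y)^+ of the overview before regeneration. D is what [theta_o] prescribes at the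
    queue of agent 1, not what he actually bids. *)
Definition shortfall (Y : noise R n Om) t w : R :=
  let s := trajectory Y agent1 q1 theta theta_o t w in
  if alive s then Num.max (theta_o (queue s agent1) -
                           rival_max Y agent1 theta theta_o t agent1 w s) 0 else 0.

Definition ideal_shortfall (Y : noise R n Om) t w : R :=
  let s := trajectory Y agent1 q1 theta theta_o t w in
  if alive s then primitive p (theta_o (queue s agent1)) else 0.

Lemma shortfall_ge0 Y t w : 0 <= shortfall Y t w.
Proof. by rewrite /shortfall; case: ifP => // _; rewrite le_max lexx orbT. Qed.

Lemma ideal_shortfall_ge0 Y t w : 0 <= ideal_shortfall Y t w.
Proof. by rewrite /ideal_shortfall; case: ifP => // _; exact: primitive_ge0. Qed.

(** The current round t is included because the rivals in it enter the shortfall. *)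
Definition draw t w : {ffun 'I_t.+1 -> 'S_n * 'S_n} :=
  [ffun s : 'I_t.+1 => (assign X s w, tiebreak X s w)].

(** Beyond round t, [inord] falls back to an index in range and the entries are meaningless; only
    rounds up to t are ever compared. *)
Definition draw_noise t (z : {ffun 'I_t.+1 -> 'S_n * 'S_n}) : noise R n Om :=
  fixed_noise X (fun s => (z (inord s)).1) (fun s => (z (inord s)).2).

Lemma draw_noiseE t w s : (s <= t)%N ->
  assign X s w = assign (draw_noise (draw t w)) s w /\
  tiebreak X s w = tiebreak (draw_noise (draw t w)) s w.
Proof. by move=> st; rewrite /= ffunE /= inordK. Qed.

Lemma draw_trajectory t w :
  trajectory X agent1 q1 theta theta_o t w =
  trajectory (draw_noise (draw t w)) agent1 q1 theta theta_o t w.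
Proof. by apply: trajectory_ext => // s /ltnW st; exact: draw_noiseE. Qed.

Lemma tree_like_ext (a a' : nat -> 'S_n) t S : (forall s, (s < t)%N -> a s = a' s) ->
  tree_like M a t S = tree_like M a' t S.
Proof.
elim: t S => //= t IH S h; rewrite h// IH// => s st; apply: h; exact: ltnW.
Qed.

(** Being tree-like is a property of the draw, which has finitely many values and is independent of
    the other sources; so the identity for fixed assignments can be summed over the good draws. *)
Lemma good_shortfall t :
  (\int[P]_w (if tree_like_at X t.+1 [set agent1] w then shortfall X t w else 0)%:E =
   \int[P]_w (if tree_like_at X t.+1 [set agent1] w then ideal_shortfall X t w else 0)%:E)%E.
Proof.
pose Kp : set (source n) := [set j | match j with Assign _ | Tiebreak _ => True | _ => False end].
pose Kr := group t (finset.setT : {set 'I_n}).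
have KK : Kp `&` Kr = set0 by apply/seteqP; split=> // -[i|s|s|s i|s i|s i] [].
pose good (z : {ffun 'I_t.+1 -> 'S_n * 'S_n}) :=
  tree_like M (fun s => (z (inord s)).1) t.+1 [set agent1].
have gE w : tree_like_at X t.+1 [set agent1] w = good (draw t w).
  by apply: tree_like_ext => s st; have [-> _] := @draw_noiseE t w s st.
under eq_integral do rewrite gE.
under [RHS]eq_integral do rewrite gE.
have gsub (z : {ffun 'I_t.+1 -> 'S_n * 'S_n}) i :
    group t (influence (same_cell M (fun s => (z (inord s)).1)) t i) `<=` Kr.
  by apply: groupS => //; apply/fintype.subsetP => k; rewrite !inE.
have mz (z : {ffun 'I_t.+1 -> 'S_n * 'S_n}) :=
  fixed_trajectory X agent1 q1 thetaP theta_oP (fun s => (z (inord s)).2) (gsub z agent1).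
apply: (decomposed_integral_eq hX KK _
  (Fz := fun z => shortfall (draw_noise z) t)
  (Gz := fun z => ideal_shortfall (draw_noise z) t)).
- move=> z; rewrite (_ : _ @^-1` _ = \bigcap_(s in [set: 'I_t.+1])
      (assign X s @^-1` [set (z s).1] `&` tiebreak X s @^-1` [set (z s).2])).
    apply: fin_bigcap_measurable => [|s _]; first exact: finite_finset.
    by apply: measurableI; [exact: sub_assign|exact: sub_tiebreak].
  apply/seteqP; split=> w /= h.
    by move=> s _; rewrite -h /= ffunE.
  by apply/ffunP => s; rewrite ffunE; have [/= -> ->] := h s I; rewrite -surjective_pairing.
- move=> w; rewrite /shortfall -draw_trajectory.
  by case: ifP => // _; rewrite (rival_max_ext _ _ _ _ _ (draw_noiseE w (leqnn t)).1).
- by move=> w; rewrite /ideal_shortfall -draw_trajectory.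
- move=> z; split; last exact: shortfall_ge0.
  have [mq /(_ erefl) [_ ma _]] := mz z.
  apply: measurable_fun_ifT => //; apply: measurable_maxr => //; apply: measurable_funB.
    by apply: (measurableT_comp theta_oP.1 mq).
  apply: (fixed_max_measurable agent1 q1 thetaP theta_oP).
  by apply: groupS => //; apply/fintype.subsetP => k; rewrite !inE.
- move=> z; split; last exact: ideal_shortfall_ge0.
  have [mq /(_ erefl) [_ ma _]] := mz z.
  apply: measurable_fun_ifT => //.
  apply: (measurableT_comp _ (measurableT_comp theta_oP.1 mq)).
  by apply: nondecreasing_measurable => // x y; exact: primitive_mono.
- move=> z gz; exact: (agent1_shortfall M_gt1 hX q1 thetaP theta_oP rho_cont rho0 Pi_cdf
    (fun s => (z (inord s)).2) beta01 p01 p_mono Pi_inv gz theta_oP.1 theta_oP.2).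
Qed.

End GoodShortfall.

(** * The Bellman equation along the finite system *)

(** Only the ideal term i has to be finite for the cancellation; the cost c may be infinite. *)
Lemma round_cancel (R : realDomainType) (v i c v' s : \bar R) (e : R) :
  i \is a fin_num -> (v + i <= c + v' + s)%E -> (s <= i + e%:E)%E ->
  (v <= c + v' + e%:E)%E.
Proof.
move=> fi h1 h2; rewrite -(leeD2rE _ _ fi); apply: le_trans h1 _.
by rewrite -[leRHS]addeA (addeC e%:E) leeD2l.
Qed.

Section RandomSystem.
Context d (Om : measurableType d) (R : realType) (P : probability Om R).
Variables (N M : nat).
Local Notation n := (N * M)%N.
Hypotheses (M_gt1 : (1 < M)%N) (N_gt0 : (0 < N)%N).
Variables (X : noise R n Om) (beta : R) (Phi Psi Pi : probability R R).
Hypothesis hX : noise_law P X beta Phi Psi Pi.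
Variables (agent1 : 'I_n) (q1 : R).
Hypothesis q1_ge0 : 0 <= q1.
Variables (theta : seq (stage R) -> R -> R) (theta_o : R -> R).
Hypotheses (thetaP : history_policy theta) (theta_oP : stationary_policy theta_o).
Variable Abar : R.
Hypothesis Phi1 : Phi `[0, Abar]%classic = 1%E.
Hypothesis beta01 : 0 < beta < 1.

Local Notation traj := (trajectory X agent1 q1 theta theta_o).

Definition past (t : nat) : set (source n) :=
  [set j | match j with
           | Init _ => true
           | Assign s | Tiebreak s | Arrival s _ | Survives s _ | Fresh s _ => (s < t)%N
           end].

(** What determines the auctions of round t; the survivals and arrivals of that round stay
    independent of it. *)
Definition past_round (t : nat) : set (source n) :=
  past t `|` [set Assign _ t; Tiebreak _ t].

(** With random assignments anyone may meet anyone, so dependence is recorded on the common past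
    only. *)
Let meet : nat -> 'I_n -> 'I_n -> bool := fun _ _ _ => true.

Lemma past_available t i K : past t `<=` K -> available (X : noise R n (sub X K)) meet t i.
Proof.
move=> pK; split=> [j _|s st q].
  split; first by apply: sub_init; exact: pK.
  by move=> s st; split;
    [apply: sub_arrival|apply: sub_survives|apply: sub_fresh]; exact: pK.
by split; [apply: sub_assign; exact: pK|apply: sub_tiebreak; exact: pK].
Qed.

Lemma past_trajectory t i K : past t `<=` K ->
  measurable_fun setT ((fun w => queue (traj t w) i) : sub X K -> R) /\
  (i = agent1 -> measurable_state (X : noise R n (sub X K)) agent1 q1 theta theta_o t).
Proof.
move=> pK; exact: (@measurable_trajectory R N M _ (sub X K) X agent1 q1 theta theta_o
  thetaP theta_oP.1 meet (fun _ _ _ _ _ => isT) (fun _ _ => isT) t i (past_available _ pK)).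
Qed.

Lemma past_bid t i K : past t `<=` K ->
  measurable_fun setT ((fun w => bid agent1 theta theta_o (traj t w) i) : sub X K -> R).
Proof.
by move=> /(@past_trajectory t i)[mq ms]; apply: (measurable_bid thetaP theta_oP.1 mq ms).
Qed.

Lemma past_round_wins t i K : past_round t `<=` K ->
  measurable_fun setT
    ((fun w => wins X agent1 theta theta_o t w (traj t w) i) : sub X K -> bool).
Proof.
move=> pK; apply: (@measurable_wins R N M _ (sub X K) X agent1 q1 theta theta_o meet
  (fun _ _ _ _ _ => isT) (fun _ _ => isT) t i).
- by move=> s; apply: sub_assign; apply: pK; right; left.
- by move=> s; apply: sub_tiebreak; apply: pK; right; right.
- by move=> j _; apply: past_bid; apply: subset_trans pK; exact: subsetUl.
Qed.

Lemma past_round_max t i K : past_round t `<=` K ->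
  measurable_fun setT
    ((fun w => rival_max X agent1 theta theta_o t i w (traj t w)) : sub X K -> R).
Proof.
move=> pK; apply: (@measurable_rival_max R N M _ (sub X K) X agent1 q1 theta theta_o meet
  (fun _ _ _ _ _ => isT) t i).
- by move=> s; apply: sub_assign; apply: pK; right; left.
- by move=> j _; apply: past_bid; apply: subset_trans pK; exact: subsetUl.
Qed.

Let q t w := queue (traj t w) agent1.

Lemma queue_measurable t : measurable_fun setT (q t).
Proof. exact: (sub_measurable hX (past_trajectory agent1 (@subset_refl _ (past t))).1). Qed.

Lemma alive_measurable t : measurable_fun setT (fun w => alive (traj t w)).
Proof.
have [_ /(_ erefl) [_ ma _]] := past_trajectory agent1 (@subset_refl _ (past t)).
exact: (sub_measurable hX ma).
Qed.

Lemma rival_max_measurable t :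
  measurable_fun setT (fun w => rival_max X agent1 theta theta_o t agent1 w (traj t w)).
Proof. exact: (sub_measurable hX (past_round_max agent1 (@subset_refl _ (past_round t)))). Qed.

Lemma wins_measurable t :
  measurable_fun setT (fun w => wins X agent1 theta theta_o t w (traj t w) agent1).
Proof. exact: (sub_measurable hX (past_round_wins agent1 (@subset_refl _ (past_round t)))). Qed.

Lemma queue_ge0 t w i : 0 <= queue (traj t w) i.
Proof.
case: hX => _ hi _ ha _; elim: t i => [|t IH] i /=.
  by case: ifP => // _; have [_ h _] := hi i.
rewrite /next_queue; have [[_ hA _] [_ hF _]] := ha t i.
case: ifP => // _; rewrite addr_ge0//; case: ifP => // _; exact: served_ge0.
Qed.

Lemma alive_prob t : P [set w | alive (traj t w)] = (beta ^+ t)%:E.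
Proof.
elim: t => [|t IH].
  rewrite expr0 -(probability_setT P); congr (P _); apply/seteqP; by split.
have [_ /(_ erefl) [_ ma _]] := past_trajectory agent1 (@subset_refl _ (past t)).
have -> : [set w | alive (traj t.+1 w)] =
    [set w | alive (traj t w)] `&` [set w | survives X t agent1 w].
  by apply/seteqP; split=> w /=; [move=> /andP[]|move=> [-> ->]].
rewrite (sub_indep_events hX (K := past t) (K' := [set Survives t agent1])).
- rewrite IH exprSr EFinM; congr (_ * _)%E.
  case: hX => _ _ _ _ hs; have [_ <-] := hs t agent1; congr (P _).
- by apply/seteqP; split=> // j [h] /= jE; move: h; rewrite jE /= ltnn.
- exact: measurable_bool_set.
- by apply: measurable_bool_set; exact: sub_survives.
Qed.

(** Almost surely, because Phi charges only [0, Abar]; before regeneration, because fresh queue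
    lengths have no such bound. *)
Lemma queue_bound t :
  {ae P, forall w, alive (traj t w) -> q t w <= q1 + Abar * t%:R}.
Proof.
elim: t => [|t IH].
  by apply: aeW => w _; rewrite /q /= eqxx mulr0 addr0.
have hA : {ae P, forall w, arrival X t agent1 w <= Abar}.
  case: hX => _ _ _ ha _; have [[mA A0 AE] _] := ha t agent1.
  have m1 : measurable (arrival X t agent1 @^-1` `[0, Abar]%classic).
    by rewrite -[X in measurable X]setTI; exact: mA.
  exists (~` (arrival X t agent1 @^-1` `[0, Abar]%classic)); split.
  - exact: measurableC.
  - by apply: prob1_setC => //; rewrite AE.
  - by move=> w /= h h1; apply: h; move: h1; rewrite in_itv/= => /andP[].
move: IH hA; apply: filterS2 => w IH hA /andP[/IH h1 s1].
rewrite /q /= /next_queue s1.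
have := queue_ge0 t w agent1; rewrite -/(q t w) in h1 * => q0.
have h2 : (if wins X agent1 theta theta_o t w (traj t w) agent1
           then served (q t w) else q t w) <= q t w.
  by case: ifP => // _; exact: served_le.
rewrite -natr1 mulrDr mulr1 addrA lerD//; exact: le_trans h1.
Qed.

Lemma alive_integral_le t (g : Om -> R) (G : R -> R) : measurable_fun setT g ->
  (forall w, 0 <= g w <= G (q t w)) -> nonneg_mono G ->
  (\int[P]_w (if alive (traj t w) then g w else 0)%:E
    <= (beta ^+ t * G (q1 + Abar * t%:R))%:E)%E.
Proof.
move=> mg gG [G0 Gm]; set c := G (q1 + Abar * t%:R).
have mA : measurable [set w | alive (traj t w)].
  by apply: measurable_bool_set; exact: alive_measurable.
have m1 : measurable_fun setT (fun w => (\1_[set w | alive (traj t w)] w : R)%:E).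
  by apply/measurable_EFinP; exact: measurable_indic.
apply: (@le_trans _ _ (\int[P]_w (c%:E * (\1_[set w | alive (traj t w)] w)%:E))%E).
  apply: ae_ge0_le_integral => //.
  - by move=> w _; rewrite lee_fin; case: ifP => // _; have /andP[] := gG w.
  - by apply/measurable_EFinP; apply: measurable_fun_ifT => //; exact: alive_measurable.
  - by move=> w _; apply: mule_ge0; rewrite lee_fin//; exact: G0.
  - exact: measurable_funeM.
  - move: (queue_bound t); apply: filterS => w h _; rewrite -EFinM lee_fin indicE.
    have -> : (w \in [set w | alive (traj t w)]) = alive (traj t w).
      by apply/idP/idP; rewrite inE.
    move: h; case: (alive (traj t w)) => [/(_ isT) h|_]; last by rewrite mulr0.
    rewrite mulr1; have /andP[_ h1] := gG w; apply: le_trans h1 _.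
    exact: Gm h.
rewrite ge0_integralZl_EFin//; last exact: G0.
rewrite integral_indic// setIT.
apply: (@le_trans _ _ (c%:E * (beta ^+ t)%:E)%E); first by rewrite -(alive_prob t).
by rewrite -EFinM mulrC.
Qed.

Variable W : R -> R.
Hypothesis WP : nonneg_mono W.

Lemma arrival_mean t i x :
  (\int[P]_w (W (x + arrival X t i w))%:E = (mean Phi W x)%:E)%E.
Proof.
case: hX => _ _ _ ha _; have [[mA _ AE] _] := ha t i.
have mW := shift_measurable x WP.
have W0 u : (0 <= (W (x + u))%:E)%E by rewrite lee_fin; case: WP.
rewrite (law_integral mA AE mW W0) -(meanE Phi1 x WP).
by rewrite (prob1_integral (@measurable_nneg R) (Phi_nneg Phi1)).

Qed.

Definition after_round t w :=
  if wins X agent1 theta theta_o t w (traj t w) agent1 then served (q t w) else q t w.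

(** Survival and arrival of agent 1 in round t are independent of the auction and of each other; the
    first contributes the factor beta, the second the mean of W. *)
Lemma value_next t :
  (\int[P]_w (if alive (traj t.+1 w) then W (q t.+1 w) else 0)%:E =
   \int[P]_w (if alive (traj t w) then beta * mean Phi W (after_round t w) else 0)%:E)%E.
Proof.
have [b0 b1] := andP beta01.
pose KY : set (source n) := [set Survives t agent1; Arrival t agent1].
have [mq /(_ erefl) [_ ma _]] := past_trajectory agent1 (@subsetUl _ (past t) _ : past t `<=` past_round t).
have mw := past_round_wins agent1 (@subset_refl _ (past_round t)).
have mX1 : measurable_fun setT ((fun w => (alive (traj t w), after_round t w)) :
    sub X (past_round t) -> bool * R).
  apply: measurable_fun_pair => //; apply: measurable_fun_ifT => //.
  by apply: (measurableT_comp (@served_measurable R) mq).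
have mS K : K (Survives t agent1) -> measurable_fun setT (survives X t agent1 : sub X K -> bool).
  exact: sub_survives.
have mA K : K (Arrival t agent1) -> measurable_fun setT (arrival X t agent1 : sub X K -> R).
  exact: sub_arrival.
have mY1 : measurable_fun setT ((fun w => (survives X t agent1 w, arrival X t agent1 w)) :
    sub X KY -> bool * R).
  by apply: measurable_fun_pair; [apply: mS; left|apply: mA; right].
have KK : past_round t `&` KY = set0.
  by apply/seteqP; split=> // j [h [] /= jE]; move: h; rewrite jE => -[/=|[]//]; rewrite ltnn.
have ind := sub_independent_pair hX KK mX1 mY1.
pose f (z : (bool * R) * (bool * R)) : \bar R :=
  (if z.1.1 && z.2.1 then W (z.1.2 + z.2.2) else 0)%:E.
have mf : measurable_fun setT f.
  apply/measurable_EFinP; apply: measurable_fun_ifT => //.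
    by apply: measurable_andb; apply: measurableT_comp.
  apply: (measurableT_comp (nonneg_mono_measurable WP measurableT)).
  by apply: measurable_funD; apply: measurableT_comp.
have f0 z : (0 <= f z)%E by rewrite /f lee_fin; case: ifP => // _; case: WP.
transitivity (\int[P]_w f ((alive (traj t w), after_round t w),
    (survives X t agent1 w, arrival X t agent1 w)))%E.
  apply: eq_integral => w _; rewrite /f /q /= /next_queue; congr EFin.
  by case: (alive _); case: (survives _ _ _ _).
rewrite [LHS](independent_pair_integral (sub_measurable hX mX1) (sub_measurable hX mY1) ind mf f0).
apply: eq_integral => w _; rewrite /f /=; case: (alive _); last by rewrite integral0.
move: (after_round t w) => x {mX1 ind}.
have KK2 : [set Survives t agent1] `&` [set Arrival t agent1] = set0 :> set (source n).
  by apply/seteqP; split=> // j [/= ->].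
have mS1 := mS [set Survives t agent1] erefl.
have mA1 := mA [set Arrival t agent1] erefl.
have ind2 := sub_independent_pair hX KK2 mS1 mA1.
pose g (z : bool * R) : \bar R := (if z.1 then W (x + z.2) else 0)%:E.
have mg : measurable_fun setT g.
  apply/measurable_EFinP; apply: measurable_fun_ifT => //.
  apply: (measurableT_comp (nonneg_mono_measurable WP measurableT)).
  by apply: measurable_funD => //.
have g0 z : (0 <= g z)%E by rewrite /g lee_fin; case: ifP => // _; case: WP.
rewrite [LHS](independent_pair_integral (sub_measurable hX mS1) (sub_measurable hX mA1) ind2 mg g0).
pose c := mean Phi W x; have c0 : 0 <= c by exact: (mean_nonneg_mono Phi1 WP).1.
transitivity (\int[P]_w (c%:E * (\1_[set w | survives X t agent1 w] w)%:E))%E.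
  apply: eq_integral => w' _; rewrite /g /= indicE.
  have -> : (w' \in [set w | survives X t agent1 w]) = survives X t agent1 w'.
    by apply/idP/idP; rewrite inE.
  case: (survives _ _ _ _); last by rewrite integral0 mule0.
  by rewrite mule1 arrival_mean.
have mSO : measurable [set w | survives X t agent1 w].
  by apply: measurable_bool_set; exact: (sub_measurable hX mS1).
rewrite ge0_integralZl_EFin//; last by apply/measurable_EFinP; exact: measurable_indic.
rewrite integral_indic// setIT mulrC EFinM; congr (_ * _)%E.
case: hX => _ _ _ _ hs; have [_ <-] := hs t agent1; congr (P _).
Qed.

Variables (rho : R -> R) (C : R -> R).
Local Notation p := (win_prob M rho).
Hypotheses (p_mono : {homo p : x y / x <= y}) (p01 : forall x, 0 <= p x <= 1).
Hypothesis CpP : nonneg_mono (fun x => C (Num.max x 0)).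
Hypothesis W_eq : forall x, 0 <= x ->
  W x = C x + beta * mean Phi W x - primitive p (gap Phi beta W x).
Hypothesis theta_oE : forall x, 0 <= x -> theta_o x = gap Phi beta W x.

Local Notation cost := (stage_cost X agent1 q1 theta theta_o C).
Local Notation short := (shortfall agent1 q1 theta theta_o X).
Local Notation ideal := (ideal_shortfall agent1 q1 theta theta_o rho X).
Let value t w := if alive (traj t w) then W (q t w) else 0.
Let next_value t w := if alive (traj t w) then beta * mean Phi W (after_round t w) else 0.

Let rmax t w := rival_max X agent1 theta theta_o t agent1 w (traj t w).

Lemma rmax_ge0 t w : 0 <= rmax t w.
Proof. exact: rival_max_ge0. Qed.

Lemma costE t w : cost t w = if alive (traj t w) then
  C (Num.max (q t w) 0) +
  (if wins X agent1 theta theta_o t w (traj t w) agent1 then rmax t w else 0) else 0.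
Proof. by rewrite /stage_cost max_l//; exact: queue_ge0. Qed.

Lemma cost_ge0 t w : 0 <= cost t w.
Proof.
rewrite costE; case: ifP => // _; rewrite addr_ge0//; first exact: CpP.1.
by case: ifP => // _; exact: rmax_ge0.
Qed.

(* With D the gap, W = C + L - H(D) turns the difference of the two sides into
   [win](Y - D) + (D - Y)^+. *)
Lemma round_ge t w :
  value t w + ideal t w <= cost t w + next_value t w + short t w.
Proof.
rewrite costE /value /next_value /ideal_shortfall /shortfall -/(q t w) -/(rmax t w).
case: ifP => _; last by rewrite !addr0.
have q0 : 0 <= q t w by exact: queue_ge0.
rewrite max_l// W_eq// theta_oE// /after_round; set Y := rmax t w.
have h1 : 0 <= Num.max (gap Phi beta W (q t w) - Y) 0 by rewrite le_max lexx orbT.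
have h2 : gap Phi beta W (q t w) - Y <= Num.max (gap Phi beta W (q t w) - Y) 0.
  by rewrite le_max lexx.
move: h1 h2; set Z := Num.max _ _; rewrite /gap => h1 h2.
by case: ifP => _; lra.
Qed.

(** When the bid is D, winning forces Y <= D and losing forces Y >= D, so [win](Y - D) is exactly
    -(D - Y)^+. *)
Lemma round_eq t w : theta = markovian theta_o ->
  value t w + ideal t w = cost t w + next_value t w + short t w.
Proof.
move=> thetaE; rewrite costE /value /next_value /ideal_shortfall /shortfall.
rewrite -/(q t w) -/(rmax t w).
case: ifP => // _; last by rewrite !addr0.
have q0 : 0 <= q t w by exact: queue_ge0.
have bE : bid agent1 theta theta_o (traj t w) agent1 = theta_o (q t w).
  rewrite /bid eqxx; exact: (congr1 (fun th => th (hist (traj t w)) (q t w)) thetaE).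
rewrite max_l// W_eq// -theta_oE// /after_round.
have gE := theta_oE q0; rewrite /gap in gE.
case: ifPn => win.
  have : rmax t w <= theta_o (q t w).
    by rewrite -bE; exact: (rival_max_le_of_wins thetaP.2 theta_oP.2 win).
  by move=> h; rewrite max_l ?subr_ge0//; lra.
have : theta_o (q t w) <= rmax t w.
  by rewrite -bE leNgt; apply: contra win; exact: wins_of_rival_max_lt.
by move=> h; rewrite max_r ?subr_le0//; lra.
Qed.

Let measurable_W : measurable_fun setT W.
Proof. exact: nonneg_mono_measurable WP measurableT. Qed.

Let measurable_mean : measurable_fun setT (mean Phi W).
Proof. exact: nonneg_mono_measurable (mean_nonneg_mono Phi1 WP) measurableT. Qed.

Let m_alive := alive_measurable.
Let m_q := queue_measurable.
Let m_max := rival_max_measurable.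
Let m_wins := wins_measurable.

Lemma cost_measurable t : measurable_fun setT (cost t).
Proof.
rewrite (_ : cost t = fun w => if alive (traj t w) then C (Num.max (q t w) 0) +
  (if wins X agent1 theta theta_o t w (traj t w) agent1 then rmax t w else 0) else 0).
  apply: measurable_fun_ifT => //; apply: measurable_funD.
    by apply: (measurableT_comp (nonneg_mono_measurable CpP measurableT)).
  exact: (measurable_fun_ifT (m_wins t) (m_max t) (measurable_cst _)).
by apply/funext => w; exact: costE.
Qed.

Lemma value_measurable t : measurable_fun setT (value t).
Proof. by apply: measurable_fun_ifT => //; exact: measurableT_comp. Qed.

Lemma next_value_measurable t : measurable_fun setT (next_value t).
Proof.
apply: measurable_fun_ifT => //; apply: measurable_funM => //.
apply: measurableT_comp => //; apply: measurable_fun_ifT => //.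
by apply: measurableT_comp => //; exact: served_measurable.
Qed.

Lemma short_measurable t : measurable_fun setT (short t).
Proof.
have mth := measurableT_comp theta_oP.1 (m_q t).
exact: (measurable_fun_ifT (m_alive t)
  (measurable_maxr (measurable_funB mth (m_max t)) (measurable_cst _)) (measurable_cst _)).
Qed.

Lemma primitive_measurable : measurable_fun setT (primitive p).
Proof. by apply: nondecreasing_measurable => // x y; exact: primitive_mono. Qed.

Lemma ideal_measurable t : measurable_fun setT (ideal t).
Proof.
have mth := measurableT_comp theta_oP.1 (m_q t).
exact: (measurable_fun_ifT (m_alive t) (measurableT_comp primitive_measurable mth)
  (measurable_cst _)).
Qed.

Lemma value_ge0 t w : 0 <= value t w.
Proof. by rewrite /value; case: ifP => // _; exact: WP.1. Qed.

Lemma next_value_ge0 t w : 0 <= next_value t w.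
Proof.
rewrite /next_value; case: ifP => // _; rewrite mulr_ge0//.
  by case/andP: beta01 => /ltW.
exact: (mean_nonneg_mono Phi1 WP).1.
Qed.

Local Notation Ex f := (\int[P]_w (f w)%:E)%E.

Let Ex_add (f g : Om -> R) : measurable_fun setT f -> measurable_fun setT g ->
  (forall w, 0 <= f w) -> (forall w, 0 <= g w) ->
  (Ex (fun w => f w + g w)%R = Ex f + Ex g)%E.
Proof.
move=> mf mg f0 g0; under eq_integral do rewrite EFinD.
by rewrite ge0_integralD//; [move=> w _; rewrite lee_fin|exact/measurable_EFinP|
  move=> w _; rewrite lee_fin|exact/measurable_EFinP].
Qed.

Let Ex_le (f g : Om -> R) : measurable_fun setT f -> measurable_fun setT g ->
  (forall w, 0 <= f w) -> (forall w, f w <= g w) -> (Ex f <= Ex g)%E.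
Proof.
move=> mf mg f0 fg; apply: ge0_le_integral => //.
- by move=> w _; rewrite lee_fin.
- exact/measurable_EFinP.
- exact/measurable_EFinP.
- by move=> w _; rewrite lee_fin.
Qed.

Let ideal0 := ideal_shortfall_ge0 agent1 q1 theta theta_o p01 X.
Let short0 := shortfall_ge0 agent1 q1 theta theta_o X.

Lemma expected_round t :
  (Ex (cost t) + Ex (value t.+1) + Ex (short t) =
   Ex (fun w => cost t w + next_value t w + short t w)%R)%E.
Proof.
rewrite [Ex (value t.+1)](value_next t) -Ex_add//.
- rewrite -Ex_add//; [|exact: short_measurable|].
    by apply: measurable_funD; [exact: cost_measurable|exact: next_value_measurable].
  by move=> w; rewrite addr_ge0 ?cost_ge0 ?next_value_ge0.
- exact: cost_measurable.
- exact: next_value_measurable.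
- exact: cost_ge0.
- exact: next_value_ge0.
Qed.

(** Stated without subtraction: all terms are nonnegative expectations, and that of the cost may be
    infinite. *)
Lemma expected_round_ge t :
  (Ex (value t) + Ex (ideal t) <= Ex (cost t) + Ex (value t.+1) + Ex (short t))%E.
Proof.
rewrite expected_round -Ex_add//; [|exact: value_measurable|exact: ideal_measurable|exact: value_ge0].
apply: Ex_le; last exact: round_ge.
- by apply: measurable_funD; [exact: value_measurable|exact: ideal_measurable].
- apply: measurable_funD; last exact: short_measurable.
  by apply: measurable_funD; [exact: cost_measurable|exact: next_value_measurable].
- by move=> w; rewrite addr_ge0 ?value_ge0.
Qed.

Lemma expected_round_eq t : theta = markovian theta_o ->
  (Ex (value t) + Ex (ideal t) = Ex (cost t) + Ex (value t.+1) + Ex (short t))%E.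
Proof.
move=> tE; rewrite expected_round -Ex_add//;
  [|exact: value_measurable|exact: ideal_measurable|exact: value_ge0].
by apply: eq_integral => w _; rewrite round_eq.
Qed.

Hypothesis rho_cont : continuous rho.
Hypothesis rho0 : rho 0 = 0.
Hypothesis Pi_cdf : forall x, 0 <= x -> Pi [set q | theta_o q <= x] = (rho x)%:E.
Hypothesis Pi_inv : forall B : set R, measurable B -> Pi B =
  (\int[Pi]_q ((beta * p (theta_o q))%:E * Phi [set u | B (served q + u)%R]
     + (beta * (1 - p (theta_o q)))%:E * Phi [set u | B (q + u)%R]
     + (1 - beta)%:E * Psi B))%E.

(** Almost sure bound on D in round t: the gap at x is at most beta W(x + Abar), and the queue at
    most q1 + Abar t, whence the index t + 1. *)
Definition gap_bound t : R := beta * W (q1 + Abar * t.+1%:R).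

Lemma gap_bound_ge0 t : 0 <= gap_bound t.
Proof. by rewrite mulr_ge0//; [case/andP: beta01 => /ltW|exact: WP.1]. Qed.

Lemma theta_o_bound t w : theta_o (q t w) <= beta * W (q t w + Abar).
Proof. by rewrite theta_oE ?queue_ge0//; exact: gap_le. Qed.

Lemma expected_value_le t : (Ex (value t) <= (beta ^+ t * W (q1 + Abar * t%:R))%:E)%E.
Proof.
apply: (@alive_integral_le t (fun w => W (q t w)) W) => //.
- exact: measurableT_comp.
- by move=> w; rewrite lexx andbT; exact: WP.1.
Qed.

Lemma expected_ideal_le t : (Ex (ideal t) <= (beta ^+ t * gap_bound t)%:E)%E.
Proof.
have b0 : 0 <= beta by case/andP: beta01 => /ltW.
rewrite /gap_bound -natr1 mulrDr mulr1 addrA.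
apply: (@alive_integral_le t (fun w => primitive p (theta_o (q t w))) (fun x => beta * W (x + Abar))).
- by apply: (measurableT_comp primitive_measurable); exact: measurableT_comp theta_oP.1 (m_q t).
- move=> w; rewrite primitive_ge0//=; apply: le_trans (theta_o_bound t w).
  by apply: primitive_le => //; exact: theta_oP.2.
- split=> [x|x y xy]; first by rewrite mulr_ge0//; exact: WP.1.
  by rewrite ler_wpM2l//; apply: WP.2; rewrite lerD2r.
Qed.

Lemma theta_o_ae_bound t :
  {ae P, forall w, alive (traj t w) -> theta_o (q t w) <= gap_bound t}.
Proof.
have b0 : 0 <= beta by case/andP: beta01 => /ltW.
move: (queue_bound t); apply: filterS => w h /h {}h.
apply: le_trans (theta_o_bound t w) _; rewrite ler_wpM2l//; apply: WP.2.
by rewrite -natr1 mulrDr mulr1 addrA lerD2r.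
Qed.

Lemma ideal_ae_bound t : {ae P, forall w, ideal t w <= gap_bound t}.
Proof.
move: (theta_o_ae_bound t); apply: filterS => w h; rewrite /ideal_shortfall.
case: ifP => [/h {}h|_]; last exact: gap_bound_ge0.
by apply: le_trans h; apply: primitive_le => //; exact: theta_oP.2.
Qed.

Lemma short_ae_bound t : {ae P, forall w, short t w <= gap_bound t}.
Proof.
move: (theta_o_ae_bound t); apply: filterS => w h; rewrite /shortfall.
case: ifP => [/h {}h|_]; last exact: gap_bound_ge0.
rewrite ge_max gap_bound_ge0 andbT; apply: le_trans h.
by rewrite lerBlDr lerDl; exact: (rmax_ge0 t w).
Qed.

(** Size of the shortfall times the probability of a collision in the tree rooted at agent 1 alone,
    with t + 1 levels since round t counts. *)
Definition error t : R := gap_bound t * ((tree_bound M t.+1 1)%:R / N%:R).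

Local Notation good t := (tree_like_at X t.+1 [set agent1]).

Let good_measurable t : measurable_fun setT (good t).
Proof.
apply: (measurable_fun_bool true); rewrite setTI.
exact: (sub_event hX (@tree_like_measurable _ _ R N M X t.+1 [set agent1]%SET)).
Qed.

Lemma expected_bad_le t (f : Om -> R) : measurable_fun setT f -> (forall w, 0 <= f w) ->
  {ae P, forall w, f w <= gap_bound t} ->
  (Ex f <= Ex (fun w => if good t w then f w else 0%R) + (error t)%:E)%E.
Proof.
move=> mf f0 fD; have D0 := gap_bound_ge0 t.
pose bad := [set w | ~~ good t w].
have mbad : measurable bad := bad_tree_measurable hX t.+1 [set agent1]%SET.
have mi : measurable_fun setT (fun w => gap_bound t * (\1_bad w : R)).
  by apply: measurable_funM => //; exact: measurable_indic.
have mg : measurable_fun setT (fun w => if good t w then f w else 0).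
  exact: measurable_fun_ifT.
have g0 w : 0 <= (if good t w then f w else 0) by case: ifP.
have i0 w : 0 <= gap_bound t * (\1_bad w : R) by rewrite mulr_ge0.
apply: (@le_trans _ _ (Ex (fun w => (if good t w then f w else 0) + gap_bound t * (\1_bad w : R))%R)).
  apply: ae_ge0_le_integral => //.
  - by move=> w _; rewrite lee_fin.
  - exact/measurable_EFinP.
  - by move=> w _; rewrite lee_fin addr_ge0.
  - by apply/measurable_EFinP; exact: measurable_funD.
  - move: fD; apply: filterS => w h _; rewrite lee_fin indicE.
    have -> : (w \in bad) = ~~ good t w by apply/idP/idP; rewrite inE.
    by case: (good t w) => /=; rewrite ?mulr0 ?addr0// mulr1 add0r.
rewrite Ex_add// leeD//.
under eq_integral do rewrite EFinM.
rewrite ge0_integralZl_EFin//; last by apply/measurable_EFinP; exact: measurable_indic.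
rewrite integral_indic// setIT /error [leRHS]EFinM; apply: lee_wpmul2l; first by rewrite lee_fin.
apply: le_trans (bad_tree_prob M_gt1 N_gt0 hX t.+1 [set agent1]%SET) _.
by rewrite cards1.
Qed.

Let good_eq t : (Ex (fun w => if good t w then short t w else 0%R) =
                 Ex (fun w => if good t w then ideal t w else 0%R))%E.
Proof.
apply: (good_shortfall M_gt1 hX agent1 q1 thetaP theta_oP rho_cont rho0 Pi_cdf _ p01 p_mono Pi_inv t).
by case/andP: beta01 => /ltW -> /ltW ->.
Qed.

Let good_le t (f : Om -> R) : measurable_fun setT f -> (forall w, 0 <= f w) ->
  (Ex (fun w => if good t w then f w else 0%R) <= Ex f)%E.
Proof.
move=> mf f0; apply: Ex_le => //; first exact: measurable_fun_ifT.
  by move=> w; case: ifP.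
by move=> w; case: ifP.
Qed.

(** On tree-like pasts both expectations coincide exactly; only the bad event contributes an
    error. *)
Lemma ideal_le_short t : (Ex (ideal t) <= Ex (short t) + (error t)%:E)%E.
Proof.
apply: le_trans (expected_bad_le (ideal_measurable t) (ideal0 t) (ideal_ae_bound t)) _.
by rewrite -good_eq leeD2r//; apply: good_le; [exact: short_measurable|exact: short0].
Qed.

Lemma short_le_ideal t : (Ex (short t) <= Ex (ideal t) + (error t)%:E)%E.
Proof.
apply: le_trans (expected_bad_le (short_measurable t) (short0 t) (short_ae_bound t)) _.
by rewrite good_eq leeD2r//; apply: good_le; [exact: ideal_measurable|exact: ideal0].
Qed.

Variable K : R.
Hypothesis K_ge0 : 0 <= K.
Hypothesis W_geometric : forall t, beta ^+ t * W (q1 + Abar * t%:R) <= K * Num.sqrt beta ^+ t.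

Lemma expected_value0 : Ex (value 0) = (W q1)%:E.
Proof.
transitivity (\int[P]_w (cst (W q1)%:E w))%E.
  by apply: eq_integral => w _; rewrite /value /q /= eqxx.
transitivity ((W q1)%:E * P setT)%E; first exact: (integral_cst P measurableT).
by transitivity ((W q1)%:E * 1)%E; [congr (_ * _)%E; exact: probability_setT|rewrite mule1].
Qed.

Let value_geometric t : (Ex (value t) <= (K * Num.sqrt beta ^+ t)%:E)%E.
Proof. by apply: le_trans (expected_value_le t) _; rewrite lee_fin. Qed.

Let ideal_geometric t : (Ex (ideal t) <= (K * Num.sqrt beta ^+ t.+1)%:E)%E.
Proof.
apply: le_trans (expected_ideal_le t) _; rewrite lee_fin /gap_bound mulrA -exprSr.
exact: W_geometric.
Qed.

Let Ex_ge0 (f : Om -> R) : (forall w, 0 <= f w) -> (0 <= Ex f)%E.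
Proof. by move=> f0; apply: integral_ge0 => w _; rewrite lee_fin. Qed.

Let ideal_fin t : Ex (ideal t) \is a fin_num.
Proof.
rewrite ge0_fin_numE; last exact: Ex_ge0.
exact: le_lt_trans (ideal_geometric t) (ltry _).
Qed.

Let short_fin t : Ex (short t) \is a fin_num.
Proof.
rewrite ge0_fin_numE; last exact: Ex_ge0.
apply: le_lt_trans (short_le_ideal t) _.
by rewrite lte_add_pinfty ?ltry// -ge0_fin_numE//; exact: Ex_ge0.
Qed.

(** The expected values telescope over the rounds, and exchanging the actual for the ideal shortfall
    costs one error per round. *)
Lemma value_sum_ge T : (Ex (value 0) <=
  \sum_(t < T) Ex (cost t) + Ex (value T) + (\sum_(t < T) error t)%:E)%E.
Proof.
elim: T => [|T IH]; first by rewrite !big_ord0 add0e adde0.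
apply: le_trans IH _; rewrite !big_ord_recr /= -(addeA _ (Ex (cost T))) EFinD.
rewrite (addeC (\sum_(t < T) error t)%:E) [leRHS]addeA leeD2r// -addeA leeD2l//.
exact: round_cancel (ideal_fin T) (expected_round_ge T) (short_le_ideal T).
Qed.

Lemma finite_valueE : finite_value P X C agent1 q1 theta theta_o =
  (\sum_(0 <= t <oo) Ex (cost t))%E.
Proof.
rewrite /finite_value integral_nneseries//.
- by move=> t; apply/measurable_EFinP; exact: cost_measurable.
- by move=> t w _; rewrite lee_fin cost_ge0.
Qed.

Lemma finite_value_ge T : ((W q1 - \sum_(t < T) error t - K * Num.sqrt beta ^+ T)%:E <=
  finite_value P X C agent1 q1 theta theta_o)%E.
Proof.
rewrite finite_valueE; apply: (@le_trans _ _ (\sum_(0 <= t < T) Ex (cost t))%E); last first.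
  by apply: nneseries_lim_ge => t _ _; apply: Ex_ge0; exact: cost_ge0.
rewrite !EFinB !leeBlDr//; apply: le_trans (_ : _ <= _ + _ + _)%E _; last first.
  apply: leeD; last exact: lexx.
  by apply: leeD; [exact: lexx|exact: value_geometric T].
by rewrite -expected_value0 big_mkord; exact: value_sum_ge.
Qed.

Section Equilibrium.
Hypothesis thetaE : theta = markovian theta_o.

Lemma value_sum_le T : (\sum_(t < T) Ex (cost t) + Ex (value T) <=
  Ex (value 0) + (\sum_(t < T) error t)%:E)%E.
Proof.
elim: T => [|T IH]; first by rewrite !big_ord0 add0e adde0.
rewrite !big_ord_recr /= -[leLHS]addeA EFinD [leRHS]addeA.
apply: (@le_trans _ _ (\sum_(t < T) Ex (cost t) + (Ex (value T) + (error T)%:E))%E).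
  rewrite leeD2l//; rewrite -(leeD2rE _ _ (short_fin T)).
  rewrite -(expected_round_eq T thetaE). rewrite -[leRHS]addeA leeD2l// addeC.
  exact: ideal_le_short.
by rewrite addeA leeD2r.
Qed.

(** Beyond round T the errors cannot be used, since they grow too fast with t. Instead the actual
    shortfall is discarded and the ideal one, geometrically small uniformly in N, is paid in
    full. *)
Lemma value_sum_tail T k : (\sum_(t < T + k) Ex (cost t) + Ex (value (T + k)) <=
  Ex (value 0) + (\sum_(t < T) error t + \sum_(t < k) K * Num.sqrt beta ^+ (T + t).+1)%:E)%E.
Proof.
elim: k => [|k IH]; first by rewrite addn0 big_ord0 addr0; exact: value_sum_le.
rewrite addnS !big_ord_recr /= -[leLHS]addeA [in leRHS]addrA EFinD [leRHS]addeA.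
apply: (@le_trans _ _ (\sum_(t < T + k) Ex (cost t) +
    (Ex (value (T + k)) + (K * Num.sqrt beta ^+ (T + k).+1)%:E))%E).
  rewrite leeD2l//; apply: (@le_trans _ _ (Ex (value (T + k)) + Ex (ideal (T + k)))%E).
    by rewrite (expected_round_eq _ thetaE) leeDl// Ex_ge0.
  by rewrite leeD2l.
by rewrite addeA leeD2r.
Qed.

Lemma finite_value_le T : (finite_value P X C agent1 q1 theta theta_o <=
  (W q1 + (\sum_(t < T) error t + K * Num.sqrt beta ^+ T / (1 - Num.sqrt beta)))%:E)%E.
Proof.
have /andP[r0 r1] := sqrt_beta01 beta01.
rewrite finite_valueE; apply: lime_le.
  by apply: is_cvg_nneseries => t _ _; apply: Ex_ge0; exact: cost_ge0.
exists T => // T' /= TT; rewrite -(subnKC TT) big_mkord; set k := (T' - T)%N.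
apply: (@le_trans _ _ (\sum_(t < T + k) Ex (cost t) + Ex (value (T + k)))%E).
  by rewrite leeDl// Ex_ge0// => w; exact: value_ge0.
apply: le_trans (value_sum_tail T k) _; rewrite expected_value0 -EFinD lee_fin !lerD2l.
apply: (@le_trans _ _ (K * Num.sqrt beta ^+ T * \sum_(t < k) Num.sqrt beta ^+ t)).
  rewrite mulr_sumr; apply: ler_sum => t _.
  rewrite -mulrA -exprD ler_wpM2l// exprS ler_piMl ?exprn_ge0 ?(ltW r0) ?(ltW r1)//.
apply: ler_wpM2l; first by rewrite mulr_ge0 ?exprn_ge0// ltW.
exact: geometric_sum_le (sqrt_beta01 beta01).
Qed.

End Equilibrium.

End RandomSystem.

(** * The theorem *)

Section PolicyExtensionality.
Variables (R : realType) (N M : nat) (Om : Type) (X : noise R (N * M) Om).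
Variables (agent1 : 'I_(N * M)) (q1 : R).
Variables (theta theta' : seq (stage R) -> R -> R) (theta_o theta_o' : R -> R).
Hypotheses (thetaE : forall h x, 0 <= x -> theta h x = theta' h x)
  (theta_oE : forall x, 0 <= x -> theta_o x = theta_o' x).
Variable w : Om.
Hypotheses (q1_ge0 : 0 <= q1) (init0 : forall i, 0 <= init X i w)
  (arrival0 : forall t i, 0 <= arrival X t i w) (fresh0 : forall t i, 0 <= fresh X t i w).

Lemma bid_ext (s : state R N M) i : 0 <= queue s i ->
  bid agent1 theta theta_o s i = bid agent1 theta' theta_o' s i.
Proof. by move=> s0; rewrite /bid; case: ifP => _; rewrite ?thetaE ?theta_oE. Qed.

Lemma next_queue_ge0 t s i : (forall j, 0 <= queue s j) ->
  0 <= next_queue X agent1 theta theta_o t w s i.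
Proof.
move=> s0; rewrite /next_queue; case: ifP => // _; rewrite addr_ge0//.
by case: ifP => // _; exact: served_ge0.
Qed.

Lemma wins_policy_ext t s i : (forall j, 0 <= queue s j) ->
  wins X agent1 theta theta_o t w s i = wins X agent1 theta' theta_o' t w s i.
Proof. by move=> s0; apply: eq_forallb => j; rewrite !bid_ext. Qed.

Lemma payment_policy_ext t s i : (forall j, 0 <= queue s j) ->
  payment X agent1 theta theta_o t w s i = payment X agent1 theta' theta_o' t w s i.
Proof.
move=> s0; rewrite /payment wins_policy_ext//; case: ifP => // _.
by apply: eq_bigr => j _; exact: bid_ext.
Qed.

Lemma trajectory_policy_ext t :
  trajectory X agent1 q1 theta theta_o t w = trajectory X agent1 q1 theta' theta_o' t w /\
  forall i, 0 <= queue (trajectory X agent1 q1 theta theta_o t w) i.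
Proof.
elim: t => [|t [IH IH0]]; first by split=> // i /=; case: ifP.
split; last by move=> i; exact: next_queue_ge0.
rewrite /= -IH; set s := trajectory _ _ _ _ _ _ _ in IH0 *.
rewrite /next_state; congr State.
  by apply/funext => i; rewrite /next_queue wins_policy_ext.
by rewrite bid_ext// wins_policy_ext// payment_policy_ext.
Qed.

Lemma stage_cost_ext (C : R -> R) t :
  stage_cost X agent1 q1 theta theta_o C t w = stage_cost X agent1 q1 theta' theta_o' C t w.
Proof.
have [E s0] := trajectory_policy_ext t.
by rewrite /stage_cost -E; case: ifP => // _; rewrite payment_policy_ext.
Qed.

End PolicyExtensionality.

(** Queues never become negative, so only the values of the policies on R^+ matter. This permits
    replacing [mf_policy] by its clipped version. *)
Lemma finite_value_ext d (Om : measurableType d) (R : realType) (P : probability Om R)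
    (N M : nat) (X : noise R (N * M) Om) beta Phi Psi Pi (C : R -> R) agent1 q
    (theta theta' : seq (stage R) -> R -> R) (theta_o theta_o' : R -> R) :
  noise_law P X beta Phi Psi Pi -> 0 <= q ->
  (forall h x, 0 <= x -> theta h x = theta' h x) ->
  (forall x, 0 <= x -> theta_o x = theta_o' x) ->
  finite_value P X C agent1 q theta theta_o = finite_value P X C agent1 q theta' theta_o'.
Proof.
move=> [_ hi _ ha _] q0 tE oE; apply: eq_integral => w _.
apply: eq_eseriesr => t _; congr EFin; apply: stage_cost_ext => //.
- by move=> i; have [_ ->] := hi i.
- by move=> s i; have [[_ ->]] := ha s i.
- by move=> s i; have [_ [_ ->]] := ha s i.
Qed.

Lemma prob1_setI d (T : measurableType d) (R : realType) (P : probability T R) (A D : set T) :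
  measurable A -> measurable D -> P D = 1%E -> P (A `&` D) = P A.
Proof.
move=> mA mD PD; rewrite (measureDI P mA mD) [X in (X + _)%E](_ : _ = 0%E) ?add0e//.
apply/eqP; rewrite -measure_le0 -(prob1_setC mD PD).
apply: le_measure; rewrite ?inE; [exact: measurableD|exact: measurableC|].
by move=> x [].
Qed.

Section Equilibrium.
Variables (R : realType) (M : nat) (beta : R) (C : R -> R).
Variables (Phi Psi : probability R R) (rho : R -> R) (Pi : probability R R) (theta : R -> R).
Hypothesis hMFE : mean_field_equilibrium M beta C Phi Psi rho Pi.
Hypothesis thetaP : stationary_policy theta.
Hypothesis thetaE : forall x, 0 <= x -> mf_policy M beta C Phi rho x = theta x.
Hypothesis p_mono : {homo win_prob M rho : x y / x <= y}.
Hypothesis p01 : forall x, 0 <= win_prob M rho x <= 1.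
Hypothesis beta01 : 0 <= beta <= 1.

(** Pi is carried by R^+, where [theta] is nonnegative and equal to [mf_policy], so the two sets
    differ by a null set. *)
Lemma equilibrium_cdf x : 0 <= x -> Pi [set q | theta q <= x] = (rho x)%:E.
Proof.
case: hMFE => -[Pi1 _] cdf x0; rewrite cdf//.
have mA : measurable [set q | theta q <= x].
  by apply: measurable_bool_set; apply: measurable_fun_ler => //; case: thetaP.
have mN := @measurable_nneg R.
have -> : [set q | 0 <= q /\ 0 <= mf_policy M beta C Phi rho q <= x] =
    [set q | theta q <= x] `&` nneg R.
  apply/seteqP; split=> q /=; rewrite /nneg /= in_itv/= andbT.
    by move=> [q0]; rewrite thetaE// => /andP[].
  by move=> [qx q0]; rewrite thetaE// thetaP.2.
by rewrite prob1_setI.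
Qed.

Lemma equilibrium_invariant (B : set R) : measurable B -> Pi B =
  (\int[Pi]_q ((beta * win_prob M rho (theta q))%:E * Phi [set u | B (served q + u)%R]
     + (beta * (1 - win_prob M rho (theta q)))%:E * Phi [set u | B (q + u)%R]
     + (1 - beta)%:E * Psi B))%E.
Proof.
case: hMFE => -[Pi1 inv] _ mB; have /andP[b0 b1] := beta01.
have mp : measurable_fun setT (fun q => win_prob M rho (theta q)).
  by apply: measurableT_comp thetaP.1; exact: nondecreasing_measurable.
have mS (s : R -> R) : measurable_fun setT s -> measurable_fun setT (fun q : R => Phi [set u | B (s q + u)]).
  move=> ms; apply: (@measurable_section R Phi [set z | B (s z.1 + z.2)]).
  have m : measurable_fun setT (fun z : R * R => s z.1 + z.2).
    by apply: measurable_funD => //; exact: measurableT_comp.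
  by have := m measurableT B mB; rewrite setTI.
rewrite (inv B mB) -(prob1_integral (@measurable_nneg R) Pi1).
- apply: eq_integral => q; rewrite inE /nneg/= in_itv/= andbT => q0.
  by rewrite /mf_kernel thetaE.
- apply: emeasurable_funD => //; apply: emeasurable_funD; apply: emeasurable_funM.
  + by apply/measurable_EFinP; exact: measurable_funM.
  + by apply: mS; exact: served_measurable.
  + by apply/measurable_EFinP; apply: measurable_funM => //; exact: measurable_funB.
  + exact: mS.
- move=> q; have /andP[h0 h1] := p01 (theta q).
  by rewrite !adde_ge0// mule_ge0// lee_fin ?mulr_ge0// subr_ge0.
Qed.

End Equilibrium.

Lemma limn_esup_le_eps (R : realType) (u : (\bar R)^nat) :
  (forall e : R, 0 < e -> exists N, forall n, (N <= n)%N -> (u n <= e%:E)%E) ->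
  (limn_esup u <= 0)%E.
Proof.
move=> h; apply/lee_addgt0Pr => e e0; rewrite add0e; have [N HN] := h e e0.
rewrite /limn_esup limf_esupE; apply: ge_ereal_inf.
exists (ereal_sup (u @` [set n | (N <= n)%N])).
  by exists [set n | (N <= n)%N] => //; exists N.
by apply: ge_ereal_sup => _ [n Nn <-]; exact: HN.
Qed.

(* The n-th system has N = n.+1 cells. *)
Theorem theorem16 (R : realType) (M : nat) (hM : (1 < M)%N)
    (beta : R) (hbeta : 0 < beta < 1)
    (Abar : R) (Phi : probability R R) (hPhi : arrival_distribution Abar Phi)
    (Psi : probability R R) (hPsi : regeneration_distribution Psi)
    (C : R -> R) (hC : holding_cost C)
    (E : R) (rho : R -> R) (hrho : bid_cdf E rho)
    (Pi : probability R R)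
    (hMFE : mean_field_equilibrium M beta C Phi Psi rho Pi)
    (d : nat -> measure_display) (Om : forall n : nat, measurableType (d n))
    (P : forall n : nat, probability (Om n) R)
    (X : forall n : nat, noise R (n.+1 * M) (Om n))
    (hX : forall n : nat, noise_law (P n) (X n) beta Phi Psi Pi)
    (theta : nat -> seq (stage R) -> R -> R)
    (htheta : forall n : nat, history_policy (theta n))
    (q : R) (hq : 0 <= q) :
  let theta_hat := mf_policy M beta C Phi rho in
  let V := fun (n : nat) (theta1 : seq (stage R) -> R -> R) =>
    finite_value (P n) (X n) C (first_agent n hM) q theta1 theta_hat in
  (limn_esup (fun n => V n (markovian theta_hat) - V n (theta n)) <= 0)%E.
Proof.
pose theta_hat := mf_policy M beta C Phi rho.
pose V := fun (n : nat) (theta1 : seq (stage R) -> R -> R) =>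
    finite_value (P n) (X n) C (first_agent n hM) q theta1 theta_hat.
change (is_true (limn_esup (fun n => V n (markovian theta_hat) - V n (theta n)) <= 0)%E).
have [W [WP W_eq W_policy W_geo]] := mean_field_solution M hPhi hC hrho hbeta.
have Phi1 := hPhi.1.
pose th := optimal_policy Phi beta W.
have thP : stationary_policy th := optimal_policy_stationary Phi1 hbeta WP.
have th_gap x : 0 <= x -> th x = gap Phi beta W x by move=> x0; rewrite /th /optimal_policy max_l.
have th_hat x : 0 <= x -> theta_hat x = th x by move=> x0; rewrite th_gap// -W_policy.
have th_hist : history_policy (markovian th).
  split=> [t|h x]; last exact: thP.2.
  by apply: (measurableT_comp thP.1); exact: measurable_snd.
have pm := win_prob_mono hrho M; have p01 := win_prob01 hrho M.
have CP := holding_cost_nonneg_mono hC.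
have rc : continuous rho by case: hrho.
have r0 := bid_cdf0 hrho.
have b01 : 0 <= beta <= 1 by case/andP: hbeta => /ltW -> /ltW ->.
have cdf := equilibrium_cdf hMFE thP th_hat.
have inv := equilibrium_invariant hMFE thP th_hat pm p01 b01.
have [K K0 HK] := W_geo q hq.
have /andP[s0 s1] := sqrt_beta01 hbeta.
set s := Num.sqrt beta in HK s0 s1.
have V_hat n : V n (markovian theta_hat) =
    finite_value (P n) (X n) C (first_agent n hM) q (markovian th) th.
  by apply: (finite_value_ext _ _ (hX n) hq _ th_hat) => h x; exact: th_hat.
have V_theta n : V n (theta n) = finite_value (P n) (X n) C (first_agent n hM) q (theta n) th.
  exact: (finite_value_ext _ _ (hX n) hq (fun _ _ _ => erefl) th_hat).
(* The number of cells times the total error of the first T rounds; it does not depend on n. *)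
pose A T := \sum_(t < T) gap_bound beta q Abar W t * (tree_bound M t.+1 1)%:R.
have errorE n T : \sum_(t < T) error n.+1 M beta q Abar W t = A T / n.+1%:R.
  by rewrite /A mulr_suml; apply: eq_bigr => t _; rewrite /error mulrA.
(* The W q of the two bounds cancels. Each bound contributes one total error; the lower one leaves
   the tail K s^T, the upper one K s^T / (1 - s). *)
have main n T : (V n (markovian theta_hat) - V n (theta n) <=
    (2 * (A T / n.+1%:R) + K * (1 + (1 - s)^-1) * s ^+ T)%:E)%E.
  have up := finite_value_le hM (ltn0Sn n) (hX n) (first_agent n hM) hq th_hist thP Phi1 hbeta
    WP pm p01 CP W_eq th_gap rc r0 cdf inv K0 HK erefl T.
  have low := finite_value_ge hM (ltn0Sn n) (hX n) (first_agent n hM) hq (htheta n) thP Phi1 hbeta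
    WP pm p01 CP W_eq th_gap rc r0 cdf inv HK T.
  rewrite V_hat V_theta; apply: le_trans (leeB up low) _.
  rewrite -EFinB lee_fin !errorE -/s; set x := s ^+ T; set y := (1 - s)^-1.
  set z := A T / _; lra.
apply: limn_esup_le_eps => e e0.
have K'0 : 0 <= K * (1 + (1 - s)^-1) by rewrite mulr_ge0// addr_ge0// invr_ge0 subr_ge0 ltW.
(* T is fixed before n because A T grows with T; afterwards the factor 4 leaves e / 2 for the
   doubled error term. *)
have [T HT] : exists T, K * (1 + (1 - s)^-1) * s ^+ T <= e / 2.
  have h : `|s| < 1 by rewrite gtr0_norm.
  have e2 : 0 < e / 2 by rewrite divr_gt0.
  have /cvgrPdist_le/(_ _ e2) [T _ HT] := cvg_geometric (K * (1 + (1 - s)^-1)) h.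
  exists T; have := HT T (leqnn T); rewrite /= sub0r normrN.
  by apply: le_trans; exact: ler_norm.
have [N HN] : exists N : nat, 4 * A T / e <= N%:R.
  by exists (Num.truncn `|4 * A T / e|).+1; apply: le_trans (ler_norm _) _; rewrite ltW// truncnS_gt.
exists N => n Nn; apply: le_trans (main n T) _; rewrite lee_fin.
have n0 : 0 < (n.+1%:R : R) by rewrite ltr0n.
have h : 4 * A T / e <= n.+1%:R.
  by apply: le_trans HN _; rewrite ler_nat ltnW.
have : A T / n.+1%:R <= e / 4.
  by rewrite ler_pdivrMr//; move: h; rewrite ler_pdivrMr//; lra.
move: HT; set x := _ * s ^+ T; set z := A T / _; lra.
Qed.
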